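(* Consider the time-invariant game $\Gamma$ described in the context. Let the Graph Assumption, the Game Assumption, the Lipschitz Assumption and the Oracle Assumption (all stated in the context) hold, and suppose the pseudo-gradient $G$ is $\mu$-strongly monotone for some $\mu>0$: $\langle G(x)-G(x'),x-x'\rangle\ge\mu\|x-x'\|^2$ for all $x,x'\in X_1\times\cdots\times X_N$. Let $\alpha_0=\beta_0=\gamma_0=1$ and, for $t\ge1$, $$\alpha_t=\frac1{t^{a_1}},\qquad\beta_t=\frac1{t^{a_2}},\qquad\gamma_t=\frac1{t^{a_3}},$$ where $0<a_1,a_3<1$, $a_1>2a_2>0$ and $2a_2+a_3<1$. Then for any $0<\delta<1$ and $T\ge4$, with probability at least $1-\delta$, the sequence $\{x_t\}$ generated by the algorithm in the context satisfies $$\|\bar x_T-x^*\|^2=\mathcal{O}\Big(T^{-\min\{1-a_1,\,1-2a_2-a_3,\,a_3,\,a_2,\,a_1-2a_2\}}+T^{-(1-a_1)}\ln\tfrac1\delta\Big),$$ where $\bar x_T=\frac1T\sum_{t=1}^Tx_t$, $x^*$ is the variational generalized Nash equilibrium (vGNE) of $\Gamma$, and the constant hidden in $\mathcal{O}(\cdot)$ does not depend on $T$ or $\delta$.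
   Context: Game. There are $N$ players, $[N]=\{1,\dots,N\}$. Player $i$ has a local set $X_i\subseteq\mathbb{R}^{d_i}$; $d=\sum_i d_i$; $x=\mathrm{col}\{x_i\}_{i\in[N]}\in\mathbb{R}^d$ is the stacked vector, $x_{-i}$ is $x$ without block $i$. Given $\psi_i:\mathbb{R}^{d_i}\to\mathbb{R}^n$, put $\sigma(x)=\frac1N\sum_{i=1}^N\psi_i(x_i)$ and $\sigma(x_{-i})=\frac1N\sum_{j\ne i}\psi_j(x_j)$. Player $i$ has a (time-invariant) cost $f_i(x_i,\sigma)=\mathbb{E}[F_i(x_i,\sigma,\xi_i)]$, where $\xi_i$ is a random vector in $\mathbb{R}^{q_i}$ and $F_i:\mathbb{R}^{d_i}\times\mathbb{R}^n\times\mathbb{R}^{q_i}\to\mathbb{R}$ is differentiable in $(x_i,\sigma)\in X_i\times\mathbb{R}^n$ for each fixed value of $\xi_i$, and a (time-invariant) constraint function $g_i:\mathbb{R}^{d_i}\to\mathbb{R}^m$ with components $g_{ij}$. Put $g(x)=\sum_{i=1}^N g_i(x_i)$ and $X=(X_1\times\cdots\times X_N)\cap\{x: g(x)\le \mathbf 0\}$. $\nabla_1,\nabla_2$ denote (column) gradients with respect to the first and second arguments; $\nabla\psi_i(x_i)\in\mathbb{R}^{d_i\times n}$ is the transposed Jacobian; $\nabla g_i=(\nabla g_{i1},\dots,\nabla g_{im})\in\mathbb{R}^{d_i\times m}$. Define $p_i(x_i,y)=\nabla_1 f_i(x_i,y)+\frac{\nabla\psi_i(x_i)}{N}\nabla_2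 f_i(x_i,y)$ and $q_i(x_i,y,\xi)=\nabla_1F_i(x_i,y,\xi)+\frac{\nabla\psi_i(x_i)}{N}\nabla_2F_i(x_i,y,\xi)$. The pseudo-gradient is $G(x)=\mathrm{col}\{p_i(x_i,\sigma(x))\}_{i\in[N]}$. At each $t\ge0$ player $i$ draws a sample $\xi_{i,t}$ of $\xi_i$. Filtration: $\mathcal{F}_0$ is trivial and $\mathcal{F}_t$ is the $\sigma$-algebra generated by $\{\xi_{i,s}: i\in[N],0\le s\le t-1\}$ for $t\ge1$. $\|\cdot\|$ is the Euclidean norm, $\Pi_X$ the Euclidean projection onto $X$, $[\cdot]_+$ the projection onto the nonnegative orthant. Equilibria. $x^*\in X$ is a GNE of $\Gamma$ if for each $i$, $x_i^*$ minimizes $f_i\big(x_i,\frac1N\psi_i(x_i)+\sigma(x_{-i}^* )\big)$ over $x_i\in X_i$ subject to $g_i(x_i)+\sum_{j\neq i}g_j(x_j^* )\le\mathbf 0$. A vGNE is a GNE for which the KKT conditions hold with a common multiplier $\mu^*\in\mathbb{R}^m_+$ for all players: $\mathbf 0\in p_i(x_i^*,\sigma(x^* ))+\nabla g_i(x_i^* )\mu^*+\mathbf{N}_{X_i}(x_i^* )$ for all $i\in[N]$ and $\mathbf 0\in -g(x^* )+\mathbf{N}_{\mathbb{R}^m_+}(\mu^* )$, where $\mathbf{N}_C(x)=\{s:s^{\top}(y-x)\le0\ \forall y\in C\}$. Under the assumptions of the claim the vGNE exists and is unique. Algorithm. $\mathcal{W}_t=[w_{ij,t}]\in\mathbb{R}^{N\times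 N}$ is the weighted adjacency matrix of the directed graph $\mathcal{G}_t=([N],\mathcal{E}_t)$: $w_{ij,t}>0$ if $(j,i)\in\mathcal{E}_t$, $w_{ij,t}=0$ otherwise, and $w_{ii,t}>0$. The parameters $\alpha_t,\beta_t,\gamma_t\in(0,1]$ are non-increasing in $t$. Initialize $z_{i,0}=1$, $x_{i,0}\in X_i$, $\mu_{i,0}=\mathbf 0\in\mathbb{R}^m$, $\sigma_{i,0}=\psi_i(x_{i,0})$, and for $t\ge0$: $z_{i,t+1}=\sum_j w_{ij,t}z_{j,t}$; $\hat\mu_{i,t}=\sum_j w_{ij,t}\mu_{j,t}$; $\hat\sigma_{i,t}=\sum_j w_{ij,t}\sigma_{j,t}$; $s_{i,t+1}=q_i\big(x_{i,t},\hat\sigma_{i,t}/z_{i,t+1},\xi_{i,t}\big)+\nabla g_i(x_{i,t})\,\hat\mu_{i,t}/z_{i,t+1}$; $x_{i,t+1}=\Pi_{X_i}[x_{i,t}-\alpha_t s_{i,t+1}]$; $\mu_{i,t+1}=[\hat\mu_{i,t}+\gamma_t(g_i(x_{i,t})-\beta_t\hat\mu_{i,t})]_+$; $\sigma_{i,t+1}=\hat\sigma_{i,t}+\psi_i(x_{i,t+1})-\psi_i(x_{i,t})$. Write $x_t=\mathrm{col}\{x_{i,t}\}_{i\in[N]}$. Graph Assumption. For all $t\ge0$: (i) there is a constant $\underline w\in(0,1)$ with $w_{ij,t}\ge\underline w$ whenever $w_{ij,t}>0$; (ii) $\mathcal{W}_t$ is column-stochastic, $\sum_i w_{ij,t}=1$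 for all $j$; (iii) there is an integer $U>0$ such that the graph $([N],\bigcup_{l=0}^{U-1}\mathcal{E}_{t+l})$ is strongly connected for all $t$. Game Assumption. (i) Each $X_i$ is nonempty, convex, compact. (ii) $X$ is nonempty and satisfies Slater's constraint qualification. (iii) For all $i$, $f_i(x_i,\sigma)$ is differentiable in $(x_i,\sigma)\in X_i\times\mathbb{R}^n$ and $x_i\mapsto f_i(x_i,\sigma(x))$ is convex on $X_i$ for any given $x_{-i}\in\mathbb{R}^{d-d_i}$. (iv) Each $g_{ij}$ is differentiable and convex on $X_i$. (v) Each $\psi_i$ is differentiable and $L_\sigma$-Lipschitz on $X_i$ ($L_\sigma>0$). There are constants $L,M>0$ such that $\|x_i\|\le L$, $\|g_i(x_i)\|\le L$, $\|\nabla g_i(x_i)\|\le M$ for all $i\in[N]$, $x_i\in X_i$. Lipschitz Assumption. For all $i\in[N]$ and $x_i\in X_i$, $y\mapsto p_i(x_i,y)$ is $L_f$-Lipschitz on $\mathbb{R}^n$ ($L_f>0$). Oracle Assumption. For all $t\ge0$, $i\in[N]$ and all $\mathcal{F}_t$-measurable $x_i\in X_i$, $y\in\mathbb{R}^n$: (i) $\mathbb{E}[q_i(x_i,y,\xi_{i,t})\mid\mathcal{F}_t]=p_i(x_i,y)$; (ii) $\mathbb{E}[\exp(\|q_i(x_i,y,\xi_{i,t})-p_i(x_i,y)\|^2/\iota^2)\mid\mathcal{F}_t]\le\exp(1)$ for some constant $\iota>0$; (iii) $\|q_i(x_i,y,\xi_{i,t})\|\le S$ for some constant $S>0$. *)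

(* Defs.v *)
From HB Require Import structures.
From mathcomp Require Import all_boot all_order all_algebra.
From mathcomp Require Import all_classical all_reals all_analysis.

Set Implicit Arguments.
Unset Strict Implicit.
Unset Printing Implicit Defensive.

Import Order.TTheory GRing.Theory Num.Theory.
Import numFieldNormedType.Exports.

Local Open Scope classical_set_scope.
Local Open Scope ring_scope.

(* Vectors of R^k are rows 'rV[R]_k, so a column
   identity A v (A : d x n) is written v *m A^T. The norm `|_| of the library on
   matrices is the sup norm; it is used only through the topology and
   differentiability it induces, which are those of the Euclidean norm. *)

(* Euclidean norm of a row vector; Frobenius norm of a matrix. *)
Definition enorm (R : realType) (p q : nat) (A : 'M[R]_(p, q)) : R :=
  Num.sqrt (\sum_i \sum_j A i j ^+ 2).

Definition dotp (R : realType) (k : nat) (u v : 'rV[R]_k) : R :=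
  \sum_j u 0 j * v 0 j.

Definition vle (R : realType) (k : nat) (u v : 'rV[R]_k) : Prop :=
  forall j, u 0 j <= v 0 j.

Definition nonneg_orthant (R : realType) (k : nat) : set 'rV[R]_k :=
  [set v | vle 0 v].

(* The point of C nearest to v; 0 if there is none. *)
Definition eproj (R : realType) (k : nat) (C : set 'rV[R]_k) (v : 'rV[R]_k) :
    'rV[R]_k :=
  xget 0 [set p | C p /\ forall y, C y -> enorm (v - p) <= enorm (v - y)].

Arguments nonneg_orthant R k : clear implicits.

Definition normal_cone (R : realType) (k : nat) (C : set 'rV[R]_k)
    (x : 'rV[R]_k) : set 'rV[R]_k :=
  [set s | forall y, C y -> dotp s (y - x) <= 0].

Definition grad (R : realType) (k : nat) (h : 'rV[R]_k -> R) (x : 'rV[R]_k) :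
    'rV[R]_k :=
  \row_j 'd (h : 'rV[R]_k -> R^o) x (delta_mx 0 j).

(* ['J h x] has entry (k, l) equal to the k-th partial derivative of the l-th
   component of h: it is the transposed Jacobian. *)
Definition own_grad (R : realType) (N k n : nat) (psi : 'rV[R]_k -> 'rV[R]_n)
    (h : 'rV[R]_k -> 'rV[R]_n -> R) (x : 'rV[R]_k) (y : 'rV[R]_n) : 'rV[R]_k :=
  grad (h^~ y) x + N%:R^-1 *: (grad (h x) y *m ('J psi x)^T).

Record game (R : realType) (N n m : nat) := Game {
  dim : 'I_N -> nat;
  noise_dim : 'I_N -> nat;
  strat : forall i, set 'rV[R]_(dim i);
  psi : forall i, 'rV[R]_(dim i) -> 'rV[R]_n;
  sample_cost : forall i,
    'rV[R]_(dim i) -> 'rV[R]_n -> 'rV[R]_(noise_dim i) -> R;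
  constr : forall i, 'rV[R]_(dim i) -> 'rV[R]_m
}.

Arguments strat {R N n m} g i _.
Arguments psi {R N n m} g i _.
Arguments sample_cost {R N n m} g i _ _ _.
Arguments constr {R N n m} g i _.

Definition profile (R : realType) (N n m : nat) (Gm : game R N n m) : Type :=
  forall i : 'I_N, 'rV[R]_(dim Gm i).

Definition noise (R : realType) (N n m : nat) (Gm : game R N n m) : Type :=
  forall i : 'I_N, 'rV[R]_(noise_dim Gm i).

Definition cost_fun (R : realType) (N n m : nat) (Gm : game R N n m) : Type :=
  forall i : 'I_N, 'rV[R]_(dim Gm i) -> 'rV[R]_n -> R.

Section game_notions.
Context (R : realType) (N n m : nat) (Gm : game R N n m).
Implicit Types (x : profile Gm) (f : cost_fun Gm).

Definition stack x : 'rV[R]_(\sum_i dim Gm i) := \mxrow_i x i.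

Definition sigma x : 'rV[R]_n := N%:R^-1 *: \sum_i psi Gm i (x i).

Definition sigma_minus (i : 'I_N) x : 'rV[R]_n :=
  N%:R^-1 *: \sum_(j | j != i) psi Gm j (x j).

Definition in_prod x : Prop := forall i, strat Gm i (x i).

Definition feasible x : Prop := in_prod x /\ vle (\sum_i constr Gm i (x i)) 0.

Definition p_map f (i : 'I_N) (x : 'rV[R]_(dim Gm i)) (y : 'rV[R]_n) :=
  own_grad N (psi Gm i) (f i) x y.

Definition q_map (i : 'I_N) (x : 'rV[R]_(dim Gm i)) (y : 'rV[R]_n)
    (xi : 'rV[R]_(noise_dim Gm i)) :=
  own_grad N (psi Gm i) (fun u v => sample_cost Gm i u v xi) x y.

Arguments p_map : clear implicits.
Arguments q_map : clear implicits.

Definition pseudo_grad f x : 'rV[R]_(\sum_i dim Gm i) :=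
  \mxrow_i p_map f i (x i) (sigma x).

Definition strongly_monotone f (mu : R) : Prop :=
  forall x x', in_prod x -> in_prod x' ->
    mu * enorm (stack x - stack x') ^+ 2
      <= dotp (pseudo_grad f x - pseudo_grad f x') (stack x - stack x').

Definition is_GNE f (xs : profile Gm) : Prop :=
  feasible xs /\
  forall (i : 'I_N) (u : 'rV[R]_(dim Gm i)), strat Gm i u ->
    vle (constr Gm i u + \sum_(j | j != i) constr Gm j (xs j)) 0 ->
    f i (xs i) (N%:R^-1 *: psi Gm i (xs i) + sigma_minus i xs)
      <= f i u (N%:R^-1 *: psi Gm i u + sigma_minus i xs).

Definition KKT f (xs : profile Gm) (mus : 'rV[R]_m) : Prop :=
  (forall i : 'I_N, exists2 s, normal_cone (strat Gm i) (xs i) s &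
     p_map f i (xs i) (sigma xs)
       + mus *m ('J (constr Gm i) (xs i))^T + s = 0) /\
  (exists2 s, normal_cone (nonneg_orthant R m) mus s &
     - (\sum_i constr Gm i (xs i)) + s = 0).

Definition is_vGNE f (xs : profile Gm) : Prop :=
  is_GNE f xs /\ exists2 mus, nonneg_orthant R m mus & KKT f xs mus.

(* Slater's condition asks for a strictly feasible point of the product of the
   X_i; as these are convex and g is continuous on them, such a point can then
   also be found in the relative interior. *)
Definition game_assumption f (Lsig L M : R) : Prop :=
  [/\ (forall i, [/\ strat Gm i !=set0,
                     convex_set (strat Gm i) &
                     compact (strat Gm i)]),
      (exists x, feasible x) /\
      (exists x, in_prod x /\ forall k, (\sum_i constr Gm i (x i)) 0 k < 0),
      (forall i, (forall (u : 'rV[R]_(dim Gm i)) (y : 'rV[R]_n), strat Gm i u ->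
                    differentiable
                      ((fun v => f i v.1 v.2) :
                         'rV[R]_(dim Gm i) * 'rV[R]_n -> R^o) (u, y)) /\
                 (forall x, convex_function (strat Gm i)
                              (fun u => f i u (sigma (dfwith x i u))))),
      (forall (i : 'I_N) (k : 'I_m),
         (forall u : 'rV[R]_(dim Gm i), strat Gm i u ->
            differentiable ((fun v => constr Gm i v 0 k) :
                              'rV[R]_(dim Gm i) -> R^o) u) /\
         convex_function (strat Gm i) (fun v => constr Gm i v 0 k)) &
      (forall i, (forall u : 'rV[R]_(dim Gm i), strat Gm i u ->
                    differentiable (psi Gm i) u) /\
                 (forall u v : 'rV[R]_(dim Gm i), strat Gm i u -> strat Gm i v ->
                    enorm (psi Gm i u - psi Gm i v) <= Lsig * enorm (u - v))) /\
      (forall (i : 'I_N) (u : 'rV[R]_(dim Gm i)), strat Gm i u ->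
         [/\ enorm u <= L, enorm (constr Gm i u) <= L &
             enorm ('J (constr Gm i) u) <= M])].

Definition lipschitz_assumption f (Lf : R) : Prop :=
  forall (i : 'I_N) (u : 'rV[R]_(dim Gm i)), strat Gm i u ->
    forall y y', enorm (p_map f i u y - p_map f i u y') <= Lf * enorm (y - y').

End game_notions.

Arguments p_map {R N n m Gm} f i x y.
Arguments q_map {R N n m Gm} i x y xi.

(* [edge t j i] is the arc (j, i) from j to i. *)
Definition weighted_adjacency (R : realType) (N : nat)
    (edge : nat -> rel 'I_N) (W : nat -> 'M[R]_N) : Prop :=
  forall t,
    [/\ forall i j, edge t j i -> 0 < W t i j,
        forall i j, i != j -> ~~ edge t j i -> W t i j = 0 &
        forall i, 0 < W t i i].

Definition graph_assumption (R : realType) (N : nat)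
    (edge : nat -> rel 'I_N) (W : nat -> 'M[R]_N) : Prop :=
  [/\ exists w : R, [/\ 0 < w, w < 1 &
        forall t i j, 0 < W t i j -> w <= W t i j],
      forall t j, \sum_i W t i j = 1 &
      exists U : nat, (0 < U)%N /\ forall t i j,
        connect [rel k l | [exists s : 'I_U, edge (t + s)%N k l]] i j].

Definition borel (V : topologicalType) : set (set V) := <<s @open V >>.

Definition meas_wrt (Omega : Type) (V : topologicalType)
    (F : set (set Omega)) (h : Omega -> V) : Prop :=
  forall B, borel B -> F (h @^-1` B).

Section randomness.
Context (d : measure_display) (Omega : measurableType d) (R : realType)
        (P : probability Omega R).

(* Z is a version of the conditional expectation of Y given the sigma-algebra F;
   Y is required to be an integrable random variable. *)
Definition is_cond_exp (F : set (set Omega)) (Y Z : Omega -> R) : Prop :=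
  [/\ P.-integrable setT (EFin \o Y),
      P.-integrable setT (EFin \o Z),
      meas_wrt F (Z : Omega -> R^o) &
      forall A, F A ->
        (\int[P]_(w in A) (Y w)%:E = \int[P]_(w in A) (Z w)%:E)%E].

Context (N n m : nat) (Gm : game R N n m).
Context (xi : forall i : 'I_N, Omega -> 'rV[R]_(noise_dim Gm i))
        (xit : forall i : 'I_N, nat -> Omega -> 'rV[R]_(noise_dim Gm i)).

Definition cost : cost_fun Gm :=
  fun i x y => fine ('E_P[fun w => sample_cost Gm i x y (xi i w)])%E.

(* xi_i is a random vector, each xi_{i,t} is a random
   vector with the law of xi_i, F_i is measurable in the noise and
   differentiable in its first two arguments, and the expectation defining
   f_i exists. *)
Definition stochastic_setting : Prop :=
  [/\ forall i, meas_wrt measurable (xi i),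
      forall i t, meas_wrt measurable (xit i t) /\
        forall B, borel B -> P (xit i t @^-1` B) = P (xi i @^-1` B),
      forall i (x : 'rV[R]_(dim Gm i)) y,
        meas_wrt (@borel _) (sample_cost Gm i x y : _ -> R^o),
      forall i (x : 'rV[R]_(dim Gm i)) (y : 'rV[R]_n)
          (e : 'rV[R]_(noise_dim Gm i)), strat Gm i x ->
        differentiable ((fun v => sample_cost Gm i v.1 v.2 e) :
                          'rV[R]_(dim Gm i) * 'rV[R]_n -> R^o) (x, y) &
      forall i (x : 'rV[R]_(dim Gm i)) y,
        P.-integrable setT (fun w => (sample_cost Gm i x y (xi i w))%:E)].

(* For t = 0 the generating family is empty and the sigma-algebra is trivial. *)
Definition filtration (t : nat) : set (set Omega) :=
  <<s [set A | exists i s B,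
         [/\ (s < t)%N, borel B & A = xit i s @^-1` B] ] >>.

(* (Conditional) identities and bounds between random variables hold almost
   surely. The conditional expectation of a vector is taken coordinatewise. *)
Definition oracle_assumption (iota S : R) : Prop :=
  forall (t : nat) (i : 'I_N)
         (x : Omega -> 'rV[R]_(dim Gm i)) (y : Omega -> 'rV[R]_n),
    meas_wrt (filtration t) x -> meas_wrt (filtration t) y ->
    (forall w, strat Gm i (x w)) ->
    let q := fun w => q_map i (x w) (y w) (xit i t w) in
    let p := fun w => p_map cost i (x w) (y w) in
    [/\ forall k, exists2 Z,
          is_cond_exp (filtration t) (fun w => q w 0 k) Z &
          {ae P, forall w, Z w = p w 0 k},
        exists2 Z,
          is_cond_exp (filtration t)
            (fun w => expR (enorm (q w - p w) ^+ 2 / iota ^+ 2)) Z &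
          {ae P, forall w, Z w <= expR 1} &
        {ae P, forall w, enorm (q w) <= S}].

End randomness.

Record state (R : realType) (N n m : nat) (Gm : game R N n m) := State {
  st_z : 'I_N -> R;
  st_x : profile Gm;
  st_mu : 'I_N -> 'rV[R]_m;
  st_sigma : 'I_N -> 'rV[R]_n
}.

Section algorithm.
Context (R : realType) (N n m : nat) (Gm : game R N n m).

Definition init (x0 : profile Gm) : state Gm :=
  State (fun=> 1) x0 (fun=> 0) (fun i => psi Gm i (x0 i)).

Definition step (W : 'M[R]_N) (alpha beta gamma : R) (xi : noise Gm)
    (st : state Gm) : state Gm :=
  let x := st_x st in
  let z' i := \sum_j W i j * st_z st j in
  let muh i := \sum_j W i j *: st_mu st j in
  let sigmah i := \sum_j W i j *: st_sigma st j in
  let s i := q_map i (x i) ((z' i)^-1 *: sigmah i) (xi i)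
             + ((z' i)^-1 *: muh i) *m ('J (constr Gm i) (x i))^T in
  let x' i := eproj (strat Gm i) (x i - alpha *: s i) in
  State z' x'
    (fun i => eproj (nonneg_orthant R m)
                (muh i + gamma *: (constr Gm i (x i) - beta *: muh i)))
    (fun i => sigmah i + psi Gm i (x' i) - psi Gm i (x i)).

Fixpoint run (W : nat -> 'M[R]_N) (alpha beta gamma : nat -> R)
    (xi : nat -> noise Gm) (x0 : profile Gm) (t : nat) : state Gm :=
  if t is t'.+1 then
    step (W t') (alpha t') (beta t') (gamma t') (xi t')
         (run W alpha beta gamma xi x0 t')
  else init x0.

Definition time_average (x : nat -> profile Gm) (T : nat) : profile Gm :=
  fun i => T%:R^-1 *: \sum_(1 <= t < T.+1) x t i.

End algorithm.

Definition power_step (R : realType) (a : R) (t : nat) : R :=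
  if t is 0 then 1 else (t%:R `^ a)^-1.

(* Main.v *)
(* The push-sum weights z are bounded below, and u/z evolves by row-stochastic
   averaging whenever u is averaged with the column-stochastic weights.  Over
   N * U steps such an averaging contracts the oscillation by a fixed factor, so
   the summed disagreement of the multipliers and of the aggregate estimates is
   bounded by the summed perturbations.

   Divide the primal descent inequality by alpha_t, divide the dual one, weighted
   by z, by gamma_t, and add them up: the terms nu_i . g_i(x_i) - mu* . g(x) cancel
   up to consensus errors; here nu_i is the multiplier estimate mu-hat_i / z_i.  The
   KKT conditions at x*, convexity of g and strong monotonicity then leave
   2 mu ||x_t - x*||^2 bounded by telescoping terms,
   errors of size alpha_t / beta_t^2 + beta_t + gamma_t, and the oracle noise.  As
   the multipliers are O(1/beta_t), Abel summation bounds the telescoping terms by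
   1/alpha_T + 1/(gamma_T beta_T^2).

   The summed noise is a martingale M with bounded differences m_t.  The product
   of the 1 + lam m_t has mean 1, so Markov's inequality and
   exp(y - 2 y^2) <= 1 + y give M <= 2 lam K^2 T + ln(1/delta) / lam with
   probability 1 - delta; lam of order T^(-a1) yields the claimed rate. *)

Require Import Defs.
From HB Require Import structures.
From mathcomp Require Import all_boot all_order all_algebra.
From mathcomp Require Import all_classical all_reals all_analysis.
From mathcomp Require Import measurable_realfun.
From mathcomp Require Import ring lra.

Set Implicit Arguments.
Unset Strict Implicit.
Unset Printing Implicit Defensive.

Import Order.TTheory GRing.Theory Num.Theory.
Import numFieldNormedType.Exports.

Local Open Scope classical_set_scope.
Local Open Scope ring_scope.

(** * Consensus over a jointly connected sequence of graphs *)

(** The matrices W_t have unit column sums, but their rows need not sum to one. Jensen's inequality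
    for the multiplier ratios at node i uses the weights w_ij z_j / z_i'. Multiplied by z_i' and
    summed over i, these collapse to column sums, so averaging does not increase the z-weighted
    squared distance to mu*. The coupling terms of the primal and dual inequalities cancel because
    each inequality is divided by its own step size, after which both carry the factor 2. No bound
    on the multipliers uniform in t is at hand: the regularization only keeps mu_i below a constant
    times z_i / beta_t, and this is the source of every power of 1/beta_t.

    The second obstacle is measurability. The oracle speaks only about points measurable with
    respect to the past, so the whole state has to be shown adapted, including derivatives of F_i at
    random points, while F_i is given as measurable in the noise for fixed arguments only. The
    oracle bounds also hold merely almost surely, so the noise is replaced by versions bounded
    everywhere before any product is formed. *)

Section spreading.
Context (R : realType) (N : nat) (edge : nat -> rel 'I_N) (U : nat).
Hypothesis conn : forall t i j,
  connect [rel k l | [exists s : 'I_U, edge (t + s)%N k l]] i j.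
Context (w : R) (w_ge0 : 0 <= w).

Lemma loop_growth (v : nat -> 'I_N -> R) (i : 'I_N) (s l : nat) :
  (forall s, w * v s i <= v s.+1 i) -> w ^+ l * v s i <= v (s + l)%N i.
Proof.
move=> H; elim: l => [|l IH]; first by rewrite expr0 mul1r addn0.
rewrite addnS; apply: le_trans (H _); rewrite exprS -mulrA.
exact: ler_wpM2l.
Qed.

(* The set of nodes reached from j grows by at least one node every U steps. *)
Lemma spread_all (v : nat -> 'I_N -> R) (t0 : nat) :
  (forall s i j, edge (t0 + s)%N j i || (i == j) -> w * v s j <= v s.+1 i) ->
  forall i j, w ^+ (N * U) * v 0%N j <= v (N * U)%N i.
Proof.
move=> H i j.
have loop l s k : w ^+ l * v s k <= v (s + l)%N k.
  by apply: loop_growth => s'; apply: H; rewrite eqxx orbT.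
pose A k : {set 'I_N} := [set i | w ^+ (k * U) * v 0%N j <= v (k * U)%N i]%SET.
have AS k : A k \subset A k.+1.
  apply/fintype.subsetP => a; rewrite !inE mulSnr exprD => Ha.
  apply: le_trans (loop _ _ _); rewrite mulrAC mulrC.
  by apply: ler_wpM2l; rewrite ?exprn_ge0.
have jA k : j \in A k by rewrite inE; exact: loop.
have card k : (k < N -> k.+1 <= #|A k|)%N.
  elim: k => [|k IH] kN; first by rewrite card_gt0; apply/set0Pn; exists j.
  have {}IH := IH (ltnW kN).
  have [/forallP Aall|] := boolP [forall a, a \in A k].
    rewrite (_ : A k.+1 = [set: 'I_N]%SET) ?cardsT ?card_ord //.
    by apply/setP => a; rewrite finset.in_setT (fintype.subsetP (AS k)).
  rewrite negb_forall => /existsP[b bA].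
  suff [a [c [s]]] : exists a c (s : 'I_U),
      [/\ a \in A k, c \notin A k & edge (t0 + k * U + s)%N a c].
    case=> aA cA ed; apply: leq_ltn_trans IH _; apply: proper_card.
    rewrite properE AS /=; apply/subsetPn; exists c => //.
    have sU := ltn_ord s.
    rewrite inE in aA.
    (* The value stays at a through its self-loop for s steps, crosses the arc to c, and stays at c
       for the remaining [U - s.+1] steps of the window: [U] factors [w] in all. *)
    have h1 := ler_wpM2l (exprn_ge0 s w_ge0) aA.
    have h2 := ler_wpM2l w_ge0 (le_trans h1 (loop s _ a)).
    have h3 := le_trans h2 (H (k * U + s)%N c a _).
    rewrite addnA ed in h3.
    have := le_trans (ler_wpM2l (exprn_ge0 (U - s.+1) w_ge0) (h3 isT)) (loop _ _ c).
    have -> : ((k * U + s).+1 + (U - s.+1) = k.+1 * U)%N.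
      by rewrite -addnS -addnA subnKC // mulSnr.
    by rewrite inE !mulrA -!exprSr -!exprD addSnnS subnK // mulSn.
  (* If no arc of the window left [A k], every path from j would end in [A k]; but some path reaches
     b. *)
  apply/not_existsP => Hno; move: bA; apply/negP; rewrite negbK.
  have /connectP[p] := conn (t0 + k * U)%N j b.
  have : j \in A k by [].
  move: {1 2 3}j; elim: p => [|a p IHp] c cA /=; first by move=> _ ->.
  move=> /andP[/existsP[s ed] pp] bl; apply: (IHp a) => //.
  by apply/negPn/negP => aA; apply: (Hno c); exists a, s.
have N0 : (0 < N)%N by case: i => i /=; apply: leq_ltn_trans.
have : A N = [set: 'I_N]%SET.
  apply/eqP; rewrite eqEcard finset.subsetT cardsT card_ord /=.
  rewrite -[X in (X <= _)%N](prednK N0).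
  apply: leq_trans (card N.-1 _) _; first by rewrite prednK.
  by apply: subset_leq_card; have := AS N.-1; rewrite (prednK N0).
by move=> /setP/(_ i); rewrite !inE.
Qed.

End spreading.

Lemma sum_shift_le (R : realType) (eps : nat -> R) (l B T : nat) :
  (forall t, 0 <= eps t) -> (l <= B)%N ->
  \sum_(0 <= t < T) eps (t + l)%N <= \sum_(0 <= t < T + B) eps t.
Proof.
move=> e0 lB.
have <- : \sum_(0 + l <= t < T + l) eps t = \sum_(0 <= t < T) eps (t + l)%N.
  by rewrite big_addn addnK.
rewrite add0n [leRHS](big_cat_nat (n := l)) //=; last exact: leq_trans lB (leq_addl _ _).
rewrite [X in _ + X](big_cat_nat (n := T + l)) ?leq_addl ?leq_add2l //=.
by rewrite addrCA lerDl addr_ge0 // sumr_ge0.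
Qed.

(** Summing the recursion over t controls the sum shifted by [B]. The shift loses only the first [B]
    terms, and each [eps] is counted at most [B] times. *)
Lemma summable_recursion (R : realType) (D eps : nat -> R) (B T : nat) (rho : R) :
  (forall t, 0 <= D t) -> (forall t, 0 <= eps t) -> rho <= 1 ->
  (forall t, D (t + B)%N <= (1 - rho) * D t
                            + 2 * \sum_(0 <= l < B) eps (t + l)%N) ->
  rho * \sum_(0 <= t < T) D t <=
    \sum_(0 <= t < B) D t + 2 * B%:R * \sum_(0 <= t < T + B) eps t.
Proof.
move=> D0 e0 r1 H.
have H1 : \sum_(0 <= t < T) D (t + B)%N <= (1 - rho) * \sum_(0 <= t < T) D t
    + 2 * B%:R * \sum_(0 <= t < T + B) eps t.
  apply: (@le_trans _ _ (\sum_(0 <= t < T) ((1 - rho) * D t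
      + 2 * \sum_(0 <= l < B) eps (t + l)%N))); first by apply: ler_sum => t _.
  rewrite big_split /= -!mulr_sumr lerD2l -mulrA ler_pM2l // exchange_big /=.
  rewrite big_mkord mulr_natl -[X in _ *+ X]card_ord -sumr_const.
  by apply: ler_sum => l _; apply: sum_shift_le => //; exact: ltnW.
have H2 : \sum_(0 <= t < T) D t <=
    \sum_(0 <= t < B) D t + \sum_(0 <= t < T) D (t + B)%N.
  have -> : \sum_(0 <= t < T) D (t + B)%N = \sum_(B <= t < T + B) D t.
    by rewrite -{2}[B]add0n big_addn addnK.
  rewrite -big_cat_nat ?leq_addl //= [leRHS](big_cat_nat (n := T)) ?leq_addr //=.
  by rewrite lerDl sumr_ge0.
lra.
Qed.

Section consensus.
Context (R : realType) (N : nat) (edge : nat -> rel 'I_N) (U : nat).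
Hypothesis conn : forall t i j,
  connect [rel k l | [exists s : 'I_U, edge (t + s)%N k l]] i j.
Context (k : R) (k_ge0 : 0 <= k) (A : nat -> 'M[R]_N).
Hypothesis A_ge0 : forall t i j, 0 <= A t i j.
Hypothesis A_sum : forall t i, \sum_j A t i j = 1.
Hypothesis A_lb : forall t i j, edge t j i || (i == j) -> k <= A t i j.
Hypothesis N0 : (0 < N)%N.
Let B := (N * U)%N.

(** Subtracting the floor [a] and adding the perturbations accumulated so far makes the sequence
    nonnegative and at least its own average, so [spread_all] applies to it. *)
Lemma stochastic_lb (v : nat -> 'I_N -> R) (eps : nat -> R) (t : nat) (a : R) :
  (forall s i, \sum_j A s i j * v s j - eps s <= v s.+1 i) ->
  (forall j, a <= v t j) ->
  forall i j, a + k ^+ B * (v t j - a) - \sum_(0 <= l < B) eps (t + l)%N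
                <= v (t + B)%N i.
Proof.
move=> Hv Ha i j.
pose u s i := v (t + s)%N i - a + \sum_(0 <= l < s) eps (t + l)%N.
have Hu s i' : \sum_j A (t + s)%N i' j * u s j <= u s.+1 i'.
  rewrite /u big_nat_recr //= addnS.
  under eq_bigr do rewrite -addrA mulrDr.
  rewrite big_split /= -mulr_suml A_sum mul1r.
  have := Hv (t + s)%N i'; lra.
have u0 s i' : 0 <= u s i'.
  elim: s i' => [|s IH] i'.
    by rewrite /u addn0 big_geq // addr0 subr_ge0.
  by apply: le_trans (Hu _ _); apply: sumr_ge0 => l _; rewrite mulr_ge0.
have Hku s i' j' : edge (t + s)%N j' i' || (i' == j') -> k * u s j' <= u s.+1 i'.
  move=> e; apply: le_trans (Hu s i'); rewrite (bigD1 j') //=.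
  apply: ler_wpDr; first by apply: sumr_ge0 => l _; rewrite mulr_ge0.
  by rewrite ler_wpM2r // A_lb.
have := spread_all conn k_ge0 Hku i j.
by rewrite /u addn0 big_geq // addr0 -/B; lra.
Qed.

Lemma lb_le1 : k <= 1.
Proof.
pose i0 := Ordinal N0; rewrite -(A_sum 0%N i0) (bigD1 i0) //=.
by apply: ler_wpDr; [exact: sumr_ge0 | apply: A_lb; rewrite eqxx orbT].
Qed.

Context (r : nat -> 'I_N -> R) (eps : nat -> R).
Hypothesis r_step : forall t i, `|r t.+1 i - \sum_j A t i j * r t j| <= eps t.

Definition osc t := \big[Num.max/0]_(p : 'I_N * 'I_N) `|r t p.1 - r t p.2|.

Lemma osc_ge0 t : 0 <= osc t.
Proof. exact: bigmax_ge_id. Qed.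

Lemma osc_ub t i j : `|r t i - r t j| <= osc t.
Proof. exact: (le_bigmax _ (fun p : 'I_N * 'I_N => `|r t p.1 - r t p.2|) (i, j)). Qed.

Lemma osc_contraction t :
  osc (t + B)%N <= (1 - k ^+ B) * osc t + 2 * \sum_(0 <= l < B) eps (t + l)%N.
Proof.
pose i0 := Ordinal N0.
have eps_ge0 s : 0 <= eps s by apply: le_trans (r_step s i0).
have E0 : 0 <= \sum_(0 <= l < B) eps (t + l)%N by apply: sumr_ge0.
have [a Ha] : exists a, forall j, r t a <= r t j.
  by case: (@arg_minP _ _ _ i0 xpredT (r t)) => // a _ Ha; exists a => j; apply: Ha.
have [b Hb] : exists b, forall j, r t j <= r t b.
  by case: (@arg_maxP _ _ _ i0 xpredT (r t)) => // b _ Hb; exists b => j; apply: Hb.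
have lo i : r t a + k ^+ B * (r t b - r t a) - \sum_(0 <= l < B) eps (t + l)%N
    <= r (t + B)%N i.
  apply: stochastic_lb => // s j; have := r_step s j.
  by rewrite ler_norml => /andP[]; lra.
have hi i : r (t + B)%N i <= r t b + \sum_(0 <= l < B) eps (t + l)%N.
  have H := @stochastic_lb (fun s i => - r s i) eps t (- r t b) _ _ i b.
  rewrite subrr mulr0 addr0 in H.
  suff : - r t b - \sum_(0 <= l < B) eps (t + l)%N <= - r (t + B)%N i by lra.
  apply: H => [s j|j]; last by rewrite lerN2.
  under eq_bigr do rewrite mulrN.
  rewrite sumrN; have := r_step s j.
  by rewrite ler_norml => /andP[]; lra.
have ba : 0 <= r t b - r t a by rewrite subr_ge0.
have oab : r t b - r t a <= osc t by apply: le_trans (osc_ub t b a); exact: ler_norm.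
have kB1 := exprn_ile1 B k_ge0 lb_le1 : k ^+ B <= 1.
have main : r t b - r t a - k ^+ B * (r t b - r t a)
    + 2 * \sum_(0 <= l < B) eps (t + l)%N
  <= (1 - k ^+ B) * osc t + 2 * \sum_(0 <= l < B) eps (t + l)%N by nra.
apply: bigmax_le => [|[i j] _ /=].
  by rewrite addr_ge0 ?mulr_ge0 ?subr_ge0 ?osc_ge0.
apply: le_trans main; rewrite ler_norml.
have := lo i; have := lo j; have := hi i; have := hi j.
by move=> *; apply/andP; split; lra.
Qed.

(** Two convex combinations of the same values are compared. It is used for the one formed by a node
    and for the z-weighted one, which is the exact network mean. *)
Lemma osc_averages t (a b : 'I_N -> R) :
  (forall i, 0 <= a i) -> (forall i, 0 <= b i) -> \sum_i a i = 1 -> \sum_i b i = 1 ->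
  `|\sum_i a i * r t i - \sum_i b i * r t i| <= osc t.
Proof.
move=> a0 b0 a1 b1.
have near m : `|\sum_p a p * r t p - r t m| <= osc t.
  have -> : \sum_p a p * r t p - r t m = \sum_p a p * (r t p - r t m).
    under [RHS]eq_bigr do rewrite mulrBr.
    by rewrite sumrB -mulr_suml a1 mul1r.
  apply: le_trans (ler_norm_sum _ _ _) _.
  rewrite -[leRHS]mul1r -a1 mulr_suml; apply: ler_sum => p _.
  by rewrite normrM ger0_norm // ler_wpM2l // osc_ub.
have -> : \sum_p a p * r t p - \sum_p b p * r t p =
    \sum_q b q * (\sum_p a p * r t p - r t q).
  under [RHS]eq_bigr do rewrite mulrBr.
  by rewrite sumrB -mulr_suml b1 mul1r.
apply: le_trans (ler_norm_sum _ _ _) _.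
rewrite -[leRHS]mul1r -b1 mulr_suml; apply: ler_sum => p _.
by rewrite normrM ger0_norm // ler_wpM2l // near.
Qed.

Lemma osc_step t : osc t.+1 <= osc t + 2 * eps t.
Proof.
have eps_ge0 s : 0 <= eps s by apply: le_trans (r_step s (Ordinal N0)).
apply: bigmax_le => [|[i j] _ /=]; first by rewrite addr_ge0 ?osc_ge0 ?mulr_ge0.
have : `|\sum_p A t i p * r t p - \sum_p A t j p * r t p| <= osc t by exact: osc_averages.
have := r_step t i; have := r_step t j.
rewrite !ler_norml => /andP[? ?] /andP[? ?] /andP[? ?].
by apply/andP; split; lra.
Qed.

(** The uniform bound [e0] pays for the two ends of the window: the first [B] oscillations grow by
    at most [2 * e0] per step, and the [B] perturbations after time [T] are at most [e0] each. *)
Lemma sum_osc_le (e0 : R) (T : nat) :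
  (forall t, eps t <= e0) ->
  k ^+ B * \sum_(0 <= t < T) osc t <=
  B%:R * (osc 0 + 2 * B%:R * e0) + 2 * B%:R * (\sum_(0 <= t < T) eps t + B%:R * e0).
Proof.
move=> He; have eps_ge0 s : 0 <= eps s by apply: le_trans (r_step s (Ordinal N0)).
have e00 : 0 <= e0 by apply: le_trans (He 0%N).
have := @summable_recursion R osc eps B T (k ^+ B) osc_ge0 eps_ge0.
move=> /(_ (exprn_ile1 B k_ge0 lb_le1) osc_contraction) /le_trans; apply.
apply: lerD.
  rewrite mulr_natl -[X in _ *+ X](card_ord B) -sumr_const -(big_mkord xpredT (fun _ => _)).
  apply: ler_sum_nat => t /= tB.
  apply: (@le_trans _ _ (osc 0 + 2 * t%:R * e0)).
    elim: t {tB} => [|t IH]; first by rewrite mulr0 mul0r addr0.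
    apply: le_trans (osc_step t) _; have := He t; rewrite -addn1 natrD; lra.
  by rewrite lerD2l ler_wpM2r // ler_wpM2l // ler_nat ltnW.
rewrite ler_wpM2l ?mulr_ge0 // (big_cat_nat (n := T)) ?leq_addr //= lerD2l.
rewrite -{1}[T]add0n big_addn addnC addnK.
rewrite mulr_natl -[X in _ *+ X](card_ord B) -sumr_const -(big_mkord xpredT (fun _ => _)).
by apply: ler_sum.
Qed.

End consensus.

(** * Push-sum: ratios turn column-stochastic into row-stochastic averaging *)

Fixpoint push_weight (R : realType) (N : nat) (W : nat -> 'M[R]_N) (t : nat)
    (i : 'I_N) : R :=
  if t is t'.+1 then \sum_j W t' i j * push_weight W t' j else 1.

Section push_sum.
Context (R : realType) (N : nat) (edge : nat -> rel 'I_N) (U : nat).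
Hypothesis conn : forall t i j,
  connect [rel k l | [exists s : 'I_U, edge (t + s)%N k l]] i j.
Context (w : R) (w_gt0 : 0 < w) (W : nat -> 'M[R]_N).
Hypothesis W_ge0 : forall t i j, 0 <= W t i j.
Hypothesis W_sum : forall t j, \sum_i W t i j = 1.
Hypothesis W_lb : forall t i j, edge t j i || (i == j) -> w <= W t i j.
Hypothesis N_gt0 : (0 < N)%N.
Let B := (N * U)%N.
Let z := push_weight W.

Lemma push_lb_le1 : w <= 1.
Proof.
pose i0 := Ordinal N_gt0; rewrite -(W_sum 0%N i0) (bigD1 i0) //=.
by apply: ler_wpDr; [exact: sumr_ge0 | apply: W_lb; rewrite eqxx orbT].
Qed.

Lemma push_weight_ge0 t i : 0 <= z t i.
Proof.
elim: t i => [|t IH] i; first by rewrite /z /=.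
by apply: sumr_ge0 => j _; rewrite mulr_ge0 //; exact: IH.
Qed.

Lemma push_weight_sum t : \sum_i z t i = N%:R.
Proof.
elim: t => [|t IH]; first by rewrite sumr_const card_ord.
rewrite /z /= exchange_big /= -IH; apply: eq_bigr => j _.
by rewrite -mulr_suml W_sum mul1r.
Qed.

Lemma push_weight_le t i : z t i <= N%:R.
Proof.
rewrite -(push_weight_sum t) (bigD1 i) //= lerDl.
by apply: sumr_ge0 => j _; exact: push_weight_ge0.
Qed.

Lemma push_weight_step t i j :
  edge t j i || (i == j) -> w * z t j <= z t.+1 i.
Proof.
move=> e; rewrite /z /= (bigD1 j) //= -/(z t j).
apply: ler_wpDr.
  by apply: sumr_ge0 => k _; rewrite mulr_ge0 //; exact: push_weight_ge0.
by rewrite ler_wpM2r ?W_lb //; exact: push_weight_ge0.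
Qed.

(** The weights sum to N, so at time [t - B] some node has weight at least 1, and [B] steps carry
    the fraction [w ^+ B] of it to every node. Before time [B] the self-loops alone suffice. *)
Lemma push_weight_lb t i : w ^+ B <= z t i.
Proof.
have w1 := push_lb_le1.
have [Bt|tB] := leqP B t; last first.
  have /= := @loop_growth R N w (ltW w_gt0) z i 0 t
    (fun s => push_weight_step (introT orP (or_intror (eqxx i)))).
  rewrite mulr1; apply: le_trans.
  by rewrite ler_wiXn2l // ?(ltW w_gt0) // ltnW.
have [j zj] : exists j, 1 <= z (t - B)%N j.
  apply/not_existsP => H.
  suff : \sum_i z (t - B)%N i < N%:R by rewrite push_weight_sum ltxx.
  rewrite -[X in _ < X%:R]card_ord -sumr_const.
  apply: ltr_sum => [|k _]; last by rewrite ltNge; apply/negP/H.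
  by apply/hasP; exists i; rewrite ?mem_index_enum.
have := @spread_all R N edge U conn w (ltW w_gt0) (fun s => z (t - B + s)%N)
  (t - B)%N _ i j.
rewrite addn0 subnK // => H; apply: le_trans (H _).
  by rewrite ler_peMr ?exprn_ge0 ?(ltW w_gt0).
by move=> s k l e; rewrite addnS; exact: push_weight_step.
Qed.

Lemma push_weight_gt0 t i : 0 < z t i.
Proof. by apply: lt_le_trans (push_weight_lb t i); rewrite exprn_gt0. Qed.

(** The ratio u/z evolves with the row-stochastic matrix [A], whose entries along arcs are at least
    [w * eta / N] because z lies between [eta] and N. The mean of u is the average of u/z with
    weights z/N, hence within the oscillation. The constant precedes the sequences, so it serves all
    noise paths at once. *)
Lemma push_sum_consensus : exists2 C : R, 0 < C &
  forall (u : nat -> 'I_N -> R) (e : nat -> R) (e0 : R),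
    (forall t i, `|u t.+1 i - \sum_j W t i j * u t j| <= e t) ->
    (forall t, e t <= e0) ->
  exists2 D : nat -> R,
    forall t i, `|(z t.+1 i)^-1 * (\sum_j W t i j * u t j)
                  - N%:R^-1 * \sum_j u t j| <= D t &
    forall T, \sum_(0 <= t < T) D t
      <= C * (\sum_i `|u 0%N i| + e0 + \sum_(0 <= t < T) e t).
Proof.
pose eta := w ^+ B.
have eta0 : 0 < eta by rewrite exprn_gt0.
have N0 : 0 < N%:R :> R by rewrite ltr0n.
pose k := w * eta / N%:R.
have k0 : 0 < k by rewrite divr_gt0 ?mulr_gt0.
pose A t := \matrix_(i, j) (W t i j * z t j / z t.+1 i) : 'M[R]_N.
have z0 := push_weight_gt0.
have zge0 t i := ltW (z0 t i).
have A0 t i j : 0 <= A t i j by rewrite mxE divr_ge0 ?mulr_ge0.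
have A1 t i : \sum_j A t i j = 1.
  under eq_bigr do rewrite mxE.
  by rewrite -mulr_suml -[X in X / _]/(z t.+1 i) divff // gt_eqF.
have Ak t i j : edge t j i || (i == j) -> k <= A t i j.
  move=> e; rewrite mxE /k ler_pM //.
  - by rewrite mulr_ge0 ?ltW.
  - by apply: ler_pM; [exact: ltW|exact: ltW|exact: W_lb|exact: push_weight_lb].
  - by rewrite lef_pV2 ?posrE // push_weight_le.
pose c := 2 * B%:R + 2 * B%:R ^+ 2 : R.
have c0 : 0 <= c by rewrite addr_ge0 ?mulr_ge0 ?exprn_ge0.
(* The summand 1 keeps the constant positive even when [B] is 0. *)
exists ((k ^+ B)^-1 * (2 * B%:R + (c + c + 2*B%:R) / eta) + 1).
  rewrite ltr_pwDr // mulr_ge0 ?invr_ge0 ?exprn_ge0 ?(ltW k0) //.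
  by rewrite addr_ge0 ?divr_ge0 ?addr_ge0 ?mulr_ge0 // ltW.
move=> u e e0 ue ee.
pose r t i := u t i / z t i.
have rW t i j : A t i j * r t j = W t i j * u t j / z t.+1 i.
  by rewrite mxE /r; field; rewrite !gt_eqF.
have rS t i : `|r t.+1 i - \sum_j A t i j * r t j| <= e t / eta.
  under eq_bigr do rewrite rW.
  rewrite -mulr_suml -mulrBl normrM ler_pM // normfV gtr0_norm //.
  by rewrite lef_pV2 ?posrE // push_weight_lb.
have e_ge0 t : 0 <= e t by apply: le_trans (ue t (Ordinal N_gt0)).
have e00 : 0 <= e0 by apply: le_trans (ee 0%N).
exists (osc r) => [t i|T].
  have -> : (z t.+1 i)^-1 * (\sum_j W t i j * u t j) = \sum_j A t i j * r t j.
    by under [RHS]eq_bigr do rewrite rW; rewrite -mulr_suml mulrC.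
  have -> : N%:R^-1 * \sum_j u t j = \sum_j (z t j / N%:R) * r t j.
    rewrite mulr_sumr; apply: eq_bigr => j _.
    by rewrite /r; field; rewrite !gt_eqF.
  apply: osc_averages => // [j|]; first by rewrite divr_ge0 // ltW.
  by rewrite -mulr_suml push_weight_sum divff // gt_eqF.
have He t : e t / eta <= e0 / eta by rewrite ler_wpM2r ?invr_ge0 ?(ltW eta0).
have := @sum_osc_le R N edge U conn k (ltW k0) A A0 A1 Ak N_gt0 r _ rS (e0 / eta) T He.
rewrite -/B mulrC -ler_pdivlMr ?exprn_gt0 // => /le_trans; apply.
rewrite -mulr_suml mulrC.
set E := \sum_(0 <= t < T) e t; have E0 : 0 <= E by apply: sumr_ge0.
set u0 := \sum_i _; have u00 : 0 <= u0 by apply: sumr_ge0.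
have o0 : osc r 0 <= 2 * u0.
  apply: bigmax_le => [|[i j] _ /=]; first by rewrite mulr_ge0.
  have h l : `|r 0%N l| <= u0.
    by rewrite /r /z /= divr1 /u0 (bigD1 l) //= lerDl sumr_ge0.
  by have := ler_normB (r 0%N i) (r 0%N j); have := h i; have := h j; lra.
set I := (X in X + 1); have S0 : 0 <= u0 + e0 + E by rewrite !addr_ge0.
rewrite [leRHS]mulrDl mul1r ler_wpDr // {}/I -[leRHS]mulrA.
rewrite ler_wpM2l ?invr_ge0 ?exprn_ge0 ?(ltW k0) // /c.
have b0 : 0 <= B%:R :> R by [].
have h0 : 0 <= eta^-1 by rewrite invr_ge0 ltW.
move: (B%:R) (eta^-1) b0 h0 => b h b0 h0.
have := ler_wpM2l b0 o0.
have bu := mulr_ge0 b0 u00; have be := mulr_ge0 b0 e00; have bE := mulr_ge0 b0 E0.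
have := mulr_ge0 h0 bu; have := mulr_ge0 h0 be; have := mulr_ge0 h0 bE.
have := mulr_ge0 h0 (mulr_ge0 b0 bu); have := mulr_ge0 h0 (mulr_ge0 b0 be).
have := mulr_ge0 h0 (mulr_ge0 b0 bE).
lra.
Qed.

End push_sum.

(** * Measurability of derivatives along random points *)

Lemma differentiable_expansion (R : realType) (V : normedModType R) (f : V -> R)
    (x : V) (e : R) : differentiable (f : V -> R^o) x -> 0 < e ->
  exists2 r : R, 0 < r & forall y, `|y| < r ->
    `|f (x + y) - f x - 'd (f : V -> R^o) x y| <= e * `|y|.
Proof.
move=> /diff_locally /eqaddoP/(_ e) H /H{H} /nbhs_ballP[r /= r0 Hr].
exists r => // y yr; have := Hr y; rewrite -ball_normE /= sub0r normrN => /(_ yr).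
by rewrite !fctE /= opprD addrA [y + x]addrC.
Qed.

Section countable_approximation.
Context d (T : measurableType d) (R : realType).

(* The cost F_i is differentiable only over X_i x R^n, and its derivative at a
   random point has to be measurable.  It is a limit of difference quotients
   between countably valued approximations of that point, which may lie outside
   X_i: there F_i is still measurable in the noise. *)
Definition approximable (V : normedModType R) (v : T -> V) : Prop :=
  forall eps : R, 0 < eps -> exists (c : nat -> V) (k : T -> nat),
    (forall j, measurable (k @^-1` [set j])) /\
    forall w, `|v w - c (k w)| <= eps.

Section fixed_space.
Context (V : normedModType R).
Implicit Types (v : T -> V) (h : V -> T -> R).

Lemma measurable_countably_valued (k : T -> nat) (S : set nat) :
  (forall j, measurable (k @^-1` [set j])) -> measurable (k @^-1` S).
Proof.
move=> mk; rewrite (_ : _ @^-1` _ = \bigcup_(j in S) k @^-1` [set j]).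
  by rewrite bigcup_mkcond; apply: bigcupT_measurable => j; case: ifP.
by apply/seteqP; split=> [w Sw|w [j Sj /= jw]]; [exists (k w) | rewrite /= jw].
Qed.

Lemma measurable_section (c : nat -> V) (k : T -> nat) h :
  (forall j, measurable (k @^-1` [set j])) ->
  (forall u, measurable_fun setT (h u)) ->
  measurable_fun setT (fun w => h (c (k w)) w).
Proof.
move=> mk mh _ B mB; rewrite setTI.
rewrite (_ : _ @^-1` _ = \bigcup_j (k @^-1` [set j] `&` h (c j) @^-1` B)).
  apply: bigcupT_measurable => j; apply: measurableI => //.
  by rewrite -[X in measurable X]setTI; exact: mh.
by apply/seteqP; split=> [w Bw|w [j _ [/= kj]]]; [exists (k w) | rewrite kj].
Qed.

Lemma approximable_seq v (e : nat -> R) : approximable v -> (forall n, 0 < e n) ->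
  exists (c : nat -> nat -> V) (k : nat -> T -> nat),
    (forall n j, measurable (k n @^-1` [set j])) /\
    forall n w, `|v w - c n (k n w)| <= e n.
Proof.
move=> av e0.
have /choice[c Hc] : forall n, exists c : nat -> V, exists k : T -> nat,
    (forall j, measurable (k @^-1` [set j])) /\
    forall w, `|v w - c (k w)| <= e n by move=> n; exact: av.
have [k Hk] := choice Hc.
by exists c, k; split=> [n|n]; case: (Hk n).
Qed.

(** A Caratheodory argument: the function is a pointwise limit of its values at countably valued
    points, where measurability for each fixed argument is enough. Continuity is asked only at the
    random point itself. *)
Lemma measurable_continuous_comp v h : approximable v ->
  (forall u, measurable_fun setT (h u)) ->
  (forall w, {for v w, continuous (h^~ w)}) ->
  measurable_fun setT (fun w => h (v w) w).
Proof.
move=> av mh ch.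
have [c [k [mk ck]]] := approximable_seq av (fun n => harmonic_gt0 n).
apply: (@measurable_fun_cvg _ _ _ _ (fun n w => h (c n (k n w)) w)).
  by move=> n; exact: (@measurable_section (c n) (k n) h).
move=> w _; suff cv : (fun n => c n (k n w)) @ \oo --> v w by exact: cvg_comp cv (ch w).
apply/cvgrPdist_le => e e0.
have /cvgrPdist_le/(_ e e0) := @cvg_harmonic R.
apply: filterS => n; rewrite sub0r normrN gtr0_norm ?harmonic_gt0 // => he.
exact: le_trans (ck n w) he.
Qed.

Lemma measurable_diff_comp v h (u : V) : approximable v ->
  (forall x, measurable_fun setT (h x)) ->
  (forall w, differentiable (h^~ w : V -> R^o) (v w)) ->
  measurable_fun setT (fun w => 'd (h^~ w : V -> R^o) (v w) u).
Proof.
(* The points are approximated to within the square of the step of the quotient. *)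
move=> av mh dh.
have e0 n : 0 < @harmonic R n ^+ 2 by rewrite exprn_gt0 // harmonic_gt0.
have [c [k [mk ck]]] := approximable_seq av e0.
apply: (@measurable_fun_cvg _ _ _ _ (fun n w => n.+1%:R *
    (h (c n (k n w) + harmonic n *: u) w - h (c n (k n w)) w))).
  move=> n; apply: measurable_funM => //; apply: measurable_funB.
    by apply: (@measurable_section (fun j => c n j + harmonic n *: u)  (k n) h).
  exact: (@measurable_section (c n) (k n) h).
move=> w _; apply/cvgrPdist_le => e epos.
set D := 'd (h^~ w : V -> R^o) (v w).
(* The remainders at the displacements [p] and [p + s *: u] are at most [e / C] times [s] and
   [s * (1 + |u|)], which together stay below [s * e]. *)
pose C := 3 * (1 + `|u|); have C0 : 0 < C by rewrite mulr_gt0 // ltr_pwDl.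
have eC : 0 < e / C by rewrite divr_gt0.
have [r r0 Hr] := differentiable_expansion (dh w) eC.
have r1 : 0 < r / (1 + `|u|) by rewrite divr_gt0 // ltr_pwDl.
have /cvgrPdist_lt/(_ _ r1) := @cvg_harmonic R.
apply: filterS => n; rewrite sub0r normrN gtr0_norm ?harmonic_gt0 // => hr.
pose s := @harmonic R n; have s0 : 0 < s := harmonic_gt0 n.
have s1 : s <= 1 by rewrite /s /= invf_le1 // ler1n.
pose p := c n (k n w) - v w.
have pn : `|p| <= s ^+ 2 by rewrite distrC; exact: ck.
have ps : `|p| <= s by apply: le_trans pn _; rewrite expr2 ler_piMl // ltW.
have U0 : 0 <= `|u| by [].
have pr : `|p| < r.
  rewrite ltr_pdivlMr ?ltr_pwDl // in hr; have := mulr_ge0 (ltW s0) U0.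
  rewrite -/s in hr; lra.
have qs : `|p + s *: u| <= s * (1 + `|u|).
  by rewrite (le_trans (ler_normD _ _)) // normrZ (gtr0_norm s0) mulrDr mulr1 lerD2r.
have qr : `|p + s *: u| < r.
  by apply: le_lt_trans qs _; rewrite -ltr_pdivlMr ?ltr_pwDl.
have DE : D (p + s *: u) = D p + s * D u by rewrite /D linearD linearZ.
have pE : v w + p = c n (k n w) by rewrite /p addrC subrK.
have H1 := Hr _ pr; have H2 := Hr _ qr.
rewrite addrA -/D DE pE in H2; rewrite -/D pE in H1.
have sE : n.+1%:R = s^-1 by rewrite /s /= invrK.
rewrite sE; clear - epos C0 s0 U0 H1 H2 ps qs eC.
move: (h (c n (k n w) + _) w) (h (c n (k n w)) w) (h (v w) w) (D p) (D u) H1 H2.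
move=> f2 f1 f0 Dp Du H1 H2.
(* The linear part [Dp] of the displacement is common to both expansions and drops out, leaving a
   difference of two remainders. *)
have -> : Du - s^-1 * (f2 - f1) = s^-1 * ((f1 - f0 - Dp) - (f2 - f0 - (Dp + s * Du))).
  by field; rewrite gt_eqF.
rewrite normrM normfV (gtr0_norm s0) ler_pdivrMl //.
apply: le_trans (ler_normB _ _) _; apply: le_trans (lerD H1 H2) _.
have h1 := ler_wpM2l (ltW eC) ps; have h2 := ler_wpM2l (ltW eC) qs.
apply: le_trans (lerD h1 h2) _.
rewrite -mulrDr mulrAC ler_pdivrMr // /C.
have := mulr_ge0 (mulr_ge0 (ltW s0) (ltW epos)) U0; have := mulr_ge0 (ltW s0) (ltW epos); lra.
Qed.

End fixed_space.

(** A point is in [B] exactly when, for some n, the whole closed ball of radius [harmonic n] around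
    its approximant is in [B]. That condition depends on the index only, so it is a countable union
    of fibres, and no separability of the space is involved. *)
Lemma approximable_open (V : normedModType R) (v : T -> V) (B : set V) :
  approximable v -> open B -> measurable (v @^-1` B).
Proof.
move=> av oB.
have [c [k [mk ck]]] := approximable_seq av (fun n => harmonic_gt0 n).
rewrite (_ : _ @^-1` _ = \bigcup_n
    k n @^-1` [set j | forall x, `|x - c n j| <= harmonic n -> B x]).
  by apply: bigcupT_measurable => n; exact: measurable_countably_valued.
apply/seteqP; split=> [w Bw|w [n _ /(_ (v w))]]; last exact.
have /nbhs_ballP[e /= e0 He] : nbhs (v w) B by exact: open_nbhs_nbhs.
have /cvgrPdist_lt/(_ _ (divr_gt0 e0 (ltr0Sn R 1))) := @cvg_harmonic R.
move=> [n _ /(_ n (leqnn n))]; rewrite /= sub0r normrN => hn.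
have {}hn : harmonic n < e / 2 := le_lt_trans (ler_norm _) hn.
exists n => //= x xc; apply: He; rewrite -ball_normE /=.
rewrite -[v w](subrK (c n (k n w))) -addrA.
apply: le_lt_trans (ler_normD _ _) _; rewrite [e]splitr ltrD //.
  exact: le_lt_trans (ck n w) hn.
by rewrite distrC; exact: le_lt_trans xc hn.
Qed.

Lemma approximable_pair (V V' : normedModType R) (v : T -> V) (v' : T -> V') :
  approximable v -> approximable v' -> approximable (fun w => (v w, v' w)).
Proof.
move=> av av' e e0; have [c [k [mk ck]]] := av e e0.
have [c' [k' [mk' ck']]] := av' e e0.
exists (fun j => if @unpickle (nat * nat)%type j is Some p then (c p.1, c' p.2) else (0, 0)).
exists (fun w => pickle (k w, k' w)); split=> [j|w]; last first.
  by rewrite pickleK prod_normE /= ge_max ck ck'.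
case E : (@pickle_inv (nat * nat)%type j) => [[a b]|]; last first.
  rewrite (_ : _ @^-1` _ = set0) //; apply/seteqP; split=> // w /= kj.
  by move: E; rewrite -kj pickleK_inv.
rewrite (_ : _ @^-1` _ = k @^-1` [set a] `&` k' @^-1` [set b]); first exact: measurableI.
have jE : pickle (a, b) = j by have := @pickle_invK (nat * nat)%type j; rewrite E.
apply/seteqP; split=> w /=; rewrite -jE; last by move=> [-> ->].
by move=> /(pcan_inj pickleK) [-> ->].
Qed.

(** Each coordinate is rounded down to a multiple of 1/(m+1); the resulting integer vectors are
    countable, and each fibre is a finite intersection of preimages of intervals. *)
Lemma approximable_rV k (v : T -> 'rV[R]_k) :
  (forall j, measurable_fun setT (fun w => v w 0 j)) -> approximable v.
Proof.
move=> mv e e0.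
have /cvgrPdist_lt/(_ _ e0) := @cvg_harmonic R.
move=> [m _ /(_ m (leqnn m))]; rewrite /= sub0r normrN => hm.
have {}hm : m.+1%:R^-1 < e := le_lt_trans (ler_norm _) hm.
have m0 : 0 < m.+1%:R :> R by [].
pose idx w : 'rV[int]_k := \row_j Num.floor (m.+1%:R * v w 0 j).
exists (fun j => if @unpickle 'rV[int]_k j is Some z
                 then \row_i ((z 0 i)%:~R / m.+1%:R) else 0).
exists (fun w => pickle (idx w)); split=> [j|w]; last first.
  rewrite pickleK; apply/ltW/(le_lt_trans _ hm).
  rewrite /Num.norm /= mx_normrE; apply: bigmax_le => //= -[i l] _ /=.
  rewrite !mxE (ord1 i); have := floor_le (m.+1%:R * v w 0 l).
  have := lt_succ_floor (m.+1%:R * v w 0 l); rewrite intrD.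
  move: (Num.floor _)%:~R => f f1 f2.
  have -> : v w 0 l - f / m.+1%:R = (m.+1%:R * v w 0 l - f) / m.+1%:R.
    by field; rewrite gt_eqF.
  rewrite normrM normfV (gtr0_norm m0) ler_piMl ?invr_ge0 ?ltW //.
  by rewrite ger0_norm; lra.
case E : (@pickle_inv 'rV[int]_k j) => [z|]; last first.
  rewrite (_ : _ @^-1` _ = set0) //; apply/seteqP; split=> // w /= kj.
  by move: E; rewrite -kj pickleK_inv.
have jE : pickle z = j by have := @pickle_invK 'rV[int]_k j; rewrite E.
rewrite (_ : _ @^-1` _ = \bigcap_(i in [set: 'I_k])
    (fun w => m.+1%:R * v w 0 i) @^-1` `[(z 0 i)%:~R, (z 0 i + 1)%:~R[%classic).
  apply: fin_bigcap_measurable => // i _; rewrite -[X in measurable X]setTI.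
  by apply: measurable_funM => //; exact: measurable_itv.
apply/seteqP; split=> w /=; rewrite -jE.
  move=> /(pcan_inj pickleK) zE i _; rewrite /= in_itv /= -zE mxE.
  by rewrite floor_le /= lt_succ_floor.
move=> H; congr pickle; apply/rowP => i; rewrite mxE.
by have := H i I; rewrite /= in_itv /= => /floor_def.
Qed.

End countable_approximation.

Section meas_wrt_theory.
Context d (T : measurableType d) (R : realType).

Lemma meas_wrt_open (V : topologicalType) (h : T -> V) :
  (forall B, open B -> measurable (h @^-1` B)) -> meas_wrt measurable h.
Proof.
move=> mh B; pose G := [set A | measurable (h @^-1` A)].
suff : <<s @open V >> `<=` G by apply.
apply: smallest_sub => //; split.
- by rewrite /G /= preimage_set0.
- move=> A GA; rewrite /G /= setTD preimage_setC; exact: measurableC.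
- by move=> F GF; rewrite /G /= preimage_bigcup; apply: bigcupT_measurable.
Qed.

Lemma meas_wrt_rV k (v : T -> 'rV[R]_k) :
  (forall j, measurable_fun setT (fun w => v w 0 j)) -> meas_wrt measurable v.
Proof.
by move=> mv; apply: meas_wrt_open => B; apply: approximable_open; exact: approximable_rV.
Qed.

Lemma meas_wrt_measurable_fun (f : T -> R) :
  meas_wrt measurable (f : T -> R^o) <-> measurable_fun setT f.
Proof.
split=> mf; last first.
  apply: meas_wrt_open => B oB; rewrite -[X in measurable X]setTI.
  by apply: mf => //; exact: open_measurable.
apply: (measurability _ (RGenOpens.measurableE R)) => _ [_ [x [y ->]] <-].
rewrite setTI; apply: mf; apply: sub_sigma_algebra; exact: interval_open.
Qed.

End meas_wrt_theory.

Lemma differentiable_coords (R : realType) (V : normedModType R) (m : nat)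
    (g : V -> 'rV[R]_m) (u : V) :
  (forall k, differentiable (fun v => g v 0 k : R^o) u) -> differentiable g u.
Proof.
move=> dg; have -> : g = \sum_k (fun v => (g v 0 k : R^o) *: delta_mx 0 k).
  by apply/funext => v; rewrite fct_sumE -row_sum_delta.
by apply: differentiable_sum => k; exact: differentiableZl.
Qed.

Lemma diff_coord (R : realType) (p q : nat) (A B : 'M[R]_(p, q)) i j :
  'd (fun M : 'M[R]_(p, q) => M i j : R^o) A B = B i j.
Proof.
have lc : linear (fun M : 'M[R]_(p, q) => M i j : R^o) by move=> c M M'; rewrite !mxE.
pose cM := GRing.isLinear.Build _ _ _ _ _ lc.
pose cL : {linear 'M[R]_(p, q) -> R^o} := HB.pack (fun M : 'M[R]_(p, q) => M i j : R^o) cM.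
by rewrite -[X in 'd X A]/(cL : _ -> _) diff_lin //; exact: coord_continuous.
Qed.

Lemma jacobian_coord (R : realType) (k m : nat) (g : 'rV[R]_k -> 'rV[R]_m)
    (u : 'rV[R]_k) a b : differentiable g u ->
  ('J g u) a b = 'd (fun v => g v 0 b : R^o) u (delta_mx 0 a).
Proof.
move=> dg; rewrite /jacobian mxE.
have dc : differentiable (fun M : 'rV[R]_m => M 0 b : R^o) (g u).
  exact: differentiable_coord.
by rewrite [in RHS](diff_comp dg dc) /= diff_coord.
Qed.

(** With its companion below, this expresses both partial gradients in [q_map] through one joint
    differential, to which [measurable_diff_comp] applies. *)
Lemma diff_partial1 (R : realType) (V V' : normedModType R) (F : V -> V' -> R)
    (x : V) (y : V') (v : V) :
  differentiable ((fun p => F p.1 p.2) : V * V' -> R^o) (x, y) ->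
  'd (F^~ y : V -> R^o) x v = 'd ((fun p => F p.1 p.2) : V * V' -> R^o) (x, y) (v, 0).
Proof.
move=> dF.
have dp : differentiable (fun u : V => (id u, cst y u)) x.
  exact: differentiable_pair.
rewrite [LHS](_ : _ = ('d (((fun p => F p.1 p.2) : V * V' -> R^o) \o
                      (fun u : V => (id u, cst y u))) x v)) //.
rewrite (diff_comp dp dF) /= diff_pair // diff_cst.
by rewrite (@diff_val _ _ _ _ _ id id _).
Qed.

Lemma diff_partial2 (R : realType) (V V' : normedModType R) (F : V -> V' -> R)
    (x : V) (y : V') (v : V') :
  differentiable ((fun p => F p.1 p.2) : V * V' -> R^o) (x, y) ->
  'd (F x : V' -> R^o) y v = 'd ((fun p => F p.1 p.2) : V * V' -> R^o) (x, y) (0, v).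
Proof.
move=> dF.
have dp : differentiable (fun u : V' => (cst x u, id u)) y.
  exact: differentiable_pair.
rewrite [LHS](_ : _ = ('d (((fun p => F p.1 p.2) : V * V' -> R^o) \o
                      (fun u : V' => (cst x u, id u))) y v)) //.
rewrite (diff_comp dp dF) /= diff_pair // diff_cst.
by rewrite (@diff_val _ _ _ _ _ id id _).
Qed.

Section measurable_gradients.
Context d (T : measurableType d) (R : realType).

Lemma measurable_jacobian (k m : nat) (g : 'rV[R]_k -> 'rV[R]_m) (x : T -> 'rV[R]_k) a b :
  (forall j, measurable_fun setT (fun w => x w 0 j)) ->
  (forall w, differentiable g (x w)) ->
  measurable_fun setT (fun w => ('J g (x w)) a b).
Proof.
move=> mx dg.
under eq_fun do rewrite jacobian_coord //.
apply: (measurable_diff_comp (h := fun v _ => g v 0 b)).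
- exact: approximable_rV.
- by move=> u; exact: measurable_cst.
- move=> w; apply: (@differentiable_comp _ _ _ _ g (fun M : 'rV[R]_m => M 0 b : R^o)) => //.
  exact: differentiable_coord.
Qed.

Lemma measurable_comp_differentiable (k m : nat) (g : 'rV[R]_k -> 'rV[R]_m)
    (x : T -> 'rV[R]_k) b :
  (forall j, measurable_fun setT (fun w => x w 0 j)) ->
  (forall w, differentiable g (x w)) ->
  measurable_fun setT (fun w => g (x w) 0 b).
Proof.
move=> mx dg; apply: (measurable_continuous_comp (h := fun v _ => g v 0 b)).
- exact: approximable_rV.
- by move=> u; exact: measurable_cst.
- move=> w; apply: (@continuous_comp _ _ _ g (fun M : 'rV[R]_m => M 0 b)).
    exact: differentiable_continuous.
  exact: coord_continuous.
Qed.

Lemma measurable_q_map (N n m : nat) (Gm : game R N n m) (i : 'I_N)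
    (x : T -> 'rV[R]_(Defs.dim Gm i)) (y : T -> 'rV[R]_n)
    (e : T -> 'rV[R]_(noise_dim Gm i)) k :
  (forall j, measurable_fun setT (fun w => x w 0 j)) ->
  (forall j, measurable_fun setT (fun w => y w 0 j)) ->
  meas_wrt measurable e ->
  (forall u v, meas_wrt (@borel _) (sample_cost Gm i u v : _ -> R^o)) ->
  (forall w, differentiable ((fun v => sample_cost Gm i v.1 v.2 (e w)) :
      'rV[R]_(Defs.dim Gm i) * 'rV[R]_n -> R^o) (x w, y w)) ->
  (forall w, differentiable (psi Gm i) (x w)) ->
  measurable_fun setT (fun w => q_map i (x w) (y w) (e w) 0 k).
Proof.
move=> mx my me mF dF dpsi.
pose h (p : 'rV[R]_(Defs.dim Gm i) * 'rV[R]_n) w := sample_cost Gm i p.1 p.2 (e w).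
have md u : measurable_fun setT (fun w => 'd (h^~ w : _ -> R^o) (x w, y w) u).
  apply: (@measurable_diff_comp _ T R _ (fun w => (x w, y w)) h u) => //.
    by apply: approximable_pair; exact: approximable_rV.
  move=> p; apply/meas_wrt_measurable_fun => B bB.
  exact: me (mF _ _ _ bB).
pose D w := 'd (h^~ w : _ -> R^o) (x w, y w).
have qE w : q_map i (x w) (y w) (e w) 0 k = D w (delta_mx 0 k, 0)
    + N%:R^-1 * \sum_l D w (0, delta_mx 0 l) * ('J (psi Gm i) (x w)) k l.
  rewrite /q_map /own_grad !mxE; congr (_ + _ * _).
    exact: (diff_partial1 (F := fun u v => sample_cost Gm i u v (e w))).
  apply: eq_bigr => l _; rewrite !mxE; congr (_ * _).
  exact: (diff_partial2 (F := fun u v => sample_cost Gm i u v (e w))).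
rewrite (funext qE).
apply: measurable_funD; first exact: md.
apply: measurable_funM => //; apply: measurable_sum => l.
apply: measurable_funM; first exact: md.
exact: measurable_jacobian.
Qed.

End measurable_gradients.

(** * Euclidean geometry *)

Section euclidean.
Context (R : realType).

Lemma dotpE k (u v : 'rV[R]_k) : dotp u v = (u *m v^T) 0 0.
Proof. by rewrite mxE; apply: eq_bigr => j _; rewrite mxE. Qed.

Lemma dotpC k (u v : 'rV[R]_k) : dotp u v = dotp v u.
Proof. by apply: eq_bigr => j _; rewrite mulrC. Qed.

Lemma dotpDl k (u v x : 'rV[R]_k) : dotp (u + v) x = dotp u x + dotp v x.
Proof. by rewrite !dotpE mulmxDl mxE. Qed.

Lemma dotpNl k (u x : 'rV[R]_k) : dotp (- u) x = - dotp u x.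
Proof. by rewrite !dotpE mulNmx mxE. Qed.

Lemma dotpZl k c (u x : 'rV[R]_k) : dotp (c *: u) x = c * dotp u x.
Proof. by rewrite !dotpE -scalemxAl mxE. Qed.

Lemma dotpDr k (u v x : 'rV[R]_k) : dotp x (u + v) = dotp x u + dotp x v.
Proof. by rewrite ![dotp x _]dotpC dotpDl. Qed.

Lemma dotpNr k (u x : 'rV[R]_k) : dotp x (- u) = - dotp x u.
Proof. by rewrite ![dotp x _]dotpC dotpNl. Qed.

Lemma dotpZr k c (u x : 'rV[R]_k) : dotp x (c *: u) = c * dotp x u.
Proof. by rewrite ![dotp x _]dotpC dotpZl. Qed.

Definition dotp_linE := (dotpDl, dotpDr, dotpNl, dotpNr, dotpZl, dotpZr).

Lemma dotp_ge0 k (u : 'rV[R]_k) : 0 <= dotp u u.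
Proof. by apply: sumr_ge0 => j _; rewrite -expr2 sqr_ge0. Qed.

Lemma enorm_ge0 p q (A : 'M[R]_(p, q)) : 0 <= enorm A.
Proof. exact: sqrtr_ge0. Qed.

Lemma enorm_sqr p q (A : 'M[R]_(p, q)) : enorm A ^+ 2 = \sum_i \sum_j A i j ^+ 2.
Proof.
by rewrite sqr_sqrtr //; apply: sumr_ge0 => i _; apply: sumr_ge0 => j _; exact: sqr_ge0.
Qed.

Lemma enorm_dotp k (u : 'rV[R]_k) : enorm u ^+ 2 = dotp u u.
Proof. by rewrite enorm_sqr big_ord1; apply: eq_bigr => j _; rewrite expr2. Qed.

Lemma enorm_le_sqr p q (A : 'M[R]_(p, q)) p' q' (B : 'M[R]_(p', q')) :
  (enorm A <= enorm B) = (enorm A ^+ 2 <= enorm B ^+ 2).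
Proof. by rewrite ler_sqr ?nnegrE ?enorm_ge0. Qed.

Lemma coord_le_enorm p q (A : 'M[R]_(p, q)) i j : `|A i j| <= enorm A.
Proof.
rewrite -ler_sqr ?nnegrE ?enorm_ge0 // enorm_sqr real_normK ?num_real //.
rewrite (bigD1 i) //= (bigD1 j) //= -addrA lerDl addr_ge0 //.
  by apply: sumr_ge0 => l _; exact: sqr_ge0.
by apply: sumr_ge0 => l _; apply: sumr_ge0 => l' _; exact: sqr_ge0.
Qed.

Lemma sqr_sum_ge (I : finType) (a : I -> R) :
  \sum_i a i ^+ 2 <= (\sum_i `|a i|) ^+ 2.
Proof.
rewrite [leRHS]expr2 mulr_suml; apply: ler_sum => i _.
rewrite -real_normK ?num_real // expr2 ler_wpM2l // (bigD1 i) //= lerDl.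
by apply: sumr_ge0.
Qed.

Lemma enorm_le_sum k (u : 'rV[R]_k) : enorm u <= \sum_j `|u 0 j|.
Proof.
have s0 : 0 <= \sum_j `|u 0 j| by apply: sumr_ge0.
rewrite -ler_sqr ?nnegrE ?enorm_ge0 // enorm_sqr big_ord1.
exact: sqr_sum_ge.
Qed.

Lemma dotp_le k (u v : 'rV[R]_k) (a b : R) :
  (forall j, `|u 0 j| <= a) -> (forall j, `|v 0 j| <= b) ->
  `|dotp u v| <= k%:R * a * b.
Proof.
move=> ua vb; apply: le_trans (ler_norm_sum _ _ _) _.
rewrite -mulrA mulr_natl -[X in _ *+ X](card_ord k) -sumr_const.
by apply: ler_sum => j _; rewrite normrM ler_pM.
Qed.

Lemma enorm_le_sup k (u : 'rV[R]_k) (a : R) :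
  (forall j, `|u 0 j| <= a) -> enorm u ^+ 2 <= k%:R * a ^+ 2.
Proof.
move=> ua; rewrite enorm_dotp; apply: le_trans (ler_norm _) _.
by rewrite expr2 mulrA; exact: dotp_le.
Qed.

Lemma mx_norm_coord p q (A : 'M[R]_(p, q)) i j : `|A i j| <= `|A|.
Proof.
rewrite [leRHS]/Num.norm /= mx_normrE.
exact: (le_bigmax _ (fun ij : 'I_p * 'I_q => `|A ij.1 ij.2|) (i, j)).
Qed.

Lemma convex_setP k (C : set 'rV[R]_k) (x y : 'rV[R]_k) (t : R) : convex_set C ->
  C x -> C y -> 0 <= t -> t <= 1 -> C (y + t *: (x - y)).
Proof.
move=> cC Cx Cy t0 t1.
have : C (t *: x + (1 - t) *: y).
  exact: set_mem (cC x y (Itv01 t0 t1) (mem_set Cx) (mem_set Cy)).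
by rewrite scalerBl scale1r scalerBr addrCA.
Qed.

Lemma convex_functionP k (C : set 'rV[R]_k) (f : 'rV[R]_k -> R) (x y : 'rV[R]_k) (t : R) :
  convex_function C f ->
  C x -> C y -> 0 <= t -> t <= 1 -> f (y + t *: (x - y)) <= f y + t * (f x - f y).
Proof.
move=> cC Cx Cy t0 t1.
have : f (t *: x + (1 - t) *: y) <= t * f x + (1 - t) * f y.
  exact: cC (Itv01 t0 t1) x y (mem_set Cx) (mem_set Cy).
by rewrite scalerBl scale1r scalerBr addrCA => /le_trans; apply; lra.
Qed.

Lemma convex_gradient k (C : set 'rV[R]_k) (f : 'rV[R]_k -> R) (x y : 'rV[R]_k) :
  convex_function C f -> differentiable (f : 'rV[R]_k -> R^o) x -> C x -> C y ->
  'd (f : 'rV[R]_k -> R^o) x (y - x) <= f y - f x.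
Proof.
move=> cf df Cx Cy; apply/ler_addgt0Pr => e e0.
set n := `|y - x|; have n0 : 0 <= n := normr_ge0 _.
have n1 : 0 < n + 1 by lra.
have [r r0 Hr] := differentiable_expansion df (divr_gt0 e0 n1).
(* The step keeps [t * |y - x|] below [r]; the [n + 1] avoids dividing by zero when y equals x. *)
pose t := Num.min 1 (r / 2 / (n + 1)).
have rn0 : 0 < r / 2 / (n + 1) by rewrite divr_gt0 ?divr_gt0.
have t0 : 0 < t by rewrite lt_min ltr01 rn0.
have t1 : t <= 1 by rewrite ge_min lexx.
have tr : t * (n + 1) <= r / 2 by rewrite -ler_pdivlMr // ge_min lexx orbT.

have tn : `|t *: (y - x)| = t * n by rewrite normrZ gtr0_norm.
have := Hr (t *: (y - x)); rewrite tn.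
have tn' : t * n < r by have := r0; lra.
have DE : 'd (f : 'rV[R]_k -> R^o) x (t *: (y - x))
    = t * 'd (f : 'rV[R]_k -> R^o) x (y - x) by rewrite linearZ.
move=> /(_ tn'); rewrite DE.
have := convex_functionP cf Cy Cx (ltW t0) t1.
move: (f (x + _)) ('d _ x _) (f x) (f y) => f1 D fx fy h1; rewrite ler_norml => /andP[h2 _].
have h3 : e / (n + 1) * (t * n) <= e * t.
  by rewrite mulrAC ler_pdivrMr //; have := mulr_ge0 (ltW e0) (ltW t0); lra.
have : t * (D - (fy - fx + e)) <= 0 by lra.
by rewrite pmulr_rle0 // subr_le0.
Qed.

(** The variational inequality of the Euclidean projection: for a convex set it follows from
    minimality, and the distance estimates below use nothing else. *)
Definition is_proj k (C : set 'rV[R]_k) (v p : 'rV[R]_k) : Prop :=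
  C p /\ forall y, C y -> dotp (v - p) (y - p) <= 0.

Lemma nearest_is_proj k (C : set 'rV[R]_k) v p : convex_set C -> C p ->
  (forall y, C y -> enorm (v - p) <= enorm (v - y)) -> is_proj C v p.
Proof.
move=> cC Cp Hp; split=> // y Cy.
rewrite leNgt; apply/negP => a0; set a := dotp _ _ in a0.
have b0 : 0 <= dotp (y - p) (y - p) := dotp_ge0 _.
set b := dotp _ _ in b0.
(* Moving from p towards y by this fraction changes the squared distance by [- t * (2 * a - t * b)],
   which is negative because [t * b < a]. *)
pose t := a / (a + b + 1).
have D0 : 0 < a + b + 1 by lra.
have t0 : 0 < t by rewrite divr_gt0.
have t1 : t <= 1 by rewrite ler_pdivrMr //; lra.
have tE : t * (a + b + 1) = a by rewrite /t mulrVK // unitfE gt_eqF.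
have := Hp _ (convex_setP cC Cy Cp (ltW t0) t1).
rewrite enorm_le_sqr !enorm_dotp.
rewrite (_ : v - (p + t *: (y - p)) = (v - p) - t *: (y - p)); last first.
  by rewrite opprD addrA.
have -> : dotp (v - p - t *: (y - p)) (v - p - t *: (y - p)) =
    dotp (v - p) (v - p) - 2 * t * a + t ^+ 2 * b.
  by rewrite /a /b; move: (v - p) (y - p) => w z; rewrite !dotp_linE (dotpC z w); ring.
move=> h; have : t * (2 * a - t * b) <= 0 by lra.
rewrite pmulr_rle0 //.
have -> : t * b = a - t * (a + 1) by lra.
have := mulr_gt0 t0 a0; lra.
Qed.

Lemma is_proj_dist k (C : set 'rV[R]_k) v p y : is_proj C v p -> C y ->
  enorm (p - y) ^+ 2 <= enorm (v - y) ^+ 2.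
Proof.
move=> [_ Hp] Cy; have := Hp y Cy; rewrite !enorm_dotp !dotp_linE.
have := dotp_ge0 (v - p); rewrite !dotp_linE.
rewrite (dotpC p v) (dotpC y v) (dotpC y p); lra.
Qed.

Lemma is_proj_nonexpansive k (C : set 'rV[R]_k) u v p q :
  is_proj C u p -> is_proj C v q -> enorm (p - q) ^+ 2 <= enorm (u - v) ^+ 2.
Proof.
move=> [Cp Hp] [Cq Hq]; have := Hp q Cq; have := Hq p Cp; rewrite !enorm_dotp.
have := dotp_ge0 ((u - v) - (p - q)); rewrite !dotp_linE.
rewrite (dotpC p u) (dotpC p v) (dotpC q u) (dotpC q v) (dotpC q p) (dotpC v u).
lra.
Qed.

Lemma eproj_is_proj k (C : set 'rV[R]_k) v :
  convex_set C -> compact C -> C !=set0 -> is_proj C v (eproj C v).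
Proof.
move=> cC kC C0.
(* Compactness provides a nearest point, so the default value of [xget] in [eproj] is never
   returned. *)
have [p /set_mem Cp Hp] : exists2 p, p \in C & forall y, y \in C ->
    \sum_j (v 0 j - p 0 j) ^+ 2 <= \sum_j (v 0 j - y 0 j) ^+ 2.
  apply: EVT_min_rV => //; apply: continuous_subspaceT.
  apply: continuous_big => [|j _ y]; first exact: add_continuous.
  have cB : {for y, continuous (fun y : 'rV[R]_k => v 0 j - y 0 j)}.
    apply: (@continuousB _ _ _ (cst (v 0 j)) (fun y : 'rV[R]_k => y 0 j)).
      exact: cst_continuous.
    exact: coord_continuous.
  apply: (@continuous_comp _ _ _ (fun y : 'rV[R]_k => v 0 j - y 0 j)
    (fun r : R => r ^+ 2)) => //.
  exact: exprn_continuous.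
have [|Cq Hq] := @xgetPex _ 0 [set p | C p /\ forall y, C y -> enorm (v - p) <= enorm (v - y)].
  exists p; split=> // y Cy; rewrite enorm_le_sqr !enorm_sqr !big_ord1.
  have sE (u : 'rV[R]_k) : \sum_j (v - u) 0 j ^+ 2 = \sum_j (v 0 j - u 0 j) ^+ 2.
    by apply: eq_bigr => j _; rewrite !mxE.
  by rewrite !sE Hp // mem_set.
exact: nearest_is_proj.
Qed.

(** The orthant is not compact, so existence and uniqueness are shown by hand: the coordinatewise
    positive part [p0] satisfies a Pythagorean inequality, which forces any other nearest point to
    coincide with it. *)
Lemma eproj_orthant k (v : 'rV[R]_k) j :
  (eproj (nonneg_orthant R k) v) 0 j = Num.max 0 (v 0 j).
Proof.
pose p0 : 'rV[R]_k := \row_j Num.max 0 (v 0 j).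
have Hp0 (y : 'rV[R]_k) : nonneg_orthant R k y ->
    enorm (v - p0) ^+ 2 + enorm (y - p0) ^+ 2 <= enorm (v - y) ^+ 2.
  move=> y0; rewrite !enorm_sqr !big_ord1 -big_split /=; apply: ler_sum => l _.
  rewrite !mxE; have := y0 l; rewrite mxE.
  by case: (leP 0 (v 0 l)) => h1 h2; nra.
have [|Cq Hq] := @xgetPex _ 0 [set p | nonneg_orthant R k p /\
    forall y, nonneg_orthant R k y -> enorm (v - p) <= enorm (v - y)].
  exists p0; split=> [l|y y0]; first by rewrite !mxE le_max lexx.
  by rewrite enorm_le_sqr; apply: le_trans (Hp0 y y0); rewrite lerDl sqr_ge0.
rewrite -/(eproj _ _) in Cq Hq.
have h1 := Hp0 _ Cq.
have Cp0 : nonneg_orthant R k p0 by move=> l; rewrite !mxE le_max lexx.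
have h2 := Hq _ Cp0; rewrite enorm_le_sqr in h2.
have h3 : enorm (eproj (nonneg_orthant R k) v - p0) ^+ 2 <= 0 by lra.
have := coord_le_enorm (eproj (nonneg_orthant R k) v - p0) 0 j.
have -> : enorm (eproj (nonneg_orthant R k) v - p0) = 0.
  by apply/eqP; rewrite -sqrf_eq0 eq_le h3 sqr_ge0.
by rewrite normr_le0 !mxE subr_eq0 => /eqP ->.
Qed.

Lemma convex_gradient_dotp k m (C : set 'rV[R]_k) (g : 'rV[R]_k -> 'rV[R]_m)
    (nu : 'rV[R]_m) (x y : 'rV[R]_k) :
  (forall j, convex_function C (fun v => g v 0 j)) ->
  (forall j, differentiable ((fun v => g v 0 j) : 'rV[R]_k -> R^o) x) ->
  C x -> C y -> (forall j, 0 <= nu 0 j) ->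
  dotp nu (g x) - dotp nu (g y) <= dotp (nu *m ('J g x)^T) (x - y).
Proof.
move=> cg dg Cx Cy nu0.
have dgx := differentiable_coords dg.
have -> : dotp (nu *m ('J g x)^T) (x - y) =
    \sum_j nu 0 j * 'd ((fun v => g v 0 j) : 'rV[R]_k -> R^o) x (x - y).
  rewrite /dotp; under eq_bigr do rewrite mxE mulr_suml.
  rewrite exchange_big /=; apply: eq_bigr => j _.
  rewrite {2}[x - y]row_sum_delta linear_sum mulr_sumr; apply: eq_bigr => l _.
  by rewrite linearZ /= mxE jacobian_coord // -mulrA [X in _ * X]mulrC.
rewrite -sumrB; apply: ler_sum => j _; rewrite -mulrBr ler_wpM2l //.
have := convex_gradient (cg j) (dg j) Cx Cy.
rewrite -(opprB x y) linearN /=; lra.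
Qed.

Lemma eproj_coord_continuous k (C : set 'rV[R]_k) j :
  convex_set C -> compact C -> C !=set0 ->
  continuous (fun v => (eproj C v) 0 j : R).
Proof.
move=> cC kC C0 v; apply/(@cvgrPdist_le R R _ (nbhs v) (nbhs_filter v)) => e e0.
have k1 : 0 < k%:R + 1 :> R by rewrite ltr_wpDl.
apply/nbhs_ballP; exists (e / (k%:R + 1)); first by rewrite /= divr_gt0.
move=> u; rewrite -ball_normE /= => /ltW uv.
have h := is_proj_nonexpansive (eproj_is_proj v cC kC C0) (eproj_is_proj u cC kC C0).
rewrite -enorm_le_sqr in h.
have := coord_le_enorm (eproj C v - eproj C u) 0 j; rewrite !mxE => /le_trans; apply.
apply: le_trans h _; apply: le_trans (enorm_le_sum _) _.
apply: (@le_trans _ _ (\sum_(l < k) e / (k%:R + 1))).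
  by apply: ler_sum => l _; apply: le_trans (mx_norm_coord _ _ _) uv.
rewrite sumr_const card_ord -[_ *+ k]mulr_natl mulrCA ler_piMr ?(ltW e0) //.
by rewrite ler_pdivrMr // mul1r lerDl.
Qed.

End euclidean.

(** * Descent along a trajectory *)

(** Summation by parts with nondecreasing weights. The induction carries the slack [b - a T.+2],
    which absorbs the growth of the weight at the next step. *)
Lemma abel_sum_le (R : realType) (a c : nat -> R) (b : R) (T : nat) :
  (forall t, (t <= T)%N -> a t.+1 <= b) -> (forall t, 0 <= a t) ->
  (forall t, 0 <= c t) -> (forall t, c t <= c t.+1) ->
  \sum_(1 <= t < T.+2) c t * (a t - a t.+1) <= c T.+1 * b.
Proof.
move=> ab a0 c0 cS.
suff : \sum_(1 <= t < T.+2) c t * (a t - a t.+1) <= c T.+1 * (b - a T.+2).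
  by move=> /le_trans; apply; rewrite ler_wpM2l // lerBlDr lerDl.
elim: T ab => [|T IH] ab.
  by rewrite big_nat1 ler_wpM2l // lerD2r ab.
rewrite big_nat_recr //=; apply: le_trans (lerD (IH _) (lexx _)) _ => [t tT|].
  exact/ab/leqW.
have : c T.+1 * (b - a T.+2) <= c T.+2 * (b - a T.+2).
  by rewrite ler_wpM2r // subr_ge0 ab.
lra.
Qed.

Section stacking.
Context (R : realType) (N n m : nat) (Gm : game R N n m).
Implicit Types x y : profile Gm.

Lemma dotp_mxrow (u v : forall i, 'rV[R]_(Defs.dim Gm i)) :
  dotp (\mxrow_i u i) (\mxrow_i v i) = \sum_i dotp (u i) (v i).
Proof.
rewrite dotpE tr_mxrow mul_mxrow_mxcol summxE.
by apply: eq_bigr => i _; rewrite dotpE.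
Qed.

Lemma stackB x y : stack x - stack y = \mxrow_i (x i - y i).
Proof. by rewrite /stack -mxrowB. Qed.

Lemma enorm_stackB x y :
  enorm (stack x - stack y) ^+ 2 = \sum_i enorm (x i - y i) ^+ 2.
Proof.
rewrite enorm_dotp stackB dotp_mxrow.
by apply: eq_bigr => i _; rewrite enorm_dotp.
Qed.

End stacking.

(* The term with w is Jensen's inequality for the square, with weights
   w_j z_j / z'. *)
Lemma dual_step (R : realType) (N : nat) (w z mu : 'I_N -> R) (z' a g ga be b : R) :
  (forall j, 0 <= w j) -> (forall j, 0 < z j) -> z' = \sum_j w j * z j -> 0 < z' ->
  0 <= a -> 0 <= ga -> 0 <= be ->
  let muh := \sum_j w j * mu j in
  `|g / z' - be * (muh / z')| <= b ->
  z' * (Num.max 0 (muh + ga * (g - be * muh)) / z' - a) ^+ 2 <=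
    \sum_j w j * (z j * (mu j / z j - a) ^+ 2) + 2 * ga * (g * (muh / z' - a))
      + ga * be * (z' * a ^+ 2) + ga ^+ 2 * (z' * b ^+ 2).
Proof.
move=> w0 z0 z'E z'0 a0 ga0 be0 muh hb.
pose nu := muh / z'.
pose h := g / z' - be * nu.
have jensen : z' * (nu - a) ^+ 2 <= \sum_j w j * (z j * (mu j / z j - a) ^+ 2).
  have : 0 <= \sum_j w j * (z j * (mu j / z j - nu) ^+ 2).
    by apply: sumr_ge0 => j _; rewrite mulr_ge0 // mulr_ge0 ?sqr_ge0 ?ltW.
  have -> : \sum_j w j * (z j * (mu j / z j - nu) ^+ 2) =
     \sum_j w j * (z j * (mu j / z j - a) ^+ 2) + 2 * (a - nu) * \sum_j w j * mu j
       + (nu ^+ 2 - a ^+ 2) * \sum_j w j * z j.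
    rewrite !mulr_sumr -!big_split /=; apply: eq_bigr => j _.
    by field; rewrite gt_eqF.
  have -> : \sum_j w j * mu j = nu * z' by rewrite /nu divfK // gt_eqF.
  rewrite -z'E; lra.
have hh : h ^+ 2 <= b ^+ 2.
  have b0 : 0 <= b := le_trans (normr_ge0 _) hb.
  by rewrite -(real_normK (num_real h)) ler_sqr ?nnegrE //; exact: hb.
(* Since a and z' are nonnegative, taking the positive part does not move the ratio away from a. *)
have step : (Num.max 0 (muh + ga * (g - be * muh)) / z' - a) ^+ 2 <= (nu + ga * h - a) ^+ 2.
  have -> : nu + ga * h = (muh + ga * (g - be * muh)) / z'.
    by rewrite /h /nu; field; rewrite gt_eqF.
  have [e0|e0] := leP 0 (muh + _); first by [].
  have : (muh + ga * (g - be * muh)) / z' <= 0 by rewrite ler_pdivrMr // mul0r ltW.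
  rewrite mul0r; move: (_ / z') => e e1; nra.
apply: le_trans (ler_wpM2l (ltW z'0) step) _.
have E : z' * (nu + ga * h - a) ^+ 2 = z' * (nu - a) ^+ 2 + 2 * ga * (g * (nu - a))
    - 2 * ga * be * (z' * (nu * (nu - a))) + ga ^+ 2 * (z' * h ^+ 2).
  by rewrite /h; field; rewrite gt_eqF.
rewrite E -/nu.
have k1 : ga ^+ 2 * (z' * h ^+ 2) <= ga ^+ 2 * (z' * b ^+ 2).
  by rewrite ler_wpM2l ?sqr_ge0 // ler_wpM2l // ltW.
(* The regularization contributes -2 nu (nu - a), which is at most a^2, because a^2 + 2 nu (nu - a)
   = nu^2 + (nu - a)^2. *)
have k2 : 0 <= ga * be * (z' * (a ^+ 2 + 2 * (nu * (nu - a)))).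
  rewrite !mulr_ge0 // ?(ltW z'0) //; have := sqr_ge0 (nu - a); have := sqr_ge0 nu; lra.
lra.
Qed.

Lemma primal_arith (R : realType) (a b C D LL Lf mu Ds Dn c mg D0 D1 NT SS E2 X1 X2 X3 X4 G1 : R) :
  0 < a -> 0 < b ->
  D1 <= D0 - 2 * a * SS + a ^+ 2 * E2 ->
  E2 <= D * (C / b) ^+ 2 ->
  SS = - NT + X1 + X2 + X3 + X4 ->
  - (D * (Lf * Ds) * (2 * LL)) <= X1 ->
  mu * D0 <= X2 -> - mg <= X3 -> G1 - c * LL * Dn <= X4 ->
  2 * mu * D0 + 2 * (G1 - mg) <= a^-1 * (D0 - D1)
     + 2 * NT + 4 * D * LL * Lf * Ds + 2 * c * LL * Dn + D * C ^+ 2 * (a / b ^+ 2).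
Proof.
move=> a0 b0 d1 d2 d3 d4 d5 d6 d7.
have d9 : 2 * SS <= a^-1 * (D0 - D1) + D * C ^+ 2 * (a / b ^+ 2).
  rewrite -(ler_pM2l a0).
  have -> : a * (a^-1 * (D0 - D1) + D * C ^+ 2 * (a / b ^+ 2)) =
    D0 - D1 + a ^+ 2 * (D * (C / b) ^+ 2) by field; rewrite !gt_eqF.
  have := ler_wpM2l (sqr_ge0 a) d2; lra.
lra.
Qed.

(** [G] is the coupling term: it enters the primal inequality with factor 2 and the dual one with
    factor -2 after division by [c], so it disappears. *)
Lemma dual_arith (R : realType) (A0 G V0 V1 P NT X Y Q b c c4 c5 : R) :
  0 < c ->
  A0 + 2 * G <= P + NT + X + Y + Q ->
  2 * c * (- G) <= V0 - V1 + c * b * c4 + c ^+ 2 * c5 ->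
  A0 <= P + c^-1 * (V0 - V1) + NT + X + Y + Q + c4 * b + c5 * c.
Proof.
move=> c0 h1 h2.
have h3 : 2 * (- G) <= c^-1 * (V0 - V1) + c4 * b + c5 * c.
  rewrite -(ler_pM2l c0).
  have -> : c * (c^-1 * (V0 - V1) + c4 * b + c5 * c) =
    V0 - V1 + c * b * c4 + c ^+ 2 * c5 by field; rewrite gt_eqF.
  lra.
lra.
Qed.

(** Each error is a constant times one of the summands of the bracket, so a single constant can
    multiply the whole bracket. The leading 1 takes the contributions of the initial
    disagreement. *)
Lemma sum_arith (R : realType) (S P1 P2 SN sD sDn q b g k1 k2 k3 k4 k5 C0 I E G Qb Q B Ga
    ia ib CA CV : R) :
  S <= P1 + P2 + SN + k1 * sD + k2 * sDn + k3 * q + k4 * b + k5 * g ->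
  P1 <= CA * ia -> P2 <= CV * ib ->
  sD <= C0 * (I + E + E * Qb) -> Qb <= Q -> sDn <= C0 * (G + G * Ga) ->
  q <= Q -> b <= B -> g <= Ga ->
  0 <= k1 -> 0 <= k2 -> 0 <= k3 -> 0 <= k4 -> 0 <= k5 -> 0 <= C0 -> 0 <= I -> 0 <= E ->
  0 <= G -> 0 <= Q -> 0 <= B -> 0 <= Ga -> 0 <= ia -> 0 <= ib -> 0 <= CA -> 0 <= CV ->
  S <= (CA + CV + k1 * (C0 * (I + E)) + k2 * (C0 * G) + k3 + k4 + k5)
        * (1 + ia + ib + (Q + B + Ga)) + SN.
Proof.
move=> hS hP1 hP2 hD hQb hDn hq hb hg k10 k20 k30 k40 k50 C00 I0 E0 G0 Q0 B0 Ga0 ia0 ib0 CA0 CV0.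
set Z := 1 + ia + ib + (Q + B + Ga).
have r1 : CA * ia <= CA * Z by rewrite ler_wpM2l // /Z; lra.
have r2 : CV * ib <= CV * Z by rewrite ler_wpM2l // /Z; lra.
have r3 : k1 * sD <= k1 * (C0 * (I + E)) * Z.
  rewrite -!mulrA ler_wpM2l //; apply: le_trans hD _; rewrite ler_wpM2l //.
  have h1 := ler_wpM2l E0 hQb; have h2 : (I + E) * (1 + Q) <= (I + E) * Z.
    by rewrite ler_wpM2l ?addr_ge0 // /Z; lra.
  have := mulr_ge0 I0 Q0; lra.
have r4 : k2 * sDn <= k2 * (C0 * G) * Z.
  rewrite -!mulrA ler_wpM2l //; apply: le_trans hDn _; rewrite ler_wpM2l //.
  by rewrite -{1}[G]mulr1 -mulrDr ler_wpM2l // /Z; lra.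
have r5 : k3 * q <= k3 * Z by rewrite ler_wpM2l // /Z; lra.
have r6 : k4 * b <= k4 * Z by rewrite ler_wpM2l // /Z; lra.
have r7 : k5 * g <= k5 * Z by rewrite ler_wpM2l // /Z; lra.
rewrite !mulrDl; move: r3 r4; move: (k1 * (C0 * (I + E)) * Z) (k2 * (C0 * G) * Z) => x y.
lra.
Qed.

Section trajectory.
Context (R : realType) (N n m : nat) (N_gt0 : (0 < N)%N) (Gm : game R N n m).
Context (edge : nat -> rel 'I_N) (U : nat) (w : R) (W : nat -> 'M[R]_N).
Hypothesis conn : forall t i j,
  connect [rel k l | [exists s : 'I_U, edge (t + s)%N k l]] i j.
Hypothesis w_gt0 : 0 < w.
Hypothesis W_ge0 : forall t i j, 0 <= W t i j.
Hypothesis W_sum : forall t j, \sum_i W t i j = 1.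
Hypothesis W_lb : forall t i j, edge t j i || (i == j) -> w <= W t i j.
Context (f : cost_fun Gm) (Lsig L M Lf mu S : R).
Hypotheses (Lsig_gt0 : 0 < Lsig) (L_gt0 : 0 < L) (M_gt0 : 0 < M) (Lf_gt0 : 0 < Lf) (S_gt0 : 0 < S).
Hypothesis Hgame : game_assumption f Lsig L M.
Hypothesis Hlip : lipschitz_assumption f Lf.
Hypothesis Hmono : strongly_monotone f mu.
Context (x0 : profile Gm) (Hx0 : in_prod x0) (xs : profile Gm) (mus : 'rV[R]_m).
Hypotheses (Hxs : feasible xs) (mus_ge0 : nonneg_orthant R m mus)
  (Hkkt : KKT f xs mus).
Context (al be ga : nat -> R).
Hypothesis al_itv : forall t, 0 < al t <= 1.
Hypothesis be_itv : forall t, 0 < be t <= 1.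
Hypothesis ga_itv : forall t, 0 < ga t <= 1.
Hypothesis al_dec : forall t, al t.+1 <= al t.
Hypothesis be_dec : forall t, be t.+1 <= be t.
Hypothesis ga_dec : forall t, ga t.+1 <= ga t.
Hypothesis al_be : forall t, al t <= be t.

Let al_gt0 t : 0 < al t. Proof. by have /andP[] := al_itv t. Qed.
Let be_gt0 t : 0 < be t. Proof. by have /andP[] := be_itv t. Qed.
Let ga_gt0 t : 0 < ga t. Proof. by have /andP[] := ga_itv t. Qed.
Let be_le1 t : be t <= 1. Proof. by have /andP[] := be_itv t. Qed.
Let ga_le1 t : ga t <= 1. Proof. by have /andP[] := ga_itv t. Qed.

Let z := push_weight W.
Let eta := w ^+ (N * U).
Let eta_gt0 : 0 < eta. Proof. exact: exprn_gt0. Qed.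
Let z_ge t i : eta <= z t i.
Proof. exact: (push_weight_lb conn w_gt0 W_ge0 W_sum W_lb N_gt0). Qed.
Let z_gt0 t i : 0 < z t i. Proof. exact: lt_le_trans (z_ge t i). Qed.
Let z_le t i : z t i <= N%:R. Proof. exact: push_weight_le. Qed.

Lemma strat_props i : [/\ strat Gm i !=set0, convex_set (strat Gm i) & compact (strat Gm i)].
Proof. by have [H _ _ _ _] := Hgame; exact: H. Qed.

Lemma constr_convex i k : convex_function (strat Gm i) (fun v => constr Gm i v 0 k).
Proof. by have [_ _ _ H _] := Hgame; have [] := H i k. Qed.

Lemma constr_diff i u k : strat Gm i u ->
  differentiable ((fun v => constr Gm i v 0 k) : 'rV[R]_(Defs.dim Gm i) -> R^o) u.
Proof. by have [_ _ _ H _] := Hgame; have [+ _] := H i k; apply. Qed.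

Lemma strat_bounds i u : strat Gm i u ->
  [/\ enorm u <= L, enorm (constr Gm i u) <= L & enorm ('J (constr Gm i) u) <= M].
Proof. by have [_ _ _ _ [_ H]] := Hgame; exact: H. Qed.

Lemma constr_le i u k : strat Gm i u -> `|constr Gm i u 0 k| <= L.
Proof. by move=> /strat_bounds[_ H _]; exact: le_trans (coord_le_enorm _ _ _) H. Qed.

Lemma strat_diff_le i u v j : strat Gm i u -> strat Gm i v -> `|(u - v) 0 j| <= 2 * L.
Proof.
move=> /strat_bounds[hu _ _] /strat_bounds[hv _ _]; rewrite !mxE.
have := ler_normB (u 0 j) (v 0 j); have := coord_le_enorm u 0 j.
have := coord_le_enorm v 0 j; lra.
Qed.

Context (xi : nat -> noise Gm).
(* traj_muh is mu-hat, traj_nu is mu-hat / z, traj_y is sigma-hat / z, and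
   traj_dir is the direction s_{i,t+1}. *)
Definition traj t := run W al be ga xi x0 t.
Definition traj_x t i := st_x (traj t) i.
Definition traj_mu t i k := st_mu (traj t) i 0 k.
Definition traj_muh t i : 'rV[R]_m := \sum_j W t i j *: st_mu (traj t) j.
Definition traj_nu t i : 'rV[R]_m := (z t.+1 i)^-1 *: traj_muh t i.
Definition traj_y t i : 'rV[R]_n := (z t.+1 i)^-1 *: \sum_j W t i j *: st_sigma (traj t) j.
Definition traj_dir t i := q_map i (traj_x t i) (traj_y t i) (xi t i)
  + traj_nu t i *m ('J (constr Gm i) (traj_x t i))^T.
Hypothesis q_le : forall t i, enorm (q_map i (traj_x t i) (traj_y t i) (xi t i)) <= S.

Lemma traj_zE t i : st_z (traj t) i = z t i.
Proof.
by elim: t i => [|t IH] i //=; rewrite /z /=; apply: eq_bigr => j _; rewrite IH.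
Qed.

Lemma traj_xS t i : traj_x t.+1 i = eproj (strat Gm i) (traj_x t i - al t *: traj_dir t i).
Proof.
rewrite /traj_x /= /traj_dir /traj_y /traj_nu -/(traj t).
have -> : \sum_j W t i j * st_z (traj t) j = z t.+1 i.
  by rewrite /z /=; apply: eq_bigr => j _; rewrite traj_zE.
by [].
Qed.

Lemma traj_muS t i k : traj_mu t.+1 i k =
  Num.max 0 (traj_muh t i 0 k + ga t * (constr Gm i (traj_x t i) 0 k - be t * traj_muh t i 0 k)).
Proof. by rewrite /traj_mu /= -/(traj t) eproj_orthant !mxE. Qed.

Lemma traj_muhE t i k : traj_muh t i 0 k = \sum_j W t i j * traj_mu t j k.
Proof. by rewrite /traj_muh summxE; apply: eq_bigr => j _; rewrite mxE. Qed.

Lemma traj_nuE t i k : traj_nu t i 0 k = (\sum_j W t i j * traj_mu t j k) / z t.+1 i.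
Proof. by rewrite /traj_nu mxE traj_muhE mulrC. Qed.

Lemma traj_x_in t : in_prod (traj_x t).
Proof.
elim: t => [|t IH] i; first exact: Hx0.
have [C0 cC kC] := strat_props i.
by rewrite traj_xS; have [] := eproj_is_proj (traj_x t i - al t *: traj_dir t i) cC kC C0.
Qed.

Definition dual_bound := L / eta.
Let dual_bound_gt0 : 0 < dual_bound. Proof. by rewrite divr_gt0. Qed.

Lemma traj_mu_ge0 t i k : 0 <= traj_mu t i k.
Proof.
case: t => [|t]; first by rewrite /traj_mu /= mxE.
by rewrite traj_muS le_max lexx.
Qed.

Lemma push_weightS t i : z t.+1 i = \sum_j W t i j * z t j. Proof. by []. Qed.

Lemma traj_muh_ge0 t i k : 0 <= traj_muh t i 0 k.
Proof. by rewrite traj_muhE; apply: sumr_ge0 => j _; rewrite mulr_ge0 ?traj_mu_ge0. Qed.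

Lemma traj_muh_le t i k : (forall j, traj_mu t j k <= z t j * (dual_bound / be t)) ->
  traj_muh t i 0 k <= z t.+1 i * (dual_bound / be t).
Proof.
move=> H; rewrite traj_muhE push_weightS mulr_suml; apply: ler_sum => j _.
by rewrite -mulrA ler_wpM2l.
Qed.

(** Averaging treats mu and z alike, so the bound passes to mu-hat. The update then mixes the old
    bound with weight [1 - ga * be] and [z * dual_bound], which dominates the constraint value, and
    this mixture equals the old bound. Passing to the smaller [be t.+1] only enlarges it. *)
Lemma traj_mu_le t i k : traj_mu t i k <= z t i * (dual_bound / be t).
Proof.
elim: t i => [|t IH] i.
  by rewrite /traj_mu /= mxE mulr_ge0 ?divr_ge0 ?ltW.
have h1 := traj_muh_le i IH.
have h2 : `|constr Gm i (traj_x t i) 0 k| <= L := constr_le k (traj_x_in t i).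
have {h2} : constr Gm i (traj_x t i) 0 k <= z t.+1 i * dual_bound.
  apply: le_trans (ler_norm _) _; apply: le_trans h2 _.
  by rewrite /dual_bound mulrC mulrAC -mulrA ler_peMr ?(ltW L_gt0) // ler_pdivlMr // mul1r.
set g := constr _ _ _ _ _ => h2.
have h3 : traj_muh t i 0 k + ga t * (g - be t * traj_muh t i 0 k) <= z t.+1 i * (dual_bound / be t).
  have b1 : 0 <= 1 - ga t * be t.
    by rewrite subr_ge0 mulr_ile1 ?(ltW (ga_gt0 t)) ?(ltW (be_gt0 t)).
  have := ler_wpM2l b1 h1; have := ler_wpM2l (ltW (ga_gt0 t)) h2.
  have -> : (1 - ga t * be t) * (z t.+1 i * (dual_bound / be t)) =
    z t.+1 i * (dual_bound / be t) - ga t * (z t.+1 i * dual_bound) by field; rewrite gt_eqF.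
  lra.
have h4 : z t.+1 i * (dual_bound / be t) <= z t.+1 i * (dual_bound / be t.+1).
  by rewrite !ler_wpM2l ?(ltW dual_bound_gt0) ?(ltW (z_gt0 _ _)) // lef_pV2 ?posrE.
rewrite traj_muS -/g ge_max (le_trans h3 h4) andbT.
by rewrite mulr_ge0 ?divr_ge0 ?ltW.
Qed.

Lemma traj_nu_itv t i k : 0 <= traj_nu t i 0 k <= dual_bound / be t.
Proof.
rewrite traj_nuE -traj_muhE divr_ge0 ?traj_muh_ge0 ?(ltW (z_gt0 _ _)) //=.
by rewrite ler_pdivrMr // mulrC traj_muh_le // => j; exact: traj_mu_le.
Qed.

Definition dir_bound := S + m%:R * dual_bound * M.
Let dir_bound_gt0 : 0 < dir_bound.
Proof. by rewrite ltr_pwDl // mulr_ge0 ?(ltW M_gt0) // mulr_ge0 ?(ltW dual_bound_gt0). Qed.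

Lemma traj_dir_le t i j : `|traj_dir t i 0 j| <= dir_bound / be t.
Proof.
rewrite /traj_dir mxE; apply: le_trans (ler_normD _ _) _.
have h1 := le_trans (coord_le_enorm _ 0 j) (q_le t i).
have h2 : `|(traj_nu t i *m ('J (constr Gm i) (traj_x t i))^T) 0 j| <= m%:R * (dual_bound / be t) * M.
  have -> : (traj_nu t i *m ('J (constr Gm i) (traj_x t i))^T) 0 j =
     dotp (traj_nu t i) (row j ('J (constr Gm i) (traj_x t i))).
    by rewrite mxE /dotp; apply: eq_bigr => k _; rewrite !mxE.
  apply: dotp_le => k.
    by have /andP[h0 h1'] := traj_nu_itv t i k; rewrite ger0_norm.
  rewrite mxE; have [_ _ h] := strat_bounds (traj_x_in t i).
  exact: le_trans (coord_le_enorm _ _ _) h.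
apply: le_trans (lerD h1 h2) _.
rewrite /dir_bound mulrDl; have : S <= S / be t by rewrite ler_peMr ?(ltW S_gt0) // invf_ge1.
rewrite [m%:R * (dual_bound / be t) * M](_ : _ = m%:R * dual_bound * M / be t); last by ring.
lra.
Qed.

Definition dsum : R := \sum_i (Defs.dim Gm i)%:R.

Lemma dim_le_dsum i : (Defs.dim Gm i)%:R <= dsum.
Proof. by rewrite /dsum (bigD1 i) //= lerDl sumr_ge0. Qed.

Lemma dsum_ge0 : 0 <= dsum. Proof. exact: sumr_ge0. Qed.

Lemma traj_x_move t i : enorm (traj_x t.+1 i - traj_x t i) <= al t * (dsum * (dir_bound / be t)).
Proof.
have [C0 cC kC] := strat_props i.
have h := is_proj_dist (eproj_is_proj (traj_x t i - al t *: traj_dir t i) cC kC C0) (traj_x_in t i).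
rewrite -traj_xS addrAC subrr sub0r in h.
rewrite -enorm_le_sqr in h; apply: le_trans h _.
apply: le_trans (enorm_le_sum _) _.
apply: (@le_trans _ _ (\sum_(j < Defs.dim Gm i) al t * (dir_bound / be t))).
  apply: ler_sum => j _; rewrite 2!mxE normrN normrM gtr0_norm //.
  by rewrite ler_wpM2l ?(ltW (al_gt0 t)) // traj_dir_le.
rewrite sumr_const card_ord -[_ *+ _]mulr_natl mulrCA ler_wpM2l ?(ltW (al_gt0 t)) //.
by rewrite ler_wpM2r ?dim_le_dsum // divr_ge0 ?ltW.
Qed.

(** Although mu-hat may be of size 1/beta, it enters the update only through beta * mu-hat, which is
    bounded; the move is thus of order gamma with no loss in beta. Taking the positive part can only
    shorten it, because mu-hat is nonnegative. *)
Lemma traj_mu_move t i k : `|traj_mu t.+1 i k - \sum_j W t i j * traj_mu t j k| <= ga t * (L + N%:R * dual_bound).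
Proof.
rewrite traj_muS -traj_muhE.
have h0 := traj_muh_ge0 t i k; set h := traj_muh t i 0 k in h0 *.
have hg := constr_le k (traj_x_in t i); set g := constr _ _ _ _ _ in hg *.
have hb : be t * h <= N%:R * dual_bound.
  apply: (@le_trans _ _ (be t * (z t.+1 i * (dual_bound / be t)))).
    by rewrite ler_wpM2l ?(ltW (be_gt0 t)) // traj_muh_le // => j; exact: traj_mu_le.
  have -> : be t * (z t.+1 i * (dual_bound / be t)) = z t.+1 i * dual_bound by field; rewrite gt_eqF.
  by rewrite ler_wpM2r ?(ltW dual_bound_gt0).
have hb0 : 0 <= be t * h by rewrite mulr_ge0 // ltW.
have gb : `|ga t * (g - be t * h)| <= ga t * (L + N%:R * dual_bound).
  rewrite normrM gtr0_norm // ler_wpM2l ?(ltW (ga_gt0 t)) //.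
  by move: hg; rewrite !ler_norml => /andP[? ?]; apply/andP; split; lra.
apply: le_trans gb; move: (ga t * _) => e.
have [eh|eh] := leP 0 (h + e); first by rewrite addrAC subrr add0r.
by rewrite sub0r normrN ger0_norm // -normrN (le_trans _ (ler_norm _)) //; lra.
Qed.

Lemma sigma_step t i : st_sigma (traj t.+1) i = \sum_j W t i j *: st_sigma (traj t) j
    + (psi Gm i (traj_x t.+1 i) - psi Gm i (traj_x t i)).
Proof. by rewrite /= -/(traj t) addrA. Qed.

(** The tracking invariant: column sums equal to one preserve the total, and the increments of psi
    telescope. The network mean of the estimates is therefore the exact aggregate. *)
Lemma sigma_sum t : \sum_i st_sigma (traj t) i = \sum_i psi Gm i (traj_x t i).
Proof.
elim: t => [//|t IH].
under eq_bigr do rewrite sigma_step.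
rewrite big_split /= sumrB -IH exchange_big /=.
under eq_bigr do rewrite -scaler_suml W_sum scale1r.
by rewrite addrCA subrr addr0.
Qed.

Definition sigma_move_bound t := Lsig * (al t * (dsum * (dir_bound / be t))).

Lemma sigma_move t i k :
  `|st_sigma (traj t.+1) i 0 k - \sum_j W t i j * st_sigma (traj t) j 0 k| <= sigma_move_bound t.
Proof.
have -> : st_sigma (traj t.+1) i 0 k - \sum_j W t i j * st_sigma (traj t) j 0 k =
    (psi Gm i (traj_x t.+1 i) - psi Gm i (traj_x t i)) 0 k.
  rewrite sigma_step mxE summxE (eq_bigr (fun j => W t i j * st_sigma (traj t) j 0 k)).
    by rewrite addrAC subrr add0r.
  by move=> j _; rewrite mxE.
apply: le_trans (coord_le_enorm _ _ _) _.
have [_ _ _ _ [Hpsi _]] := Hgame; have [_ h] := Hpsi i.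
apply: le_trans (h _ _ (traj_x_in t.+1 i) (traj_x_in t i)) _.
by rewrite ler_wpM2l ?(ltW Lsig_gt0) // traj_x_move.
Qed.

Definition dist_sqr t := \sum_i enorm (traj_x t i - xs i) ^+ 2.
Definition noise_term t :=
  \sum_i dotp (p_map f i (traj_x t i) (traj_y t i) - q_map i (traj_x t i) (traj_y t i) (xi t i))
             (traj_x t i - xs i).
(** The potential of the dual variables. The factor z is what lets the Jensen weights sum to column
    sums when averaging is applied. *)
Definition dual_dist t := \sum_i \sum_k z t i * (traj_mu t i k / z t i - mus 0 k) ^+ 2.
Definition gsum t : 'rV[R]_m := \sum_i constr Gm i (traj_x t i).
(** The primal-dual coupling, which primal descent and dual contraction contain with opposite
    signs. *)
Definition gain t := \sum_i dotp (traj_nu t i) (constr Gm i (traj_x t i)) - dotp mus (gsum t).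

Lemma dotp_suml k (I : finType) (v : I -> 'rV[R]_k) u :
  dotp (\sum_i v i) u = \sum_i dotp (v i) u.
Proof. by rewrite dotpE mulmx_suml summxE; apply: eq_bigr => i _; rewrite dotpE. Qed.

Lemma dotp_sumr k (I : finType) (v : I -> 'rV[R]_k) u :
  dotp u (\sum_i v i) = \sum_i dotp u (v i).
Proof. by rewrite dotpC dotp_suml; apply: eq_bigr => i _; rewrite dotpC. Qed.

Lemma dotp_le0 k (u v : 'rV[R]_k) : (forall j, 0 <= u 0 j) -> vle v 0 -> dotp u v <= 0.
Proof.
move=> u0 v0; rewrite -oppr_ge0 -sumrN; apply: sumr_ge0 => j _.
by rewrite -mulrN mulr_ge0 // oppr_ge0; have := v0 j; rewrite mxE.
Qed.

Lemma equilibrium_terms t :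
  - dotp mus (gsum t) <= \sum_i dotp (p_map f i (xs i) (sigma xs)) (traj_x t i - xs i).
Proof.
have [H1 [s Hs Es]] := Hkkt; have [xs_in xs_le] := Hxs.
have g0 : 0 <= dotp mus (\sum_i constr Gm i (xs i)).
  have -> : \sum_i constr Gm i (xs i) = s.
    by apply/eqP; rewrite eq_sym -subr_eq0 addrC Es.
  have := Hs 0 (fun j => lexx _); rewrite sub0r dotpNr dotpC; lra.
have : - dotp mus (gsum t) <= dotp mus (\sum_i constr Gm i (xs i)) - dotp mus (gsum t) by lra.
move=> /le_trans; apply.
rewrite /gsum !dotp_sumr -sumrB; apply: ler_sum => i _.
have [si Hsi Ei] := H1 i.
have := Hsi _ (traj_x_in t i).
have hc : dotp mus (constr Gm i (xs i)) - dotp mus (constr Gm i (traj_x t i))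
    <= dotp (mus *m ('J (constr Gm i) (xs i))^T) (xs i - traj_x t i).
  apply: (@convex_gradient_dotp R _ _ (strat Gm i)) => // [k|k||k].
  - exact: constr_convex.
  - exact: constr_diff.
  - exact: traj_x_in.
  - by have := mus_ge0 k; rewrite mxE.
have Ep : p_map f i (xs i) (sigma xs) = - (mus *m ('J (constr Gm i) (xs i))^T) - si.
  by apply/eqP; rewrite -subr_eq0 opprD !opprK addrA Ei.
rewrite Ep dotpDl !dotpNl; rewrite -(opprB (traj_x t i)) dotpNr in hc; lra.
Qed.

Lemma primal_step t (Ds Dn : R) :
  (forall i, \sum_k `|(traj_y t i - sigma (traj_x t)) 0 k| <= Ds) ->
  (forall i k, `|traj_nu t i 0 k - N%:R^-1 * \sum_j traj_mu t j k| <= Dn) ->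
  2 * mu * dist_sqr t + 2 * gain t <= (al t)^-1 * (dist_sqr t - dist_sqr t.+1)
     + 2 * noise_term t + 4 * dsum * L * Lf * Ds + 2 * (N%:R * m%:R) * L * Dn
     + dsum * dir_bound ^+ 2 * (al t / be t ^+ 2).
Proof.
move=> HDs HDn; have [xs_in xs_le] := Hxs.
have Ds0 : 0 <= Ds by apply: le_trans (HDs (Ordinal N_gt0)); apply: sumr_ge0.
pose P i := p_map f i (traj_x t i) (traj_y t i).
pose P' i := p_map f i (traj_x t i) (sigma (traj_x t)).
pose SS := \sum_i dotp (traj_dir t i) (traj_x t i - xs i).
pose E2 := \sum_i enorm (traj_dir t i) ^+ 2.
pose X1 := \sum_i dotp (P i - P' i) (traj_x t i - xs i).
pose X2 := \sum_i dotp (P' i - p_map f i (xs i) (sigma xs)) (traj_x t i - xs i).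
pose X3 := \sum_i dotp (p_map f i (xs i) (sigma xs)) (traj_x t i - xs i).
pose X4 := \sum_i dotp (traj_nu t i *m ('J (constr Gm i) (traj_x t i))^T) (traj_x t i - xs i).
pose G1 := \sum_i dotp (traj_nu t i) (constr Gm i (traj_x t i)).
have d1 : dist_sqr t.+1 <= dist_sqr t
    - 2 * al t * SS
    + al t ^+ 2 * E2.
  rewrite /dist_sqr /SS /E2 !mulr_sumr -sumrB -big_split /=; apply: ler_sum => i _.
  have [C0 cC kC] := strat_props i.
  have := is_proj_dist (eproj_is_proj (traj_x t i - al t *: traj_dir t i) cC kC C0) (xs_in i).
  rewrite -traj_xS => /le_trans; apply; rewrite addrAC !enorm_dotp.
  move: (traj_x t i - xs i) (traj_dir t i) => u v; rewrite !dotp_linE (dotpC v u).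
  by rewrite le_eqVlt; apply/orP; left; apply/eqP; ring.
have d2 : E2 <= dsum * (dir_bound / be t) ^+ 2.
  rewrite /E2 /dsum mulr_suml; apply: ler_sum => i _; apply: enorm_le_sup => j.
  exact: traj_dir_le.
(* The direction splits into noise, the error of the aggregate estimate, a strongly monotone part,
   the equilibrium part and the constraint part. *)
have d3 : SS = - noise_term t
    + X1
    + X2
    + X3
    + X4.
  rewrite /noise_term /SS /X1 /X2 /X3 /X4 -sumrN -!big_split /=; apply: eq_bigr => i _.
  rewrite /traj_dir -/(P i).
  move: (q_map i _ _ _) (P i) (P' i) (p_map f i (xs i) _) (_ *m _) (_ - _).
  move=> q p p' p'' v u; rewrite !dotpDl !dotpNl.
  move: (dotp q u) (dotp p u) (dotp p' u) (dotp p'' u) (dotp v u) => *; ring.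
have d4 : - (dsum * (Lf * Ds) * (2 * L)) <= X1.
  rewrite /dsum /X1 !mulr_suml -sumrN; apply: ler_sum => i _.
  have : `|dotp (P i - P' i) (traj_x t i - xs i)| <= (Defs.dim Gm i)%:R * (Lf * Ds) * (2 * L).
    apply: dotp_le => j; last exact: strat_diff_le (traj_x_in t i) (xs_in i).
    apply: le_trans (coord_le_enorm _ _ _) _.
    apply: le_trans (Hlip (traj_x_in t i) _ _) _; rewrite ler_wpM2l ?(ltW Lf_gt0) //.
    exact: le_trans (enorm_le_sum _) (HDs i).
  by rewrite ler_norml => /andP[].
have d5 : mu * dist_sqr t <=
    X2.
  have := Hmono (traj_x_in t) xs_in; rewrite enorm_stackB /pseudo_grad -mxrowB stackB.
  by rewrite dotp_mxrow.
have d6 : - dotp mus (gsum t) <= X3 := equilibrium_terms t.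
have d7 : G1 - N%:R * m%:R * L * Dn <=
   X4.
  pose nubar : 'rV[R]_m := \row_k (N%:R^-1 * \sum_j traj_mu t j k).
  have e1 : \sum_i dotp (traj_nu t i) (constr Gm i (xs i)) <= N%:R * m%:R * L * Dn.
    have -> : \sum_i dotp (traj_nu t i) (constr Gm i (xs i)) =
        \sum_i dotp (traj_nu t i - nubar) (constr Gm i (xs i))
        + dotp nubar (\sum_i constr Gm i (xs i)).
      rewrite dotp_sumr -big_split /=; apply: eq_bigr => i _.
      by rewrite dotpDl dotpNl subrK.
    rewrite -[leRHS]addr0; apply: lerD; last first.
      apply: dotp_le0 => // k; rewrite mxE mulr_ge0 //.
      by apply: sumr_ge0 => j _; exact: traj_mu_ge0.
    rewrite -!mulrA mulr_natl -[X in _ *+ X](card_ord N) -sumr_const.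
    apply: ler_sum => i _; apply: le_trans (ler_norm _) _.
    rewrite [L * Dn]mulrC mulrA; apply: dotp_le => k; last exact: constr_le.
    by rewrite !mxE; have := HDn i k; rewrite /traj_nu !mxE.
  have e2 : G1
      - \sum_i dotp (traj_nu t i) (constr Gm i (xs i)) <=
     X4.
    rewrite /G1 /X4 -sumrB; apply: ler_sum => i _.
    apply: (@convex_gradient_dotp R _ _ (strat Gm i)) => // [k|k||k].
    - exact: constr_convex.
    - exact: (constr_diff k (traj_x_in t i)).
    - exact: traj_x_in.
    - by have /andP[] := traj_nu_itv t i k.
  by rewrite lerBlDr (le_trans _ (lerD e2 e1)) // subrK.
by rewrite /gain -/G1; apply: (primal_arith (al_gt0 t) (be_gt0 t) d1 d2 d3 d4 d5 d6 d7).
Qed.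

Lemma traj_nu_gap t i k : `|constr Gm i (traj_x t i) 0 k / z t.+1 i - be t * traj_nu t i 0 k| <= 2 * dual_bound.
Proof.
have h1 : `|constr Gm i (traj_x t i) 0 k / z t.+1 i| <= dual_bound.
  rewrite normrM normfV (gtr0_norm (z_gt0 _ _)) /dual_bound ler_pM //.
  - by rewrite invr_ge0 ltW.
  - exact: constr_le k (traj_x_in t i).
  - by rewrite lef_pV2 ?posrE.
have /andP[h2 h3] := traj_nu_itv t i k.
have h4 : `|be t * traj_nu t i 0 k| <= dual_bound.
  by rewrite ger0_norm ?mulr_ge0 ?(ltW (be_gt0 t)) // mulrC -ler_pdivlMr.
by apply: le_trans (ler_normB _ _) _; rewrite mulr2n mulrDl mul1r lerD.
Qed.

Lemma dual_contraction t :
  2 * ga t * (- gain t) <= dual_dist t - dual_dist t.+1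
    + ga t * be t * (N%:R * dotp mus mus) + ga t ^+ 2 * (N%:R * m%:R * (2 * dual_bound) ^+ 2).
Proof.
have key k : \sum_i z t.+1 i * (traj_mu t.+1 i k / z t.+1 i - mus 0 k) ^+ 2 <=
    \sum_i z t i * (traj_mu t i k / z t i - mus 0 k) ^+ 2
    + 2 * ga t * \sum_i constr Gm i (traj_x t i) 0 k * (traj_nu t i 0 k - mus 0 k)
    + ga t * be t * (N%:R * (mus 0 k * mus 0 k)) + ga t ^+ 2 * (N%:R * (2 * dual_bound) ^+ 2).
  rewrite -(push_weight_sum W_sum t.+1) !mulr_suml.
  (* Unit column sums let the old potential be rewritten as the Jensen averages of all nodes. *)
  have -> : \sum_i z t i * (traj_mu t i k / z t i - mus 0 k) ^+ 2 =
      \sum_i \sum_j W t i j * (z t j * (traj_mu t j k / z t j - mus 0 k) ^+ 2).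
    by rewrite exchange_big /=; apply: eq_bigr => j _; rewrite -mulr_suml W_sum mul1r.
  rewrite !mulr_sumr -!big_split /=; apply: ler_sum => i _.
  rewrite traj_muS traj_nuE traj_muhE -expr2.
  apply: (@dual_step R N (W t i) (z t) (fun j => traj_mu t j k) (z t.+1 i) (mus 0 k)
    (constr Gm i (traj_x t i) 0 k) (ga t) (be t) (2 * dual_bound)) => //.
  - by have := mus_ge0 k; rewrite mxE.
  - exact: ltW.
  - exact: ltW.
  - by have := traj_nu_gap t i k; rewrite traj_nuE.
have gE : gain t = \sum_k \sum_i constr Gm i (traj_x t i) 0 k * (traj_nu t i 0 k - mus 0 k).
  rewrite /gain /gsum dotp_sumr -sumrB exchange_big /=; apply: eq_bigr => i _.
  by rewrite /dotp -sumrB; apply: eq_bigr => k _; rewrite mulrBr ![_ * constr _ _ _ _ _]mulrC.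
have DE t' : dual_dist t' = \sum_k \sum_i z t' i * (traj_mu t' i k / z t' i - mus 0 k) ^+ 2.
  by rewrite /dual_dist exchange_big.
have total : dual_dist t.+1 <= dual_dist t + 2 * ga t * gain t
    + ga t * be t * (N%:R * dotp mus mus) + ga t ^+ 2 * (N%:R * m%:R * (2 * dual_bound) ^+ 2).
  have -> : N%:R * m%:R * (2 * dual_bound) ^+ 2 = \sum_(k < m) N%:R * (2 * dual_bound) ^+ 2.
    by rewrite sumr_const card_ord -[RHS]mulr_natl; ring.
  rewrite !DE gE; apply: le_trans (ler_sum _ (fun k _ => key k)) _.
  by rewrite !big_split /= -!mulr_sumr.
move: total; move: (dual_dist t) (dual_dist t.+1) (gain t) => d d' h total; lra.
Qed.

Definition sigma_init := \sum_k \sum_i `|psi Gm i (x0 i) 0 k|.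
Definition sigma_bound := Lsig * (dsum * dir_bound).
Definition mu_move_bound := L + N%:R * dual_bound.
Definition dist_bound := dsum * (2 * L) ^+ 2.
Definition dual_dist_bound := N%:R * \sum_k (dual_bound + mus 0 k) ^+ 2.

Lemma sigma_bound_ge0 : 0 <= sigma_bound.
Proof. by rewrite mulr_ge0 ?(ltW Lsig_gt0) // mulr_ge0 ?dsum_ge0 ?(ltW dir_bound_gt0). Qed.

Lemma dist_sqr_le t : dist_sqr t <= dist_bound.
Proof.
rewrite /dist_bound /dsum mulr_suml; apply: ler_sum => i _; apply: enorm_le_sup => j.
by apply: strat_diff_le; [exact: traj_x_in | have [H _] := Hxs; exact: H].
Qed.

Lemma dist_sqr_ge0 t : 0 <= dist_sqr t.
Proof. by apply: sumr_ge0 => i _; rewrite sqr_ge0. Qed.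

Lemma dual_dist_ge0 t : 0 <= dual_dist t.
Proof.
by do 2!apply: sumr_ge0 => ? _; rewrite mulr_ge0 ?sqr_ge0 ?(ltW (z_gt0 _ _)).
Qed.

Lemma dual_dist_le t : dual_dist t <= dual_dist_bound / be t ^+ 2.
Proof.
rewrite /dual_dist exchange_big /dual_dist_bound mulr_sumr mulr_suml; apply: ler_sum => k _.
rewrite -(push_weight_sum W_sum t) !mulr_suml; apply: ler_sum => i _.
rewrite -[leRHS]mulrA ler_wpM2l ?(ltW (z_gt0 _ _)) //.
have a0 : 0 <= mus 0 k by have := mus_ge0 k; rewrite mxE.
have h1 : traj_mu t i k / z t i <= dual_bound / be t by rewrite ler_pdivrMr // mulrC traj_mu_le.
have h0 : 0 <= traj_mu t i k / z t i by rewrite divr_ge0 ?traj_mu_ge0 ?(ltW (z_gt0 _ _)).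
have h2 : mus 0 k <= mus 0 k / be t by rewrite ler_peMr // invf_ge1.
have h3 : `|traj_mu t i k / z t i - mus 0 k| <= (dual_bound + mus 0 k) / be t.
  have K0 : 0 <= dual_bound / be t by rewrite divr_ge0 ?ltW.
  by rewrite mulrDl ler_norml; apply/andP; split; lra.
rewrite -expr_div_n -(real_normK (num_real (_ - _))) ler_sqr ?nnegrE //.
exact: le_trans h3.
Qed.

Section summation.
Context (C0 : R) (C0_gt0 : 0 < C0).
Hypothesis consensus : forall (u : nat -> 'I_N -> R) (e : nat -> R) (e0 : R),
    (forall t i, `|u t.+1 i - \sum_j W t i j * u t j| <= e t) ->
    (forall t, e t <= e0) ->
  exists2 D : nat -> R,
    forall t i, `|(z t.+1 i)^-1 * (\sum_j W t i j * u t j)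
                  - N%:R^-1 * \sum_j u t j| <= D t &
    forall T, \sum_(0 <= t < T) D t
      <= C0 * (\sum_i `|u 0%N i| + e0 + \sum_(0 <= t < T) e t).

(** Push-sum consensus in each coordinate, the perturbation being the Lipschitz image of the primal
    move, of order alpha/beta. As alpha is at most beta, this has the uniform bound [sigma_bound]
    too. *)
Lemma sigma_consensus : exists2 Ds : nat -> R,
  forall t i, \sum_k `|(traj_y t i - sigma (traj_x t)) 0 k| <= Ds t &
  forall T, \sum_(0 <= t < T) Ds t <=
    C0 * (sigma_init + n%:R * sigma_bound + n%:R * sigma_bound * \sum_(0 <= t < T) al t / be t).
Proof.
have al_beD t : al t / be t <= 1 by rewrite ler_pdivrMr // mul1r.
have esE t : sigma_move_bound t = sigma_bound * (al t / be t) by rewrite /sigma_move_bound /sigma_bound; ring.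
have es_le t : sigma_move_bound t <= sigma_bound by rewrite esE ler_piMr // sigma_bound_ge0.
have /choice[D HD] : forall k : 'I_n, exists D : nat -> R,
   (forall t i, `|(z t.+1 i)^-1 * (\sum_j W t i j * st_sigma (traj t) j 0 k)
                  - N%:R^-1 * \sum_j st_sigma (traj t) j 0 k| <= D t) /\
   (forall T, \sum_(0 <= t < T) D t <= C0 * (\sum_i `|psi Gm i (x0 i) 0 k| + sigma_bound
       + \sum_(0 <= t < T) sigma_move_bound t)).
  move=> k; have [D H1 H2] := @consensus (fun t i => st_sigma (traj t) i 0 k) sigma_move_bound sigma_bound
    (fun t i => sigma_move t i k) es_le.
  by exists D.
exists (fun t => \sum_k D k t) => [t i|T].
  apply: ler_sum => k _; have [H _] := HD k; have := H t i.
  have -> : (traj_y t i - sigma (traj_x t)) 0 k = (z t.+1 i)^-1 * (\sum_j W t i j * st_sigma (traj t) j 0 k)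
                  - N%:R^-1 * \sum_j st_sigma (traj t) j 0 k.
    rewrite /traj_y /sigma -sigma_sum !mxE !summxE; congr (_ * _ - _).
    by apply: eq_bigr => j _; rewrite mxE.
  by [].
rewrite exchange_big /=.
apply: le_trans (ler_sum _ (fun k _ => (HD k).2 T)) _.
rewrite -mulr_sumr ler_wpM2l ?(ltW C0_gt0) // !big_split /= !sumr_const card_ord.
have -> : \sum_(0 <= t < T) sigma_move_bound t = sigma_bound * \sum_(0 <= t < T) al t / be t.
  by rewrite mulr_sumr; apply: eq_bigr => t _; exact: esE.
by rewrite -[sigma_bound *+ n]mulr_natl -[(sigma_bound * _) *+ n]mulr_natl mulrA.
Qed.

Lemma multiplier_consensus : exists2 Dn : nat -> R,
  forall t, 0 <= Dn t /\ forall i k, `|traj_nu t i 0 k - N%:R^-1 * \sum_j traj_mu t j k| <= Dn t &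
  forall T, \sum_(0 <= t < T) Dn t <=
    C0 * (m%:R * mu_move_bound + m%:R * mu_move_bound * \sum_(0 <= t < T) ga t).
Proof.
have Gs0 : 0 <= mu_move_bound.
  by apply: addr_ge0; [exact: ltW | exact: mulr_ge0 (ler0n _ _) (ltW dual_bound_gt0)].
have g_le t : ga t * mu_move_bound <= mu_move_bound by rewrite ler_piMl ?ga_le1.
have /choice[D HD] : forall k : 'I_m, exists D : nat -> R,
   (forall t i, `|traj_nu t i 0 k - N%:R^-1 * \sum_j traj_mu t j k| <= D t) /\
   (forall T, \sum_(0 <= t < T) D t <= C0 * (mu_move_bound + mu_move_bound * \sum_(0 <= t < T) ga t)).
  move=> k; have [D H1 H2] := @consensus (fun t i => traj_mu t i k)
    (fun t => ga t * mu_move_bound) mu_move_bound (fun t i => traj_mu_move t i k) g_le.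
  exists D; split=> [t i|T]; first by rewrite traj_nuE mulrC; exact: H1.
  apply: le_trans (H2 T) _; rewrite ler_wpM2l ?(ltW C0_gt0) //.
  rewrite big1 => [|i _]; last by rewrite /traj_mu /= mxE normr0.
  by rewrite add0r -mulr_suml [_ * mu_move_bound]mulrC.
have D0 k t : 0 <= D k t by apply: le_trans ((HD k).1 t (Ordinal N_gt0)).
exists (fun t => \sum_k D k t) => [t|T].
  split=> [|i k]; first exact: sumr_ge0.
  apply: le_trans ((HD k).1 t i) _; rewrite (bigD1 k) //= lerDl.
  by apply: sumr_ge0.
rewrite exchange_big /=.
apply: le_trans (ler_sum _ (fun k _ => (HD k).2 T)) _.
by rewrite sumr_const card_ord -[leLHS]mulr_natl mulrCA -!mulrA mulrDr.
Qed.

Definition trajectory_const := dist_bound + dual_dist_bound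
  + 4 * dsum * L * Lf * (C0 * (sigma_init + n%:R * sigma_bound))
  + 2 * (N%:R * m%:R) * L * (C0 * (m%:R * mu_move_bound)) + dsum * dir_bound ^+ 2 + N%:R * dotp mus mus
  + N%:R * m%:R * (2 * dual_bound) ^+ 2.

(** The horizon is [T.+1]. Distances and noise are summed from time 1, as in the time average, while
    nonnegative errors are enlarged to start at time 0, where the consensus sums begin. The constant
    does not involve the noise path. *)
Lemma trajectory_sum T :
  2 * mu * \sum_(1 <= t < T.+2) dist_sqr t <=
  trajectory_const * (1 + (al T.+1)^-1 + (ga T.+1 * be T.+1 ^+ 2)^-1
    + (\sum_(0 <= t < T.+2) al t / be t ^+ 2 + \sum_(0 <= t < T.+2) be t
       + \sum_(0 <= t < T.+2) ga t))
  + 2 * \sum_(1 <= t < T.+2) noise_term t.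
Proof.
have [Ds HDs SDs] := sigma_consensus; have [Dn HDn SDn] := multiplier_consensus.
pose per t := (al t)^-1 * (dist_sqr t - dist_sqr t.+1)
  + (ga t)^-1 * (dual_dist t - dual_dist t.+1) + 2 * noise_term t
  + 4 * dsum * L * Lf * Ds t + 2 * (N%:R * m%:R) * L * Dn t
  + dsum * dir_bound ^+ 2 * (al t / be t ^+ 2) + N%:R * dotp mus mus * be t
  + N%:R * m%:R * (2 * dual_bound) ^+ 2 * ga t.
have step t : 2 * mu * dist_sqr t <= per t.
  have h1 := primal_step (HDs t) (HDn t).2.
  have h2 := dual_contraction t.
  exact: (dual_arith (ga_gt0 t) h1 h2).
have sum1 : \sum_(1 <= t < T.+2) (al t)^-1 * (dist_sqr t - dist_sqr t.+1) <= (al T.+1)^-1 * dist_bound.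
  apply: abel_sum_le => [t _|t|t|t].
  - exact: dist_sqr_le.
  - exact: dist_sqr_ge0.
  - by rewrite invr_ge0 ltW.
  - by rewrite lef_pV2 ?posrE.
have /nonincreasing_seqP be_mono := be_dec.
have sum2 : \sum_(1 <= t < T.+2) (ga t)^-1 * (dual_dist t - dual_dist t.+1)
    <= (ga T.+1)^-1 * (dual_dist_bound / be T.+1 ^+ 2).
  apply: abel_sum_le => [t tT|t|t|t].
  - apply: le_trans (dual_dist_le _) _.
    rewrite ler_wpM2l //; last by rewrite lef_pV2 ?posrE ?exprn_gt0 // ler_sqr ?nnegrE ?(ltW (be_gt0 _)) // be_mono.
    by rewrite mulr_ge0 // sumr_ge0 // => k _; exact: sqr_ge0.
  - exact: dual_dist_ge0.
  - by rewrite invr_ge0 ltW.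
  - by rewrite lef_pV2 ?posrE.
have total : 2 * mu * \sum_(1 <= t < T.+2) dist_sqr t <= \sum_(1 <= t < T.+2) per t.
  by rewrite mulr_sumr; apply: ler_sum => t _; exact: step.
rewrite /per !big_split /= -!mulr_sumr in total.
have drop (X : nat -> R) : (forall t, 0 <= X t) ->
    \sum_(1 <= t < T.+2) X t <= \sum_(0 <= t < T.+2) X t.
  by move=> X0; rewrite [leRHS]big_ltn // lerDr.
have Ds0 t : 0 <= Ds t.
  by apply: le_trans (HDs t (Ordinal N_gt0)); apply: sumr_ge0.
have sDs := le_trans (drop _ Ds0) (SDs T.+2).
have q_le' t : al t / be t <= al t / be t ^+ 2.
  rewrite ler_wpM2l ?(ltW (al_gt0 t)) // lef_pV2 ?posrE ?exprn_gt0 //.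
  by rewrite expr2 ler_piMl ?(ltW (be_gt0 t)).
have sQ := ler_sum (index_iota 0 T.+2) (fun t (_ : xpredT t) => q_le' t).
have Q0 t : 0 <= al t / be t ^+ 2.
  by rewrite divr_ge0 ?exprn_ge0 ?(ltW (al_gt0 t)) ?(ltW (be_gt0 t)).
have sQ' := drop _ Q0.
have sbe := drop _ (fun t => ltW (be_gt0 t)).
have sga := drop _ (fun t => ltW (ga_gt0 t)).
have sDn := le_trans (drop _ (fun t => (HDn t).1)) (SDn T.+2).
have sum2' : \sum_(1 <= t < T.+2) (ga t)^-1 * (dual_dist t - dual_dist t.+1)
    <= dual_dist_bound * (ga T.+1 * be T.+1 ^+ 2)^-1.
  by rewrite [(_ * be _ ^+ 2)^-1]invfM mulrCA.
rewrite [(al _)^-1 * dist_bound]mulrC in sum1.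
have ge0s := (ltW L_gt0, ltW Lf_gt0, ltW C0_gt0, ltW dual_bound_gt0, ltW dir_bound_gt0, dsum_ge0, sigma_bound_ge0).
rewrite /trajectory_const; apply: (sum_arith total sum1 sum2' sDs sQ sDn sQ' sbe sga).
- by rewrite !mulr_ge0 ?ge0s.
- by rewrite !mulr_ge0 ?ge0s.
- by rewrite mulr_ge0 ?sqr_ge0 ?ge0s.
- by rewrite mulr_ge0 ?dotp_ge0.
- by rewrite mulr_ge0 ?sqr_ge0 // mulr_ge0.
- by rewrite ge0s.
- by do 2!apply: sumr_ge0 => ? _.
- by rewrite mulr_ge0 ?ge0s.
- apply: mulr_ge0 => //; apply: addr_ge0; first exact: ltW.
  exact: mulr_ge0 (ler0n _ _) (ltW dual_bound_gt0).
- by apply: sumr_ge0 => t _; exact: Q0.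
- by apply: sumr_ge0 => t _; exact: ltW.
- by apply: sumr_ge0 => t _; exact: ltW.
- by rewrite invr_ge0 ltW.
- by rewrite invr_ge0 mulr_ge0 ?exprn_ge0 // ltW.
- by rewrite mulr_ge0 ?sqr_ge0 ?ge0s.
- by rewrite mulr_ge0 // sumr_ge0 // => k _; exact: sqr_ge0.
Qed.

End summation.

End trajectory.

(** * Sums of power step sizes *)

Section power_rates.
Context (R : realType).
Implicit Types (a b : R) (t T : nat).

Lemma power_step_itv a t : 0 <= a -> 0 < power_step a t <= 1.
Proof.
case: t => [|t] a0 /=; first by rewrite ltr01 lexx.
rewrite invr_gt0 powR_gt0 //= invf_le1 ?powR_gt0 //.
by rewrite -[leLHS](powRr0 t.+1%:R) ler_powR // ler1n.
Qed.

Lemma power_step_dec a t : 0 <= a -> power_step a t.+1 <= power_step a t.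
Proof.
case: t => [|t] a0 /=; first by have /andP[] := power_step_itv 1 a0.
by rewrite lef_pV2 ?posrE ?powR_gt0 // ge0_ler_powR ?nnegrE // ler_nat.
Qed.

Lemma power_step_le a b t : a <= b -> power_step b t <= power_step a t.
Proof.
case: t => [|t] ab //=; rewrite lef_pV2 ?posrE ?powR_gt0 //.
by rewrite ler_powR // ler1n.
Qed.

Lemma power_step_ratio a b t :
  power_step a t / power_step b t ^+ 2 = power_step (a - 2 * b) t.
Proof.
case: t => [|t] /=; first by rewrite expr1n divr1.
have t0 : 0 < t.+1%:R :> R by [].
have -> : t.+1%:R `^ (a - 2 * b) = t.+1%:R `^ a / (t.+1%:R `^ b) ^+ 2 :> R.
  by rewrite powRB ?lt0r_neq0 ?implybT // [2 * b]mulrC powRrM powR_mulrn ?powR_ge0.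
by field; rewrite !gt_eqF ?powR_gt0.
Qed.

(** Induction in place of an integral comparison. With c = 1 - b, x = T and y = T + 1, Young's
    inequality gives x^c y^b <= c x + b y = y - c, which is the increment needed after division by c
    y^b. *)
Lemma sum_power_step b T : 0 < b -> b < 1 ->
  \sum_(1 <= t < T.+1) power_step b t <= T%:R `^ (1 - b) / (1 - b).
Proof.
move=> b0 b1; have c0 : 0 < 1 - b by rewrite subr_gt0.
elim: T => [|T IH].
  by rewrite big_geq // divr_ge0 ?powR_ge0 // ltW.
rewrite big_nat_recr //= -lerBrDr; apply: le_trans IH _.
set c := 1 - b in c0 *; set x : R := T%:R; set y : R := T.+1%:R.
have x0 : 0 <= x by [].
have y0 : 0 < y by [].
have yE : y = x + 1 by rewrite /y /x natr1.
have yc : y `^ c * y `^ b = y.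
  rewrite -powRD ?subrK ?powRr1 ?ltW //.
  by rewrite gt_eqF ?implybT.
have Y : x `^ c * y `^ b <= x * c + y * b.
  have := @conjugate_powR R (x `^ c) (y `^ b) c^-1 b^-1.
  rewrite !powR_ge0 !invr_gt0 c0 b0 !invrK subrK => /(_ isT isT isT isT erefl).
  by rewrite -!powRrM !mulfV ?gt_eqF // !powRr1 // ltW.
have yb0 : 0 < y `^ b by rewrite powR_gt0.
rewrite -(ler_pM2r yb0) -(ler_pM2r c0).
have -> : x `^ c / c * y `^ b * c = x `^ c * y `^ b by field; rewrite gt_eqF.
have -> : (y `^ c / c - (y `^ b)^-1) * y `^ b * c = y `^ c * y `^ b - c.
  by field; rewrite !gt_eqF.
apply: le_trans Y _; rewrite yc yE /c; lra.
Qed.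

(** Every summand is at most a constant times T^(1 - rate). The five exponents of the minimum come,
    in order, from 1/alpha_T, from 1/(gamma_T beta_T^2), and from the sums of gamma, of beta and of
    alpha/beta^2. *)
Lemma rate_sum (a1 a2 a3 : R) : 0 < a1 -> a1 < 1 -> 0 < a3 -> a3 < 1 ->
  0 < 2 * a2 -> 2 * a2 < a1 -> 2 * a2 + a3 < 1 ->
  let rate := Num.min (1 - a1) (Num.min (1 - 2 * a2 - a3)
                (Num.min a3 (Num.min a2 (a1 - 2 * a2)))) in
  exists2 C : R, 0 < C & forall T, (0 < T)%N ->
    1 + (power_step a1 T)^-1 + (power_step a3 T * power_step a2 T ^+ 2)^-1
    + (\sum_(0 <= t < T.+1) power_step a1 t / power_step a2 t ^+ 2
       + \sum_(0 <= t < T.+1) power_step a2 t + \sum_(0 <= t < T.+1) power_step a3 t)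
    <= C * (T%:R * T%:R `^ (- rate)).
Proof.
move=> a1_0 a1_1 a3_0 a3_1 a2_0 a12 a23 rate.
have a20 : 0 < a2 by lra.
have [r1 r2 r3 [r4 r5]] : [/\ rate <= 1 - a1, rate <= 1 - 2 * a2 - a3, rate <= a3 &
    rate <= a2 /\ rate <= a1 - 2 * a2].
  by rewrite /rate !ge_min !lexx !orbT.
pose c1 := (1 - (a1 - 2 * a2))^-1; pose c2 := (1 - a2)^-1; pose c3 := (1 - a3)^-1.
have c10 : 0 < c1 by rewrite invr_gt0; lra.
have c20 : 0 < c2 by rewrite invr_gt0; lra.
have c30 : 0 < c3 by rewrite invr_gt0; lra.
(* In each [1 + c], the 1 accounts for the term t = 0, where the step size is 1. *)
exists (1 + 1 + 1 + (1 + c1 + (1 + c2) + (1 + c3))); first lra.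
move=> T T0; set Z := T%:R * _.
have T1 : 1 <= T%:R :> R by rewrite ler1n.
have pw e : e <= 1 - rate -> T%:R `^ e <= Z.
  move=> he; suff -> : Z = T%:R `^ (1 - rate) by rewrite ler_powR.
  by rewrite powRD ?powRr1 // pnatr_eq0 -lt0n T0 implybT.
have Z1 : 1 <= Z by rewrite -(powRr0 T%:R) pw //; lra.
have sums b : 0 < b -> b < 1 -> rate <= b ->
    \sum_(0 <= t < T.+1) power_step b t <= (1 + (1 - b)^-1) * Z.
  move=> b0 b1 rb; rewrite big_ltn //= mulrDl mul1r lerD //.
  apply: le_trans (sum_power_step T b0 b1) _.
  by rewrite mulrC ler_wpM2l ?invr_ge0 ?pw //; lra.
have e1 : (power_step a1 T)^-1 = T%:R `^ a1.
  by case: T T0 {T1 Z pw Z1 sums} => // T _ /=; rewrite invrK.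
have e2 : (power_step a3 T * power_step a2 T ^+ 2)^-1 = T%:R `^ (2 * a2 + a3).
  case: T T0 {T1 Z pw Z1 sums e1} => // T _ /=.
  rewrite invfM exprVn !invrK powRD ?pnatr_eq0 ?implybT // mulrC [2 * a2]mulrC powRrM.
  by rewrite powR_mulrn ?powR_ge0.
have e3 : \sum_(0 <= t < T.+1) power_step a1 t / power_step a2 t ^+ 2 =
   \sum_(0 <= t < T.+1) power_step (a1 - 2 * a2) t.
  by apply: eq_bigr => t _; rewrite power_step_ratio.
rewrite e1 e2 e3.
have h1 : T%:R `^ a1 <= Z by apply: pw; lra.
have h2 : T%:R `^ (2 * a2 + a3) <= Z by apply: pw; lra.
have h3 : \sum_(0 <= t < T.+1) power_step (a1 - 2 * a2) t <= (1 + c1) * Z by apply: sums; lra.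
have h4 : \sum_(0 <= t < T.+1) power_step a2 t <= (1 + c2) * Z by apply: sums; lra.
have h5 : \sum_(0 <= t < T.+1) power_step a3 t <= (1 + c3) * Z by apply: sums; lra.
move: h1 h2 h3 h4 h5 Z1; clear.
move: Z c1 c2 c3 (T%:R `^ a1) (T%:R `^ _) => Z d1 d2 d3 p1 p2.
move: (\sum_(0 <= t < _) _) (\sum_(0 <= t < _) _) (\sum_(0 <= t < _) _) => s1 s2 s3.
lra.
Qed.

End power_rates.

(** * Concentration of bounded martingales *)

Definition bounded_measurable d (T : measurableType d) (R : realType) (f : T -> R) : Prop :=
  measurable_fun setT f /\ exists K, forall w, `|f w| <= K.

Section bounded_measurable_theory.
Context d (T : measurableType d) (R : realType).
Implicit Types f g : T -> R.

Lemma bounded_measurable_cst (c : R) : bounded_measurable (fun _ : T => c).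
Proof. by split; [exact: measurable_cst | exists `|c|]. Qed.

Lemma bounded_measurableD f g : bounded_measurable f -> bounded_measurable g ->
  bounded_measurable (fun w => f w + g w).
Proof.
move=> [mf [K fK]] [mg [K' gK]]; split; first exact: measurable_funD.
by exists (K + K') => w; rewrite (le_trans (ler_normD _ _)) // lerD.
Qed.

Lemma bounded_measurableM f g : bounded_measurable f -> bounded_measurable g ->
  bounded_measurable (fun w => f w * g w).
Proof.
move=> [mf [K fK]] [mg [K' gK]]; split; first exact: measurable_funM.
by exists (K * K') => w; rewrite normrM ler_pM.
Qed.

Lemma bounded_measurable_sum (I : Type) (s : seq I) (h : I -> T -> R) :
  (forall i, bounded_measurable (h i)) -> bounded_measurable (fun w => \sum_(i <- s) h i w).
Proof.
move=> Hh; elim: s => [|i s IH].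
  by under eq_fun do rewrite big_nil; exact: bounded_measurable_cst.
by under eq_fun do rewrite big_cons; exact: bounded_measurableD.
Qed.

Lemma bounded_measurable_indic (A : set T) :
  measurable A -> bounded_measurable (\1_A : T -> R).
Proof.
move=> mA; split; first exact: measurable_indic.
by exists 1 => w; rewrite indicE normr_nat lern1 leq_b1.
Qed.

Context (P : probability T R).

Lemma bounded_measurable_integrable f : bounded_measurable f ->
  P.-integrable setT (EFin \o f).
Proof.
move=> [mf [K fK]]; apply: measurable_bounded_integrable => //.
  exact: le_lt_trans (probability_le1 P measurableT) (ltry _).
exists K; split; first exact: num_real.
by move=> x Kx w _; apply: le_trans (fK w) (ltW Kx).
Qed.

Lemma Rintegral_le_bound f (K : R) : bounded_measurable f -> (forall w, `|f w| <= K) ->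
  `|\int[P]_w f w| <= K.
Proof.
move=> bf fK; have [mf _] := bf.
apply: le_trans (le_normr_Rintegral measurableT (bounded_measurable_integrable bf)) _.
have bn : bounded_measurable (fun w => `|f w|).
  by split; [exact: measurableT_comp | exists K => w; rewrite normr_id].
apply: (@le_trans _ _ (\int[P]_(w in setT) K)).
  apply: le_Rintegral => //; first exact: bounded_measurable_integrable.
  exact/bounded_measurable_integrable/bounded_measurable_cst.
rewrite Rintegral_cst //.
have p1 : fine (P [set: T]) = 1 by rewrite probability_setT.
by rewrite -[leRHS]mulr1 -[X in _ <= _ * X]p1.
Qed.

Lemma Rintegral_step f (n : nat) (c : 'I_n -> R) (A : 'I_n -> set T) :
  bounded_measurable f -> (forall i, measurable (A i)) ->
  (forall i, \int[P]_(w in A i) f w = 0) ->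
  \int[P]_w ((\sum_i c i * \1_(A i) w) * f w) = 0.
Proof.
move=> bf mA A0.
have E : forall s : seq 'I_n, \int[P]_w (\sum_(i <- s) (c i * (\1_(A i) w * f w))) = 0.
  have bi i : bounded_measurable (fun w => \1_(A i) w * f w).
    by apply: bounded_measurableM => //; exact: bounded_measurable_indic.
  have bci i : bounded_measurable (fun w => c i * (\1_(A i) w * f w)).
    by apply: bounded_measurableM => //; exact: bounded_measurable_cst.
  elim=> [|i s IH].
    under eq_Rintegral do rewrite big_nil.
    by rewrite Rintegral_cst // mul0r.
  under eq_Rintegral do rewrite big_cons.
  rewrite RintegralD //; first last.
  - exact/bounded_measurable_integrable/bounded_measurable_sum.
  - exact: bounded_measurable_integrable.
  rewrite IH addr0 RintegralZl //; last exact: bounded_measurable_integrable.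
  suff -> : \int[P]_w (\1_(A i) w * f w) = \int[P]_(w in A i) f w by rewrite A0 mulr0.
  rewrite [RHS]Rintegral_mkcond; apply: eq_Rintegral => w _.
  by rewrite /patch indicE; case: (w \in A i); rewrite ?mul1r ?mul0r.
rewrite -[RHS](E (index_enum 'I_n)); apply: eq_Rintegral => w _.
by rewrite mulr_suml; apply: eq_bigr => i _; rewrite mulrA.
Qed.

(** Orthogonality passes from events to bounded functions: rounding [Y] down to multiples of 1/(n+1)
    gives a step function over events of the sigma-algebra, and the rounding costs at most
    K/(n+1). *)
Lemma Rintegral_orthogonal (G : set (set T)) (f Y : T -> R) :
  (forall A, <<s G >> A -> measurable A) -> bounded_measurable f ->
  (forall A, <<s G >> A -> \int[P]_(w in A) f w = 0) ->
  bounded_measurable (Y : g_sigma_algebraType G -> R) ->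
  \int[P]_w (Y w * f w) = 0.
Proof.
move=> sG bf f0 [mY [c Yc]].
have mYT : measurable_fun (setT : set T) Y.
  by move=> _ B mB; apply: sG; exact: mY.
have [_ [K fK]] := bf.
have bY : bounded_measurable Y by split=> //; exists c.
have K0 : 0 <= K := le_trans (normr_ge0 _) (fK point).
have Yc0 w : 0 <= Y w + c by have := Yc w; rewrite ler_norml => /andP[]; lra.
have Yc2 w : Y w + c <= 2 * c by have := Yc w; rewrite ler_norml => /andP[]; lra.
have main n : `|\int[P]_w (Y w * f w)| <= K / n.+1%:R.
  have n0 : 0 < n.+1%:R :> R by [].
  (* Adding the bound [c] makes the argument nonnegative, as truncation to a natural number
     requires; [J] bounds the number of values. *)
  pose k w := Num.truncn (n.+1%:R * (Y w + c)).
  have kI w : (k w)%:R <= n.+1%:R * (Y w + c) < (k w).+1%:R.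
    by apply: truncn_itv; rewrite mulr_ge0.
  pose J := (Num.truncn (n.+1%:R * (2 * c))).+1.
  have kJ w : (k w < J)%N.
    by rewrite ltnS /k le_truncn // ler_wpM2l.
  pose A (j : 'I_J) := k @^-1` [set val j].
  pose a (j : 'I_J) := (val j)%:R / n.+1%:R - c.
  have GA j : <<s G >> (A j).
    rewrite (_ : A j = (fun w => n.+1%:R * (Y w + c)) @^-1` `[(val j)%:R, (val j).+1%:R[%classic).
      have : measurable_fun (setT : set (g_sigma_algebraType G)) (fun w => n.+1%:R * (Y w + c)).
        by apply: measurable_funM => //; exact: measurable_funD.
      by move=> /(_ measurableT _ (measurable_itv `[(val j)%:R, (val j).+1%:R[)); rewrite setTI.
    apply/seteqP; split=> w /=; rewrite in_itv /=; first by move=> <-.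
    by move=> /truncn_def.
  have aE w : \sum_j a j * \1_(A j) w = (k w)%:R / n.+1%:R - c.
    rewrite (bigD1 (Ordinal (kJ w))) //= big1 => [|j jk].
      by rewrite addr0 indicE mem_set ?mulr1.
    rewrite indicE memNset ?mulr0 // => kj; case/eqP: jk; exact/val_inj/esym.
  have bS : bounded_measurable (fun w => (\sum_j a j * \1_(A j) w) * f w).
    apply: bounded_measurableM => //; apply: bounded_measurable_sum => j.
    apply: bounded_measurableM; first exact: bounded_measurable_cst.
    by apply: bounded_measurable_indic; exact: sG.
  have bD : bounded_measurable (fun w => (Y w - \sum_j a j * \1_(A j) w) * f w).
    under eq_fun do rewrite mulrBl -mulN1r.
    apply: bounded_measurableD; first exact: bounded_measurableM.
    by apply: bounded_measurableM => //; exact: bounded_measurable_cst.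
  have -> : \int[P]_w (Y w * f w) = \int[P]_w ((Y w - \sum_j a j * \1_(A j) w) * f w).
    under [RHS]eq_Rintegral do rewrite mulrBl.
    rewrite RintegralB //; first last.
    - exact: bounded_measurable_integrable.
    - by apply: bounded_measurable_integrable; exact: bounded_measurableM.
    rewrite (Rintegral_step _ bf) ?subr0 // => j; first exact: sG.
    exact: f0.
  apply: Rintegral_le_bound => // w; rewrite normrM mulrC ler_pM // aE.
  have /andP[h1 h2] := kI w.
  rewrite ler_norml; apply/andP; split.
    rewrite -(ler_pM2l n0); have -> : n.+1%:R * (Y w - ((k w)%:R / n.+1%:R - c)) =
      n.+1%:R * (Y w + c) - (k w)%:R by field; rewrite gt_eqF.
    by rewrite mulrN mulfV ?gt_eqF //; lra.
  rewrite -(ler_pM2l n0); have -> : n.+1%:R * (Y w - ((k w)%:R / n.+1%:R - c)) =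
    n.+1%:R * (Y w + c) - (k w)%:R by field; rewrite gt_eqF.
  rewrite mulfV ?gt_eqF //; rewrite -natr1 in h2; lra.
apply/eqP; rewrite -normr_le0; apply/ler_addgt0Pr => e e0; rewrite add0r.
apply: le_trans (main (Num.truncn (K / e))) _.
by rewrite ler_pdivrMr // mulrC -ler_pdivrMr // ltW // truncnS_gt.
Qed.

End bounded_measurable_theory.

(** With u = y - 2 y^2, the bound exp(-u) >= 1 - u reduces the claim to (1 + y)(1 - u) >= 1, and the
    left side is 1 + y^2 (1 + 2 y). *)
Lemma expR_quadratic_le (R : realType) (y : R) :
  `|y| <= 2^-1 -> expR (y - 2 * y ^+ 2) <= 1 + y.
Proof.
rewrite ler_norml => /andP[y1 y2].
have h0 : 0 < 1 + y by lra.
have h := expR_ge1Dx (- (y - 2 * y ^+ 2)).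
have e0 : 0 < expR (y - 2 * y ^+ 2) by exact: expR_gt0.
rewrite expRN in h; move: e0 h; move: (expR _) => e e0 h.
have q : 1 <= (1 + y) * (1 + - (y - 2 * y ^+ 2)).
  have -> : (1 + y) * (1 + - (y - 2 * y ^+ 2)) = 1 + y ^+ 2 * (1 + 2 * y) by ring.
  by rewrite lerDl mulr_ge0 ?sqr_ge0 //; lra.
rewrite -[e]mul1r -ler_pdivlMr //; apply: le_trans q _.
by rewrite ler_wpM2l // ltW.
Qed.

Section concentration.
Context d (T : measurableType d) (R : realType) (P : probability T R).
Context (G : nat -> set (set T)).
Hypothesis sG : forall t A, <<s G t >> A -> measurable A.
Hypothesis G_mono : forall t A, <<s G t >> A -> <<s G t.+1 >> A.
Context (x : nat -> T -> R) (K : R).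
Hypothesis x_meas : forall t,
  measurable_fun (setT : set (g_sigma_algebraType (G t.+1))) (x t).
Hypothesis x_le : forall t w, `|x t w| <= K.
Hypothesis x_orth : forall t (Y : T -> R),
  bounded_measurable (Y : g_sigma_algebraType (G t) -> R) -> \int[P]_w (Y w * x t w) = 0.

Let prd (lam : R) n w := \prod_(t < n) (1 + lam * x t w).

(** Boundedness and adaptedness allow the product itself to serve as the test function [Y] in the
    orthogonality hypothesis. *)
Lemma prd_bounded_measurable lam n :
  bounded_measurable (prd lam n : g_sigma_algebraType (G n) -> R).
Proof.
elim: n => [|n [mp [C pC]]].
  rewrite (_ : prd lam 0 = fun=> 1); first exact: bounded_measurable_cst.
  by apply/funext => w; rewrite /prd big_ord0.
rewrite (_ : prd lam n.+1 = fun w => prd lam n w * (1 + lam * x n w)); last first.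
  by apply/funext => w; rewrite /prd big_ord_recr.
have bx : bounded_measurable (x n : g_sigma_algebraType (G n.+1) -> R).
  by split; [exact: x_meas | exists K].
apply: (@bounded_measurableM _ (g_sigma_algebraType (G n.+1))).
  by split; [move=> _ B mB; apply: G_mono; exact: mp | exists C].
apply: (@bounded_measurableD _ (g_sigma_algebraType (G n.+1))).
  exact: bounded_measurable_cst.
by apply: (@bounded_measurableM _ (g_sigma_algebraType (G n.+1))) => //; exact: bounded_measurable_cst.
Qed.

Lemma bounded_measurable_sub t (Y : T -> R) :
  bounded_measurable (Y : g_sigma_algebraType (G t) -> R) -> bounded_measurable Y.
Proof. by move=> [mY bY]; split=> // _ B mB; apply: (@sG t); exact: mY. Qed.

Lemma prd_integral lam n : \int[P]_w prd lam n w = 1.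
Proof.
elim: n => [|n IH].
  under eq_Rintegral do rewrite /prd big_ord0.
  rewrite Rintegral_cst // mul1r.
  by have p1 : fine (P [set: T]) = 1 by rewrite probability_setT.
have bp := bounded_measurable_sub (prd_bounded_measurable lam n).
have bx : bounded_measurable (x n).
  apply: (@bounded_measurable_sub n.+1).
  by split; [exact: x_meas | exists K].
under eq_Rintegral do rewrite /prd big_ord_recr /= mulrDr mulr1 mulrCA.
have bpx := bounded_measurableM bp bx.
rewrite RintegralD //; first last.
- apply: bounded_measurable_integrable.
  by apply: bounded_measurableM => //; exact: bounded_measurable_cst.
- exact: bounded_measurable_integrable.
rewrite IH RintegralZl //; last exact: bounded_measurable_integrable.
by rewrite (x_orth (prd_bounded_measurable lam n)) mulr0 addr0.
Qed.

Lemma martingale_concentration (lam delta : R) (n : nat) :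
  0 < lam -> lam * K <= 2^-1 -> 0 < delta ->
  exists2 E : set T, measurable E /\ ((1 - delta)%:E <= P E)%E &
    forall w, E w -> \sum_(t < n) x t w <= 2 * lam * K ^+ 2 * n%:R + ln (1 / delta) / lam.
Proof.
move=> lam0 lamK d0.
have bp := bounded_measurable_sub (prd_bounded_measurable lam n); have [mp _] := bp.
have lx t w : `|lam * x t w| <= 2^-1.
  rewrite normrM gtr0_norm //; apply: le_trans lamK; exact/ler_wpM2l/x_le/ltW.
have p0 w : 0 <= prd lam n w.
  apply: prodr_ge0 => t _; have := lx t w; rewrite ler_norml => /andP[]; lra.
(* The exceptional event. The product is nonnegative, as each factor is at least 1/2, so Markov's
   inequality bounds its probability by [delta]. *)
pose B := [set w | delta^-1 <= prd lam n w].
have mB : measurable B.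
  rewrite (_ : B = prd lam n @^-1` `[delta^-1, +oo[%classic); last first.
    by apply/seteqP; split=> w; rewrite /= in_itv /= andbT.
  by rewrite -[X in measurable X]setTI; apply: mp => //; exact: measurable_itv.
have PB : (P B <= delta%:E)%E.
  have di : 0 < delta^-1 by rewrite invr_gt0.
  have mEp : measurable_fun setT (EFin \o prd lam n) by exact/measurable_EFinP.
  have := le_integral_abse P measurableT mEp di.
  have -> : (\int[P]_w `|(EFin \o prd lam n) w| = 1%:E)%E.
    rewrite -(prd_integral lam n) /Rintegral fineK; last first.
      by apply: integrable_fin_num => //; exact: bounded_measurable_integrable.
    by apply: eq_integral => w _ /=; rewrite ger0_norm.
  have -> : setT `&` [set w | ((delta^-1)%:E <= `|(EFin \o prd lam n) w|)%E] = B.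
    by rewrite setTI; apply/seteqP; split=> w /=; rewrite lee_fin ger0_norm.
  move=> h; have {h} : ((delta^-1)%:E * P B <= 1%:E)%E := h.
  have PBf : P B \is a fin_num by exact: fin_num_measure.
  rewrite -(fineK PBf) -EFinM !lee_fin ler_pdivrMl // mulr1; exact.
exists (~` B); first split; first exact: measurableC.
  have PBf : P B \is a fin_num by exact: fin_num_measure.
  rewrite probability_setC // -(fineK PBf) -EFinB lee_fin lerD2l lerN2.
  by rewrite -lee_fin fineK.
move=> w /negP; rewrite -ltNge => pw.
have ex : expR (\sum_(t < n) (lam * x t w - 2 * (lam * x t w) ^+ 2)) <= prd lam n w.
  rewrite expR_sum; apply: ler_prod => t _.
  by rewrite expR_ge0 expR_quadratic_le.
have ln_le : \sum_(t < n) (lam * x t w - 2 * (lam * x t w) ^+ 2) <= ln (1 / delta).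
  rewrite -ler_expR lnK ?posrE ?div1r ?invr_gt0 //.
  exact: le_trans ex (ltW pw).
have sq : \sum_(t < n) 2 * (lam * x t w) ^+ 2 <= 2 * lam ^+ 2 * K ^+ 2 * n%:R.
  have -> : 2 * lam ^+ 2 * K ^+ 2 * n%:R = \sum_(t < n) 2 * lam ^+ 2 * K ^+ 2.
    by rewrite sumr_const card_ord mulr_natr.
  apply: ler_sum => t _.
  have h : x t w ^+ 2 <= K ^+ 2.
    rewrite -(real_normK (num_real (x t w))) ler_sqr ?nnegrE //.
    exact: le_trans (x_le t w).
  have := ler_wpM2l (sqr_ge0 lam) h; rewrite exprMn; lra.
rewrite sumrB -mulr_sumr in ln_le.
have lamE : lam * (2 * lam * K ^+ 2 * n%:R + ln (1 / delta) / lam)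
   = 2 * lam ^+ 2 * K ^+ 2 * n%:R + ln (1 / delta) by field; rewrite gt_eqF.
rewrite -(ler_pM2l lam0) lamE; lra.
Qed.

End concentration.

(** * The algorithm along the sampled noise *)

Section stochastic_run.
Context (R : realType) (N n m : nat) (Gm : game R N n m).
Context d (Omega : measurableType d) (P : probability Omega R).
Context (xi : forall i : 'I_N, Omega -> 'rV[R]_(noise_dim Gm i))
        (xit : forall i : 'I_N, nat -> Omega -> 'rV[R]_(noise_dim Gm i)).
Hypothesis Hstoch : stochastic_setting P xi xit.
Context (W : nat -> 'M[R]_N) (Lsig L M : R).
Hypothesis Hgame : game_assumption (cost P xi) Lsig L M.
Context (x0 : profile Gm) (Hx0 : in_prod x0) (al be ga : nat -> R).

(** The generators of the filtration: they make the past a measurable space in its own right, so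
    that adaptedness is ordinary measurability on it. *)
Definition past (t : nat) : set (set Omega) :=
  [set A | exists i s B, [/\ (s < t)%N, borel B & A = xit i s @^-1` B]].

Lemma filtrationE t : filtration xit t = <<s past t >>.
Proof. by []. Qed.

Lemma past_measurable t A : <<s past t >> A -> measurable A.
Proof.
move=> sA; have [_ H _ _ _] := Hstoch.
apply: (smallest_sub _ _ sA); first exact: sigma_algebra_measurable.
by move=> _ [i [s [B [_ bB ->]]]]; have [mxi _] := H i s; exact: mxi.
Qed.

Lemma past_mono s t A : (s <= t)%N -> <<s past s >> A -> <<s past t >> A.
Proof.
move=> le_st; apply: sub_sigma_algebra2 => _ [i [u [B [us bB ->]]]].
by exists i, u, B; split=> //; exact: leq_trans us le_st.
Qed.

Definition noise_path w (s : nat) : noise Gm := fun i => xit i s w.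
Local Notation xw w t i := (traj_x W x0 al be ga (noise_path w) t i).
Local Notation yw w t i := (traj_y W x0 al be ga (noise_path w) t i).
Local Notation sw w t i := (st_sigma (traj W x0 al be ga (noise_path w) t) i).
Local Notation mw w t i k := (traj_mu W x0 al be ga (noise_path w) t i k).

Local Notation meas t f := (measurable_fun (setT : set (g_sigma_algebraType (past t))) f).

Lemma meas_mono s t (f : Omega -> R) : (s <= t)%N -> meas s f -> meas t f.
Proof. by move=> traj mf _ B mB; apply: (past_mono traj); exact: mf. Qed.

Lemma measurable_run_y t : (forall i k, meas t (fun w => sw w t i 0 k)) ->
  forall i k, meas t (fun w => yw w t i 0 k).
Proof.
move=> ms i k; rewrite /traj_y.
under eq_fun => w.
  rewrite mxE summxE; under eq_bigr do rewrite mxE; over.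
apply: measurable_funM => //; apply: measurable_sum => j.
exact: measurable_funM.
Qed.

Lemma run_in w t : in_prod (traj_x W x0 al be ga (noise_path w) t).
Proof. exact: (traj_x_in W Hgame Hx0). Qed.

Lemma measurable_run_q t i k : (forall i k, meas t (fun w => xw w t i 0 k)) ->
  (forall i k, meas t (fun w => sw w t i 0 k)) ->
  meas t.+1 (fun w => q_map i (xw w t i) (yw w t i) (noise_path w t i) 0 k).
Proof.
move=> mx ms; have [_ _ mF dF _] := Hstoch.
have [_ _ _ _ [Hpsi _]] := Hgame.
apply: (@measurable_q_map _ (g_sigma_algebraType (past t.+1))).
- by move=> j; apply: (meas_mono (leqnSn t)).
- by move=> j; apply: (meas_mono (leqnSn t)); exact: measurable_run_y.
- by move=> B bB; apply: sub_sigma_algebra; exists i, t, B.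
- exact: mF.
- by move=> w; apply: dF; exact: run_in.
- by move=> w; apply: (Hpsi i).1; exact: run_in.
Qed.

Lemma constr_differentiable i u : strat Gm i u -> differentiable (constr Gm i) u.
Proof.
move=> su; apply: differentiable_coords => k; exact: (constr_diff Hgame k su).
Qed.

(** Adaptedness of the state, which the oracle demands of its query points. The derivatives are
    handled by the lemmas on random points, the projection by its continuity. *)
Lemma measurable_run t :
  [/\ forall i k, meas t (fun w => xw w t i 0 k),
      forall i k, meas t (fun w => sw w t i 0 k) &
      forall i k, meas t (fun w => mw w t i k)].
Proof.
elim: t => [|t [mx ms mm]].
  split=> i k; rewrite /traj_x /traj_mu /=; exact: measurable_cst.
have mxS i k := meas_mono (leqnSn t) (mx i k).
have msS i k := meas_mono (leqnSn t) (ms i k).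
have mmS i k := meas_mono (leqnSn t) (mm i k).
have mmuh i k : meas t.+1 (fun w => traj_muh W x0 al be ga (noise_path w) t i 0 k).
  under eq_fun do rewrite traj_muhE.
  by apply: measurable_sum => j; exact: measurable_funM.
have mnuh i k : meas t.+1 (fun w => traj_nu W x0 al be ga (noise_path w) t i 0 k).
  under eq_fun do rewrite mxE.
  exact: measurable_funM.
have mJ i a b : meas t.+1 (fun w => ('J (constr Gm i) (xw w t i)) a b).
  apply: (@measurable_jacobian _ (g_sigma_algebraType (past t.+1))) => // w.
  exact/constr_differentiable/run_in.
have mdir i k : meas t.+1 (fun w => traj_dir W x0 al be ga (noise_path w) t i 0 k).
  have dirE w : traj_dir W x0 al be ga (noise_path w) t i 0 k =
      q_map i (xw w t i) (yw w t i) (noise_path w t i) 0 k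
      + \sum_j traj_nu W x0 al be ga (noise_path w) t i 0 j * ('J (constr Gm i) (xw w t i)) k j.
    rewrite /traj_dir mxE; congr (_ + _); rewrite mxE.
    by apply: eq_bigr => j _; rewrite [X in _ * X]mxE.
  rewrite (funext dirE); apply: measurable_funD; first exact: measurable_run_q.
  by apply: measurable_sum => j; exact: measurable_funM.
have mxn i k : meas t.+1 (fun w => xw w t.+1 i 0 k).
  have [C0 cC kC] := strat_props Hgame i.
  under eq_fun do rewrite traj_xS.
  apply: (@measurable_continuous_comp _ (g_sigma_algebraType (past t.+1)) _ _ _
    (fun v _ => (eproj (strat Gm i) v) 0 k)).
  - apply: approximable_rV => j; under eq_fun do rewrite mxE [X in _ + X]mxE [X in _ - X]mxE.
    by apply: measurable_funB => //; exact: measurable_funM.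
  - by move=> u; exact: measurable_cst.
  - by move=> w; exact: eproj_coord_continuous.
have mpsi s i k : (forall i k, meas t.+1 (fun w => xw w s i 0 k)) ->
    meas t.+1 (fun w => psi Gm i (xw w s i) 0 k).
  move=> mxs; apply: (@measurable_comp_differentiable _ (g_sigma_algebraType (past t.+1))) => // w.
  by have [_ _ _ _ [Hpsi _]] := Hgame; apply: (Hpsi i).1; exact: run_in.
split=> // i k.
  under eq_fun do rewrite sigma_step !mxE summxE.
  apply: measurable_funD; last by apply: measurable_funB; exact: mpsi.
  apply: measurable_sum => j; under eq_fun do rewrite mxE.
  exact: measurable_funM.
under eq_fun do rewrite traj_muS.
apply: measurable_maxr => //; apply: measurable_funD => //.
apply: measurable_funM => //; apply: measurable_funB; last exact: measurable_funM.
apply: (@measurable_comp_differentiable _ (g_sigma_algebraType (past t.+1))) => // w.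
exact/constr_differentiable/run_in.
Qed.

End stochastic_run.

(** * Oracle errors as bounded martingale differences *)

Section clipping.
Context (R : realType) (c : R) (c_ge0 : 0 <= c).

Definition clip (r : R) : R := Num.max (- c) (Num.min c r).

Lemma clip_le r : `|clip r| <= c.
Proof.
by rewrite ler_norml /clip le_max lexx /= ge_max ge_min lexx /= andbT; have := c_ge0; lra.
Qed.

Lemma clip_id r : `|r| <= c -> clip r = r.
Proof. by rewrite ler_norml /clip => /andP[h1 h2]; rewrite min_r // max_r. Qed.

Lemma measurable_clip d (T : measurableType d) (f : T -> R) :
  measurable_fun setT f -> measurable_fun setT (fun w => clip (f w)).
Proof.
move=> mf; apply: measurable_maxr; first exact: measurable_cst.
by apply: measurable_minr => //; exact: measurable_cst.
Qed.

Lemma clip_bounded_measurable d (T : measurableType d) (f : T -> R) :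
  measurable_fun setT f -> bounded_measurable (fun w => clip (f w)).
Proof. by move=> mf; split; [exact: measurable_clip | exists c => w; exact: clip_le]. Qed.

End clipping.

Lemma ae_eq_Rintegral d (T : measurableType d) (R : realType) (P : probability T R)
    (A : set T) (f g : T -> R) : measurable A -> measurable_fun setT f ->
  measurable_fun setT g -> {ae P, forall w, f w = g w} ->
  \int[P]_(w in A) f w = \int[P]_(w in A) g w.
Proof.
move=> mA mf mg fg; congr fine; apply: ae_eq_integral => //.
- by apply/measurable_EFinP; exact: measurable_funTS.
- by apply/measurable_EFinP; exact: measurable_funTS.
- by apply: filterS fg => w /= -> _.
Qed.

(** The constant is the mean of [Z], hence of [f], and [f] agrees almost surely with its clipping at
    [S]. *)
Lemma ae_constant_le d (T : measurableType d) (R : realType) (P : probability T R)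
    (f Z : T -> R) (c S : R) : 0 <= S -> measurable_fun setT f -> measurable_fun setT Z ->
  {ae P, forall w, Z w = c} -> \int[P]_w f w = \int[P]_w Z w ->
  {ae P, forall w, `|f w| <= S} -> `|c| <= S.
Proof.
move=> S0 mf mZ Zc E fS.
have <- : \int[P]_w Z w = c.
  rewrite (ae_eq_Rintegral measurableT mZ (measurable_cst c) Zc) Rintegral_cst //.
  have p1 : fine (P [set: T]) = 1 by rewrite probability_setT.
  by rewrite -[RHS]mulr1 -[X in _ = _ * X]p1.
rewrite -E (ae_eq_Rintegral measurableT mf (measurable_clip S mf)).
  apply: Rintegral_le_bound; first exact: clip_bounded_measurable.
  by move=> w; exact: clip_le.
by apply: filterS fS => w hw; rewrite clip_id.
Qed.

Lemma Rintegral_sum_eq0 d (T : measurableType d) (R : realType) (P : probability T R)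
    (I : Type) (s : seq I) (f : I -> T -> R) :
  (forall i, bounded_measurable (f i)) -> (forall i, \int[P]_w f i w = 0) ->
  \int[P]_w (\sum_(i <- s) f i w) = 0.
Proof.
move=> bf f0; elim: s => [|i s IH].
  under eq_Rintegral do rewrite big_nil.
  by rewrite Rintegral_cst // mul0r.
under eq_Rintegral do rewrite big_cons.
rewrite RintegralD ?IH ?f0 ?addr0 //; first exact: bounded_measurable_integrable.
exact/bounded_measurable_integrable/bounded_measurable_sum.
Qed.

Section oracle_noise.
Context (R : realType) (N n m : nat) (Gm : game R N n m).
Context d (Omega : measurableType d) (P : probability Omega R).
Context (xi : forall i : 'I_N, Omega -> 'rV[R]_(noise_dim Gm i))
        (xit : forall i : 'I_N, nat -> Omega -> 'rV[R]_(noise_dim Gm i)).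
Hypothesis Hstoch : stochastic_setting P xi xit.
Context (W : nat -> 'M[R]_N) (Lsig L M : R) (L_gt0 : 0 < L).
Hypothesis Hgame : game_assumption (cost P xi) Lsig L M.
Context (iota S : R) (S_gt0 : 0 < S).
Hypothesis Horacle : oracle_assumption P xi xit iota S.
Context (x0 : profile Gm) (Hx0 : in_prod x0) (al be ga : nat -> R).
Context (xs : profile Gm) (xs_in : in_prod xs).

Let S_ge0 : 0 <= S. Proof. exact: ltW. Qed.

Local Notation xw w t i := (traj_x W x0 al be ga (noise_path xit w) t i).
Local Notation yw w t i := (traj_y W x0 al be ga (noise_path xit w) t i).
Local Notation q w t i := (q_map i (xw w t i) (yw w t i) (noise_path xit w t i)).
Local Notation p w t i := (p_map (cost P xi) i (xw w t i) (yw w t i)).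
Local Notation meas t f := (measurable_fun (setT : set (g_sigma_algebraType (past xit t))) f).

Lemma meas_wrt_past_rV t k (v : Omega -> 'rV[R]_k) :
  (forall j, meas t (fun w => v w 0 j)) -> meas_wrt (filtration xit t) v.
Proof. exact: (@meas_wrt_rV _ (g_sigma_algebraType (past xit t))). Qed.

Lemma meas_wrt_past_cst t k (v : 'rV[R]_k) : meas_wrt (filtration xit t) (fun=> v).
Proof. by apply: meas_wrt_past_rV => j; exact: measurable_cst. Qed.

Lemma meas_past_measurable t (f : Omega -> R) : meas t f -> measurable_fun setT f.
Proof. by move=> mf _ B mB; apply: (past_measurable Hstoch (t := t)); exact: mf. Qed.

(* The bound S holds almost surely only; applying the oracle at t = 0 with constant
   arguments turns it into a bound on p everywhere. *)
Lemma p_map_le i x y k : strat Gm i x -> `|p_map (cost P xi) i x y 0 k| <= S.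
Proof.
move=> xX.
have [H1 _ H3] := @Horacle 0%N i (fun=> x) (fun=> y)
  (@meas_wrt_past_cst 0 _ x) (@meas_wrt_past_cst 0 _ y) (fun=> xX).
have [Z [iq iZ mZ HZ] Zp] := H1 k.
have mq : measurable_fun setT (fun w => q_map i x y (xit i 0 w) 0 k).
  by apply/measurable_EFinP; case/integrableP: iq.
have mZ' : measurable_fun setT Z.
  by apply/measurable_EFinP; case/integrableP: iZ.
have E : \int[P]_w (q_map i x y (xit i 0 w) 0 k) = \int[P]_w Z w.
  congr fine; apply: HZ; rewrite filtrationE.
  exact: (@measurableT _ (g_sigma_algebraType (past xit 0))).
have {}Zp : {ae P, forall w, Z w = p_map (cost P xi) i x y 0 k} := Zp.
have {}H3 : {ae P, forall w, enorm (q_map i x y (xit i 0 w)) <= S} := H3.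
have qS : {ae P, forall w, `|q_map i x y (xit i 0 w) 0 k| <= S}.
  by apply: filterS H3 => w; apply: le_trans; exact: coord_le_enorm.
exact: (ae_constant_le S_ge0 mq mZ' Zp E qS).
Qed.

Definition good_noise w := forall t i, enorm (q w t i) <= S.

(** The conditional expectation stands in for p, with which it agrees almost surely, since it is
    measurable with respect to the past by definition. Countably many times and finitely many
    coordinates leave a single null set to discard. *)
Lemma oracle_noise_differences :
  exists h : forall (t : nat) (i : 'I_N), 'I_(Defs.dim Gm i) -> Omega -> R,
  [/\ forall t i k, meas t.+1 (h t i k),
      forall t i k w, `|h t i k w| <= 2 * S,
      forall t i k A, <<s past xit t >> A -> \int[P]_(w in A) h t i k w = 0 &
      {ae P, forall w, good_noise w /\ forall t i k, h t i k w = p w t i 0 k - q w t i 0 k}].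
Proof.
have mrun := measurable_run Hstoch W Hgame Hx0 al be ga.
have xX w t : in_prod (traj_x W x0 al be ga (noise_path xit w) t) by exact: (traj_x_in W Hgame Hx0).
have mx t i : meas_wrt (filtration xit t) (fun w => xw w t i).
  by apply: meas_wrt_past_rV => j; have [mx _ _] := mrun t; exact: mx.
have my t i : meas_wrt (filtration xit t) (fun w => yw w t i).
  by apply: meas_wrt_past_rV => j; have [_ ms _] := mrun t; exact: measurable_run_y.
have or t i := Horacle (mx t i) (my t i) (fun w => xX w t i).
have Zex t i k : {Z | is_cond_exp P (filtration xit t) (fun w => q w t i 0 k) Z &
    {ae P, forall w, Z w = p w t i 0 k}}.
  by apply: cid2; have [H _ _] := or t i; exact: H.
pose Z t i k : Omega -> R := s2val (Zex t i k).
have Zce t i k : is_cond_exp P (filtration xit t) (fun w => q w t i 0 k) (Z t i k).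
  exact: (s2valP (Zex t i k)).
have Zp t i k : {ae P, forall w, Z t i k w = p w t i 0 k} by exact: (s2valP' (Zex t i k)).
have qS t i : {ae P, forall w, enorm (q w t i) <= S} by have [_ _ H] := or t i; exact: H.
have mq t i k : meas t.+1 (fun w => q w t i 0 k).
  by have [mx' ms _] := mrun t; exact: (measurable_run_q Hstoch Hgame).
have mZ t i k : meas t (Z t i k).
  have [_ _ mz _] := Zce t i k.
  exact/(@meas_wrt_measurable_fun _ (g_sigma_algebraType (past xit t))).
(* Clipping makes the differences bounded everywhere without changing them almost
   surely. *)
exists (fun t i k w => clip S (Z t i k w) - clip S (q w t i 0 k)); split.
- move=> t i k; apply: measurable_funB; last exact: measurable_clip.
  by apply: measurable_clip; exact: (meas_mono (leqnSn t)).
- move=> t i k w; apply: le_trans (ler_normB _ _) _.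
  by have h1 := clip_le S_ge0 (Z t i k w); have h2 := clip_le S_ge0 (q w t i 0 k); lra.
- move=> t i k A sA; have mA := past_measurable Hstoch sA.
  have mZ' := meas_past_measurable (mZ t i k).
  have mq' := meas_past_measurable (mq t i k).
  have bi (f : Omega -> R) : measurable_fun setT f ->
      P.-integrable A (EFin \o (fun w => clip S (f w))).
    move=> mf; apply: (integrableS measurableT) => //.
    by apply: bounded_measurable_integrable; exact: clip_bounded_measurable.
  rewrite RintegralB //; [|exact: bi mZ'|exact: bi mq'].
  apply/eqP; rewrite subr_eq0; apply/eqP.
  rewrite -(ae_eq_Rintegral mA mZ' (measurable_clip S mZ')); last first.
    apply: filterS (Zp t i k) => w ->; rewrite clip_id //.
    exact/p_map_le/xX.
  rewrite -(ae_eq_Rintegral mA mq' (measurable_clip S mq')); last first.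
    apply: filterS (qS t i) => w hw; rewrite clip_id //.
    exact: le_trans (coord_le_enorm _ _ _) hw.
  by have [_ _ _ H] := Zce t i k; congr fine; rewrite H.
- have qS' : {ae P, forall w, good_noise w}.
    by apply/ae_foralln => t; apply: filter_forall => i; exact: qS.
  have Zp' : {ae P, forall w, forall t i k, Z t i k w = p w t i 0 k}.
    by apply/ae_foralln => t; do 2!apply: filter_forall => ?; exact: Zp.
  apply: filterS2 qS' Zp' => w hq hZ; split=> // t i k.
  have e1 := clip_id (p_map_le (yw w t i) k (xX w t i)).
  have e2 := clip_id (le_trans (coord_le_enorm _ 0 k) (hq t i)).
  exact: (congr2 (fun a b : R => a - b) (etrans (congr1 (clip S) (hZ t i k)) e1) e2).
Qed.

Local Notation noise w t := (noise_term W (cost P xi) x0 xs al be ga (noise_path xit w) t).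

Definition noise_bound : R := dsum Gm * (2 * S * (2 * L)).

Lemma noise_concentration (lam delta : R) (T : nat) :
  0 < lam -> lam * noise_bound <= 2^-1 -> 0 < delta ->
  exists2 E : set Omega, measurable E /\ ((1 - delta)%:E <= P E)%E &
    {ae P, forall w, E w -> good_noise w /\
      \sum_(1 <= t < T.+1) noise w t <=
        2 * lam * noise_bound ^+ 2 * T%:R + ln (1 / delta) / lam}.
Proof.
move=> lam0 lamK d0.
have [h [mh hb h0 hae]] := oracle_noise_differences.
have mrun := measurable_run Hstoch W Hgame Hx0 al be ga.
have xX w t : in_prod (traj_x W x0 al be ga (noise_path xit w) t) by exact: (traj_x_in W Hgame Hx0).
pose y t i k w : R := (xw w t i - xs i) 0 k.
have yb t i k w : `|y t i k w| <= 2 * L by exact: (strat_diff_le Hgame k (xX w t i) (xs_in i)).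
have my t i k : meas t (y t i k).
  rewrite /y; under eq_fun do rewrite mxE.
  by apply: measurable_funD; [have [mx _ _] := mrun t; exact: mx | exact: measurable_cst].
(* The average starts at time 1, so difference number t is the noise at time [t.+1]: measurable for
   [past t.+2] and orthogonal to [past t.+1]. *)
pose x t w := \sum_i \sum_k h t.+1 i k w * y t.+1 i k w.
have L2 : 0 <= 2 * L by rewrite mulr_ge0 // ltW.
have S2 : 0 <= 2 * S by rewrite mulr_ge0.
have bh t i k : bounded_measurable (h t.+1 i k).
  by split; [exact: (meas_past_measurable (mh _ _ _)) | exists (2 * S)].
have bY t i k (Y : Omega -> R) :
    bounded_measurable (Y : g_sigma_algebraType (past xit t.+1) -> R) ->
    bounded_measurable ((fun w => y t.+1 i k w * Y w) : g_sigma_algebraType (past xit t.+1) -> R).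
  move=> bY; apply: (@bounded_measurableM _ (g_sigma_algebraType (past xit t.+1))) => //.
  by split; [exact: my | exists (2 * L)].
have [|||||E [mE PE] HE] := @martingale_concentration _ Omega R P (fun t => past xit t.+1)
    _ _ x noise_bound _ _ _ lam delta T lam0 lamK d0.
- by move=> t A; exact: (past_measurable Hstoch).
- by move=> t A; exact: past_mono.
- move=> t; apply: measurable_sum => i; apply: measurable_sum => k.
  by apply: measurable_funM => //; apply: (meas_mono (leqnSn t.+1)).
- move=> t w; apply: le_trans (ler_norm_sum _ _ _) _.
  rewrite /noise_bound /dsum mulr_suml; apply: ler_sum => i _.
  apply: le_trans (ler_norm_sum _ _ _) _.
  rewrite mulr_natl -[X in _ *+ X](card_ord (Defs.dim Gm i)) -sumr_const.
  by apply: ler_sum => k _; rewrite normrM ler_pM.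
- move=> t Y bYt.
  have E0 i k : \int[P]_w (y t.+1 i k w * Y w * h t.+1 i k w) = 0.
    apply: (Rintegral_orthogonal _ (bh t i k) _ (bY t i k Y bYt)).
      by move=> A; exact: (past_measurable Hstoch).
    by move=> A; exact: h0.
  have bz i k : bounded_measurable (fun w => y t.+1 i k w * Y w * h t.+1 i k w).
    apply: bounded_measurableM => //; have [mz zb] := bY t i k Y bYt.
    by split=> //; exact: (meas_past_measurable mz).
  have -> : \int[P]_w (Y w * x t w)
      = \int[P]_w (\sum_i \sum_k y t.+1 i k w * Y w * h t.+1 i k w).
    apply: eq_Rintegral => w _; rewrite /x mulr_sumr; apply: eq_bigr => i _.
    by rewrite mulr_sumr; apply: eq_bigr => k _; ring.
  apply: Rintegral_sum_eq0 => i; first exact: bounded_measurable_sum.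
  exact: Rintegral_sum_eq0.
exists E => //; apply: filterS hae => w [gw hw] Ew; split=> //.
have := HE w Ew.
rewrite -(big_mkord xpredT (fun t => x t w)) big_add1 /=.
have nE t : noise w t.+1 = x t w.
  apply: eq_bigr => i _; apply: eq_bigr => k _.
  rewrite [X in X * _]mxE [X in _ + X]mxE.
  exact: (congr1 (fun a : R => a * y t.+1 i k w) (esym (hw t.+1 i k))).
by rewrite (eq_bigr (fun t => x t w) (fun t _ => nE t)).
Qed.

End oracle_noise.

(** * From the summed bound to the time average and the rate *)

Lemma sqr_average_le (R : realType) (x : nat -> R) (c : R) (T : nat) : (0 < T)%N ->
  (T%:R^-1 * \sum_(1 <= t < T.+1) x t - c) ^+ 2 * T%:R
    <= \sum_(1 <= t < T.+1) (x t - c) ^+ 2.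
Proof.
move=> T0; have Tr : 0 < T%:R :> R by rewrite ltr0n.
set b := T%:R^-1 * _.
have cst (r : R) : \sum_(1 <= t < T.+1) r = T%:R * r.
  by rewrite sumr_const_nat subSS subn0 mulr_natl.
have : 0 <= \sum_(1 <= t < T.+1) (x t - b) ^+ 2 by apply: sumr_ge0 => t _; exact: sqr_ge0.
have -> : \sum_(1 <= t < T.+1) (x t - b) ^+ 2 = \sum_(1 <= t < T.+1) (x t - c) ^+ 2
    + 2 * (c - b) * \sum_(1 <= t < T.+1) x t + \sum_(1 <= t < T.+1) (b ^+ 2 - c ^+ 2).
  by rewrite mulr_sumr -!big_split /=; apply: eq_bigr => t _; ring.
have -> : \sum_(1 <= t < T.+1) x t = T%:R * b by rewrite /b mulVKf ?gt_eqF.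
rewrite cst; lra.
Qed.

Lemma enorm_time_average_le (R : realType) (N n m : nat) (Gm : game R N n m)
    (x : nat -> profile Gm) (xs : profile Gm) (T : nat) : (0 < T)%N ->
  enorm (stack (time_average x T) - stack xs) ^+ 2 * T%:R
    <= \sum_(1 <= t < T.+1) \sum_i enorm (x t i - xs i) ^+ 2.
Proof.
move=> T0; rewrite enorm_stackB exchange_big mulr_suml /=; apply: ler_sum => i _.
under eq_bigr do rewrite enorm_sqr big_ord1.
rewrite enorm_sqr big_ord1 exchange_big mulr_suml /=; apply: ler_sum => k _.
under eq_bigr do rewrite !mxE.
by rewrite !mxE summxE; exact: sqr_average_le.
Qed.

Lemma probability_le_ae d (T : measurableType d) (R : realType) (P : probability T R)
    (E F : set T) : measurable E -> measurable F ->
  {ae P, forall w, E w -> F w} -> (P E <= P F)%E.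
Proof.
move=> mE mF [A [mA PA HA]].
have sub : E `<=` F `|` A.
  move=> w Ew; case: (pselect (F w)) => [|nF]; [by left | right].
  by apply: HA => /(_ Ew).
apply: le_trans (le_measure P _ _ sub) _; rewrite ?inE //; first exact: measurableU.
apply: le_trans (measureU2 P mF mA) _.
by move: PA => /= ->; rewrite adde0.
Qed.

(** With lam = c T^(-a1) the quadratic term is of order T^(1 - a1), absorbed by the rate as rate <=
    a1, and after division by T the term l / lam is of order T^(-(1 - a1)) l. *)
Lemma concentration_rate (R : realType) (D A mu T Tr a c K l lam : R) :
  0 < mu -> 0 < T -> 0 < c -> 0 <= Tr -> 0 < a -> lam = c * a -> a <= Tr -> 0 <= l -> 0 <= A ->
  2 * mu * (D * T) <= A * (T * Tr) + 2 * (2 * lam * K ^+ 2 * T + l / lam) ->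
  D <= (A + 4 * c * K ^+ 2 + 2 / c) / (2 * mu) * (Tr + (T * a)^-1 * l).
Proof.
move=> mu0 T0 c0 Tr0 a0 -> aT l0 A0 H.
have m0 : 0 < 2 * mu by rewrite mulr_gt0.
have b0 : 0 <= (T * a)^-1 * l by rewrite mulr_ge0 // invr_ge0 mulr_ge0 ?(ltW T0) ?(ltW a0).
rewrite mulrAC ler_pdivlMr // -(ler_pM2r T0).
have -> : D * (2 * mu) * T = 2 * mu * (D * T) by ring.
apply: le_trans H _.
have -> : l / (c * a) = T * (c^-1 * ((T * a)^-1 * l)) by field; rewrite !gt_eqF.
move: (_^-1 * l) b0 => b b0.
have c1 : 0 <= c^-1 by rewrite invr_ge0 ltW.
have h1 : c * K ^+ 2 * a <= c * K ^+ 2 * Tr by rewrite ler_wpM2l // mulr_ge0 ?sqr_ge0 // ltW.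
have h2 := mulr_ge0 A0 b0.
have h3 := mulr_ge0 (mulr_ge0 (ltW c0) (sqr_ge0 K)) b0.
have h4 := mulr_ge0 c1 Tr0.
have := ler_wpM2r (ltW T0) h1; have := mulr_ge0 h2 (ltW T0).
have := mulr_ge0 h3 (ltW T0); have := mulr_ge0 h4 (ltW T0).
lra.
Qed.

Theorem theorem3 (R : realType) (N n m : nat) (N_gt0 : (0 < N)%N)
    (Gm : game R N n m)
    (d : measure_display) (Omega : measurableType d) (P : probability Omega R)
    (xi : forall i : 'I_N, Omega -> 'rV[R]_(noise_dim Gm i))
    (xit : forall i : 'I_N, nat -> Omega -> 'rV[R]_(noise_dim Gm i))
    (Hstoch : stochastic_setting P xi xit)
    (edge : nat -> rel 'I_N) (W : nat -> 'M[R]_N)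
    (HW : weighted_adjacency edge W)
    (Hgraph : graph_assumption edge W)
    (Lsig L M : R) (Lsig_gt0 : 0 < Lsig) (L_gt0 : 0 < L) (M_gt0 : 0 < M)
    (Hgame : game_assumption (cost P xi) Lsig L M)
    (Lf : R) (Lf_gt0 : 0 < Lf)
    (Hlip : lipschitz_assumption (cost P xi) Lf)
    (iota S : R) (iota_gt0 : 0 < iota) (S_gt0 : 0 < S)
    (Horacle : oracle_assumption P xi xit iota S)
    (mu : R) (mu_gt0 : 0 < mu)
    (Hmono : strongly_monotone (cost P xi) mu)
    (a1 a2 a3 : R) (a1_gt0 : 0 < a1) (a1_lt1 : a1 < 1)
    (a3_gt0 : 0 < a3) (a3_lt1 : a3 < 1)
    (a2_gt0 : 0 < 2 * a2) (a12 : 2 * a2 < a1) (a23 : 2 * a2 + a3 < 1)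
    (x0 : profile Gm) (Hx0 : in_prod x0)
    (xs : profile Gm) (Hxs : is_vGNE (cost P xi) xs) :
  exists2 C : R, 0 < C &
    forall (T : nat) (delta : R), (4 <= T)%N -> 0 < delta -> delta < 1 ->
      let rate := Num.min (1 - a1) (Num.min (1 - 2 * a2 - a3)
                    (Num.min a3 (Num.min a2 (a1 - 2 * a2)))) in
      let x w t := st_x (run W (power_step a1) (power_step a2) (power_step a3)
                             (fun s i => xit i s w) x0 t) in
      ((1 - delta)%:E <=
         P [set w | (enorm (stack (time_average (x w) T) - stack xs) ^+ 2
                     <= C * (T%:R `^ (- rate)
                             + T%:R `^ (- (1 - a1)) * ln (1 / delta)))%R])%E.
Proof.
have [[w0 [w0_gt0 w0_lt1 w0_lb]] W_sum [U [U_gt0 conn]]] := Hgraph.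
have W_ge0 t i j : 0 <= W t i j.
  have [We W0 Wd] := HW t; case: (eqVneq i j) => [->|ij]; first exact: ltW.
  by case: (boolP (edge t j i)) => [/We/ltW //|ne]; rewrite W0.
have W_lb t i j : edge t j i || (i == j) -> w0 <= W t i j.
  have [We W0 Wd] := HW t.
  by move=> /orP[/We|/eqP ->]; apply: w0_lb.
have [[[xs_in xs_le] _] [mus mus_ge0 Hkkt]] := Hxs.
have a2_pos : 0 < a2 by lra.
have al_itv := fun t => power_step_itv t (ltW a1_gt0).
have be_itv := fun t => power_step_itv t (ltW a2_pos).
have ga_itv := fun t => power_step_itv t (ltW a3_gt0).
have al_dec := fun t => power_step_dec t (ltW a1_gt0).
have be_dec := fun t => power_step_dec t (ltW a2_pos).
have ga_dec := fun t => power_step_dec t (ltW a3_gt0).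
have al_be t : power_step a1 t <= power_step a2 t by apply: power_step_le; lra.
have [C0 C0_gt0 consensus] := push_sum_consensus conn w0_gt0 W_ge0 W_sum W_lb N_gt0.
have [Cr Cr_gt0 HCr] := rate_sum a1_gt0 a1_lt1 a3_gt0 a3_lt1 a2_gt0 a12 a23.
set Cf := trajectory_const U w0 Lsig L M Lf S x0 mus C0.
pose K := noise_bound Gm L S.
have K_ge0 : 0 <= K.
  by rewrite mulr_ge0 ?dsum_ge0 // !mulr_ge0 // ltW.
(* As T^(-a1) <= 1, this makes [lam * K] at most 1/2, the condition for the exponential bound; the 1
   covers the case [K = 0]. *)
pose c := (2 * (K + 1))^-1.
have c_gt0 : 0 < c by rewrite invr_gt0; lra.
exists ((`|Cf| * Cr + 4 * c * K ^+ 2 + 2 / c) / (2 * mu)).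
  rewrite divr_gt0 ?mulr_gt0 // ltr_wpDl ?divr_gt0 //.
  apply: addr_ge0; first by apply: mulr_ge0 => //; exact: ltW.
  by apply: mulr_ge0; [apply: mulr_ge0 => //; exact: ltW | exact: sqr_ge0].
move=> T delta T4 delta_gt0 delta_lt1; cbv zeta.
set rate := Num.min (1 - a1) _.
pose x w t := st_x (run W (power_step a1) (power_step a2) (power_step a3)
                      (noise_path xit w) x0 t).
have T0 : (0 < T)%N by apply: leq_trans T4.
have Tr0 : 0 < T%:R :> R by rewrite ltr0n.
have T1 : 1 <= T%:R :> R by rewrite ler1n.
pose a := T%:R `^ (- a1).
have a_gt0 : 0 < a by rewrite powR_gt0.
have a_le1 : a <= 1.
  by rewrite -[leRHS](powRr0 T%:R) ler_powR // oppr_le0 ltW.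
pose lam := c * a.
have lam_gt0 : 0 < lam by rewrite mulr_gt0.
have lamK : lam * K <= 2^-1.
  apply: (@le_trans _ _ (c * K)).
    by apply: ler_wpM2r => //; apply: ler_piMr => //; exact: ltW.
  rewrite /c mulrC ler_pdivrMr //; lra.
have [E [mE PE] HE] := noise_concentration Hstoch W L_gt0 Hgame S_gt0 Horacle Hx0
  (power_step a1) (power_step a2) (power_step a3) xs_in T lam_gt0 lamK delta_gt0.
have TE : T = T.-1.+1 by rewrite prednK.
pose F := [set w | enorm (stack (time_average (x w) T) - stack xs) ^+ 2 <=
  (`|Cf| * Cr + 4 * c * K ^+ 2 + 2 / c) / (2 * mu)
    * (T%:R `^ (- rate) + T%:R `^ (- (1 - a1)) * ln (1 / delta))].
apply: le_trans PE _; rewrite -/(F : set _).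
apply: (@probability_le_ae _ _ _ P E F) => //.
  (* Comparing the probabilities of [E] and [F] requires [F] to be an event, which follows from
     adaptedness of the iterates. *)
  pose sq w := enorm (stack (time_average (x w) T) - stack xs) ^+ 2.
  have msq : measurable_fun setT sq.
    have sqE w : sq w = \sum_i \sum_k (T%:R^-1 * \sum_(1 <= t < T.+1) x w t i 0 k - xs i 0 k) ^+ 2.
      rewrite /sq enorm_stackB; apply: eq_bigr => i _; rewrite enorm_sqr big_ord1.
      by apply: eq_bigr => k _; rewrite !mxE summxE.
    rewrite (funext sqE); apply: measurable_sum => i; apply: measurable_sum => k.
    apply: measurable_funX; apply: measurable_funB => //.
    apply: measurable_funM => //; apply: measurable_sum => t.
    have [mx _ _] := measurable_run Hstoch W Hgame Hx0 (power_step a1) (power_step a2)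
      (power_step a3) t.
    exact: (meas_past_measurable Hstoch (mx i k)).
  rewrite (_ : F = sq @^-1` `]-oo, (`|Cf| * Cr + 4 * c * K ^+ 2 + 2 / c) / (2 * mu)
    * (T%:R `^ (- rate) + T%:R `^ (- (1 - a1)) * ln (1 / delta))]%classic).
    by rewrite -[X in measurable X]setTI; apply: msq => //; exact: measurable_itv.
  by apply/seteqP; split=> w; rewrite /= in_itv.
apply: filterS HE => w HEw Ew; have {HEw} [good noise_le] := HEw Ew.
have := @trajectory_sum R N n m N_gt0 Gm edge U w0 W conn w0_gt0 W_ge0 W_sum W_lb
  (cost P xi) Lsig L M Lf mu S Lsig_gt0 L_gt0 M_gt0 Lf_gt0 S_gt0 Hgame Hlip Hmono
  x0 Hx0 xs mus (conj xs_in xs_le) mus_ge0 Hkkt _ _ _ al_itv be_itv ga_itv al_dec be_dec ga_dec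
  al_be (noise_path xit w) good C0 C0_gt0 consensus T.-1.
rewrite -TE -/Cf; have := HCr T T0; rewrite -/rate.
have Z_ge0 : 0 <= 1 + (power_step a1 T)^-1 + (power_step a3 T * power_step a2 T ^+ 2)^-1 +
    (\sum_(0 <= t < T.+1) power_step a1 t / power_step a2 t ^+ 2
     + \sum_(0 <= t < T.+1) power_step a2 t + \sum_(0 <= t < T.+1) power_step a3 t).
  have ge0 b t : 0 < b -> 0 <= power_step b t.
    by move=> b0; have /andP[/ltW] := power_step_itv t (ltW b0).
  rewrite !addr_ge0 ?invr_ge0 ?mulr_ge0 ?exprn_ge0 ?ge0 // sumr_ge0 // => t _; rewrite ?ge0 //.
  by rewrite divr_ge0 ?exprn_ge0 ?ge0.
move: Z_ge0; set Z := (1 + _ + _ + _) => Z_ge0 HZ traj.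
have avg := enorm_time_average_le (x w) xs T0.
have rate_le : rate <= a1.
  have : rate <= a1 - 2 * a2 by rewrite /rate !ge_min lexx !orbT.
  lra.
rewrite /F /mkset.
have -> : T%:R `^ (- (1 - a1)) = (T%:R * a)^-1 :> R.
  rewrite powRN; congr (_^-1).
  by rewrite powRD ?powRr1 // pnatr_eq0 -lt0n T0 implybT.
apply: (@concentration_rate R _ _ mu T%:R (T%:R `^ (- rate)) a c K _ lam) => //.
- by rewrite /a ler_powR // lerN2.
- by rewrite ln_ge0 // div1r invf_ge1 // ltW.
- by rewrite mulr_ge0 // ltW.
apply: (@le_trans _ _ (Cf * Z + 2 * (2 * lam * K ^+ 2 * T%:R + ln (1 / delta) / lam))).
  apply: le_trans (ler_wpM2l _ avg) _; first by rewrite mulr_ge0 // ltW.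
  by apply: le_trans traj _; rewrite lerD2l ler_wpM2l.
rewrite lerD2r -mulrA; apply: (@le_trans _ _ (`|Cf| * Z)).
  by rewrite ler_wpM2r // ler_norm.
by rewrite ler_wpM2l.
Qed.
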